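(* Let $d\ge 1$ and let $X\in\mathbb{R}^d$ and $Y\in\mathbb{R}^d$ be mean-zero Gaussian random vectors with covariance matrices $\Sigma_X$ and $\Sigma_Y$ satisfying $\Sigma_Y-\Sigma_X\succeq 0$. Let $\mathcal{K}\subseteq\mathbb{R}^d$ be a closed convex set. Then $$\Pr(Y\in\mathcal{K})\ge\tfrac12\;\Longrightarrow\;\Pr(X\in\mathcal{K})\ge\Pr(Y\in\mathcal{K}).$$
   Context: For symmetric matrices, $A\succeq 0$ means that $A$ is positive semidefinite. The covariance matrices $\Sigma_X,\Sigma_Y$ are allowed to be singular (degenerate Gaussian vectors are permitted). No assumption is made on the joint distribution of $X$ and $Y$. *)

(* Defs.v *)
From mathcomp Require Import all_boot all_order all_algebra.
From mathcomp Require Import all_classical all_reals all_analysis.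

Set Implicit Arguments.
Unset Strict Implicit.
Unset Printing Implicit Defensive.

Import Order.TTheory GRing.Theory Num.Theory.
Import numFieldNormedType.Exports.

Local Open Scope classical_set_scope.
Local Open Scope ring_scope.

Definition psdmx (R : realType) (d : nat) (A : 'M[R]_d) : Prop :=
  A^T = A /\ forall u : 'cV[R]_d, 0 <= (u^T *m A *m u) 0 0.

(* 'cV[R]_d with its Borel sigma-algebra. *)
Notation borel_cV R d := (g_sigma_algebraType (@open 'cV[R]_d)).

(* The library's normal_prob m 0 is not the point mass at m: it is the uniform
   law on [0, 1]. Hence the separate case. *)
Definition gaussian_law (R : realType) (m s : R)
    (A : set (measurableTypeR R)) : \bar R :=
  if s == 0 then \d_m A else normal_prob m s A.

(* Possibly degenerate: every linear functional of X is univariate Gaussian,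
   point masses included. *)
Definition gaussian_vector (dT : measure_display) (T : measurableType dT)
    (R : realType) (P : probability T R) (d : nat)
    (X : {RV P >-> borel_cV R d}) : Prop :=
  forall u : 'cV[R]_d, exists m s : R, 0 <= s /\
    forall A : set (measurableTypeR R), measurable A ->
      P [set w | A ((u^T *m (X w : 'cV[R]_d)) 0 0)] = gaussian_law m s A.

Definition coordinate (dT : measure_display) (T : measurableType dT)
    (R : realType) (P : probability T R) (d : nat)
    (X : {RV P >-> borel_cV R d}) (i : 'I_d) : T -> R :=
  fun w => (X w : 'cV[R]_d) i 0.

Definition mean_zero (dT : measure_display) (T : measurableType dT)
    (R : realType) (P : probability T R) (d : nat)
    (X : {RV P >-> borel_cV R d}) : Prop :=
  forall i, ('E_P[coordinate X i] = 0)%E.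

Definition has_covariance_matrix (dT : measure_display)
    (T : measurableType dT) (R : realType) (P : probability T R) (d : nat)
    (X : {RV P >-> borel_cV R d}) (Sigma : 'M[R]_d) : Prop :=
  forall i j,
    covariance P (coordinate X i) (coordinate X j) = (Sigma i j)%:E.

(* Main.v *)
Require Import Defs.
From HB Require Import structures.
From mathcomp Require Import all_boot all_order all_algebra.
From mathcomp Require Import all_classical all_reals all_analysis.
From mathcomp Require Import measurable_realfun ring lra.
Import Order.TTheory GRing.Theory Num.Theory.
Import numFieldNormedType.Exports.
Local Open Scope classical_set_scope.
Local Open Scope ring_scope.
Set Implicit Arguments.
Unset Strict Implicit.
Unset Printing Implicit Defensive.

(** The theorem follows from Ehrhard's inequality. Write Phi for the standard
    normal distribution function and g for a standard normal variable. For a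
    direction a and a function h on R^d put
      gavg a h z = Phi^-1 (E [Phi (h (z + g a))]).
    A positive semidefinite matrix is a finite sum of squares a a^T
    (psd_sum_squares), so X has the law of a sum of independent multiples g_a a
    (gaussian_model, eq_prob_cos), and E [Phi (h X)] is Phi applied to the value
    at 0 of the function obtained from h by averaging along the a's
    (integral_Phi_gavgs). Since Sigma_Y - Sigma_X is itself a sum of squares
    b b^T, the variable Y only adds averages along the b's.

    The functional form of Ehrhard's inequality (functional_ehrhard) says that
    gavg preserves concavity. Now let h be concave, and let c + p y with
    c = h z lie above h along the line z + y b. For affine functions the average
    is explicit, Phi^-1 (E [Phi (c + p g)]) = c / sqrt (1 + p^2), hence
    sqrt (1 + p^2) * gavg b h z <= h z. If gavg b h z >= 0 this gives
    gavg b h z <= h z: passing from Y to X can only increase the level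
    (gavg_compare). Nonnegative levels are exactly probabilities at least
    1/2 = Phi 0, and this is where the hypothesis on Y is used.

    The indicator of K is reached through the concave functions
    ramp K n = n - n^2 * dist (., K), for which Phi (ramp K n) tends to the
    indicator. The level of ramp K n under Y may be slightly negative, because
    E [Phi (ramp K n Y)] is only known to be at least Phi n / 2. A negative level
    is multiplied by at most a product of factors 1 + n^2 |b|, polynomial in n,
    while the deficit 1 - Phi n decays exponentially, so the error vanishes in
    the limit (level_loss, prod_expR_decay).

    Ehrhard's inequality in one dimension, which is all that gavg needs, is
    proved by Borell's maximum principle. Under the heat flow with time s^2 / 2
    the function u = Phi^-1 (heat f s) solves u_s = s (u_xx - u u_x^2). If
    f, g, h satisfy l u_g (x) + m u_h (y) <= u_f (l x + m y) at time 0, a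
    negative minimum of the right side minus the left at a later time is
    incompatible with these three equations (max_principle). *)

(** * Integrals against normal laws *)

Section normal_integral.
Context {R : realType}.
Notation mu := (@lebesgue_measure R).

(** The density and the Radon-Nikodym derivative have the same integral over
    every measurable set, so they agree almost everywhere. *)
Lemma ge0_integral_normal_prob (m s : R) (f : R -> R) :
  measurable_fun [set: R] f -> (forall x, 0 <= f x) ->
  (\int[normal_prob m s]_x (f x)%:E =
   \int[mu]_x (f x * normal_pdf m s x)%:E)%E.
Proof.
move=> mf f0.
have dom := normal_prob_dominates m s.
have mEf : measurable_fun [set: R] (fun x => (f x)%:E) by exact/measurable_EFinP.
have mEp : measurable_fun [set: R] (fun x => (normal_pdf m s x)%:E).
  by apply/measurable_EFinP; exact: measurable_normal_pdf.
rewrite -(@Radon_Nikodym_SigmaFinite.change_of_variables _ _ _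
  (normal_prob m s) mu dom (fun x => (f x)%:E) setT) //; last first.
set rn := Radon_Nikodym_SigmaFinite.f _ _.
have irn : mu.-integrable setT rn by exact: Radon_Nikodym_SigmaFinite.f_integrable.
under [RHS]eq_integral do rewrite EFinM.
apply: ae_eq_integral => //.
- apply: emeasurable_funM => //; exact: (measurable_int mu).
- exact: emeasurable_funM.
- apply: ae_eqe_mul2l => /=; apply: integral_ae_eq => //=.
  by move=> E _ mE; rewrite -Radon_Nikodym_SigmaFinite.f_integral.
Qed.

Lemma integral_normal_prob (m s : R) (f : R -> R) :
  (normal_prob m s).-integrable [set: R] (fun x => (f x)%:E) ->
  (\int[normal_prob m s]_x (f x)%:E =
   \int[mu]_x (f x * normal_pdf m s x)%:E)%E.
Proof.
move=> intf.
have dom := normal_prob_dominates m s.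
have mEf : measurable_fun [set: R] (fun x => (f x)%:E).
  exact: (measurable_int _ intf).
have mEp : measurable_fun [set: R] (fun x => (normal_pdf m s x)%:E).
  by apply/measurable_EFinP; exact: measurable_normal_pdf.
rewrite -(Radon_Nikodym_change_of_variables dom) //=.
under [RHS]eq_integral do rewrite EFinM.
apply: ae_eq_integral => //.
- apply: emeasurable_funM => //; apply: (measurable_int mu).
- exact: emeasurable_funM.
- apply: ae_eqe_mul2l => /=; rewrite Radon_NikodymE/=.
  case: cid => /= h [h1 h2 h3].
  apply: integral_ae_eq => //=.
  by move=> E _ mE; rewrite -h3.
Qed.

Lemma normal_pdf01E (x : R) :
  normal_pdf 0 1 x = normal_peak 1 * expR (- (x ^+ 2 / 2)).
Proof.
rewrite normal_pdfE ?oner_eq0// /normal_fun subr0 expr1n.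
by rewrite mulNr -(mulr_natr 1) mul1r.
Qed.

(** Substitution x = m + s y: the peak of the density scales by 1 / s. *)
Lemma ge0_integral_normal_affine (m s : R) (f : R -> R) : 0 < s ->
  continuous f -> (forall x, 0 <= f x) ->
  (\int[normal_prob m s]_x (f x)%:E =
   \int[normal_prob 0 1]_x (f (m + s * x))%:E)%E.
Proof.
move=> s0 cf f0.
have s_neq0 : s != 0 by rewrite gt_eqF.
pose F := fun y : R => m + s * y.
have dF (y : R) : is_derive y 1 F s.
  by apply: is_derive_eq; rewrite /GRing.scale/=; ring.
have F'E : derive1 F = cst s.
  by apply/funext => y; rewrite derive1E; apply: derive_val.
have cF : continuous F.
  move=> y; apply: cvgD; first exact: cvg_cst.
  by apply: cvgM; [exact: cvg_cst|exact: cvg_id].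
have cfF : continuous (f \o F).
  by move=> y; apply: continuous_comp; [exact: cF|exact: cf].
have mf : measurable_fun [set: R] f by exact: continuous_measurable_fun.
have mfF : measurable_fun [set: R] (f \o F) by exact: continuous_measurable_fun.
have fF0 x : 0 <= (f \o F) x by exact: f0.
rewrite (ge0_integral_normal_prob m s mf f0).
rewrite (ge0_integral_normal_prob 0 1 mfF fF0).
rewrite (@increasing_ge0_integration_by_substitutionT _ F
  (fun x => f x * normal_pdf m s x)).
- apply: eq_integral => y _; congr EFin.
  rewrite F'E /= -mulrA; congr (_ * _).
  rewrite normal_pdf01E normal_pdfE// /normal_fun /F.
  rewrite fctE.
  have -> : - (m + s * y - m) ^+ 2 / (s ^+ 2 *+ 2) = - (y ^+ 2 / 2).
    rewrite -mulr_natr; field; exact: s_neq0.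
  have -> : @normal_peak R 1 = normal_peak s * s; last by rewrite /cst mulrAC.
  rewrite /normal_peak expr1n mul1r -mulrnAr sqrtrM ?sqr_ge0// sqrtr_sqr.
  rewrite gtr0_norm// invfM mulrC mulrA divff// mul1r.
  by [].
- by move=> x y xy; rewrite /F ltrD2l ltr_pM2l.
- by rewrite F'E => ?; exact: cvg_cst.
- by rewrite F'E; exact: is_cvg_cst.
- by rewrite F'E; exact: is_cvg_cst.
- by move=> x; case: (dF x).
- rewrite /F; under eq_fun do rewrite addrC mulrC.
  apply: (cvg_comp _ (fun y => y + m)); last exact: cvg_addrr_Ny.
  by apply: gt0_cvgMlNy => //; exact: cvg_id.
- rewrite /F; under eq_fun do rewrite addrC mulrC.
  apply: (cvg_comp _ (fun y => y + m)); last exact: cvg_addrr.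
  by apply: gt0_cvgMly => //; exact: cvg_id.
- move=> x; apply: cvgM; [exact: cf|exact: continuous_normal_pdf].
- by move=> x; rewrite mulr_ge0// normal_pdf_ge0.
Qed.

End normal_integral.

(** * Standard normal expectations *)

Section gaussian_expectation.
Context {R : realType}.
Notation mu := (@lebesgue_measure R).
Notation gauss := (normal_prob (0 : R) 1).

Definition gE (f : R -> R) : R := \int[normal_prob (0 : R) 1]_y f y.

(** A growth class closed under linear combinations, whose members have
    Gaussian expectations, and which contains 1, y, y^2 and all bounded
    measurable functions. *)
Definition subquadratic (f : R -> R) :=
  measurable_fun [set: R] f /\
  exists C, forall y, `|f y| <= C * (1 + y ^+ 2).

(** A centred normal density of larger variance absorbs the quadratic factor;
    its total mass then bounds the integral. *)
Lemma subquadratic_pdf : exists2 K : R, 0 <= K &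
  forall y : R, (1 + y ^+ 2) * normal_pdf 0 1 y <= K * normal_pdf 0 2 y.
Proof.
have p2 : 0 < @normal_peak R 2 by apply: normal_peak_gt0; rewrite pnatr_eq0.
have p1 : 0 < @normal_peak R 1 by apply: normal_peak_gt0; rewrite oner_eq0.
exists (4 * (normal_peak 1 / normal_peak 2)).
  by rewrite mulr_ge0// divr_ge0// ltW.
move=> y; rewrite normal_pdf01E normal_pdfE ?pnatr_eq0// /normal_fun subr0.
set a := expR (- (y ^+ 2 / 2)); set b := expR _.
have -> : 4 * (normal_peak 1 / normal_peak 2) * (normal_peak 2 * b) =
  normal_peak 1 * (4 * b) by field; rewrite gt_eqF.
rewrite mulrCA ler_pM2l//.
have -> : b = a * expR (3 / 8 * y ^+ 2).
  by rewrite /a /b -expRD; congr expR; rewrite -mulr_natr; field.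
rewrite mulrC mulrCA ler_pM2l ?expR_gt0//.
have := expR_ge1Dx (3 / 8 * y ^+ 2).
have := sqr_ge0 y.
set e := expR _; set z := y ^+ 2; lra.
Qed.

Lemma integrable_subquadratic (f : R -> R) :
  subquadratic f -> gauss.-integrable [set: R] (fun x => (f x)%:E).
Proof.
move=> [mf [C fC]].
have [K K0 hK] := subquadratic_pdf.
apply/integrableP; split; first exact/measurable_EFinP.
under eq_integral do rewrite /= -/(abse _).
have mnf : measurable_fun [set: R] (fun x => `|f x|) by exact: measurableT_comp.
rewrite (ge0_integral_normal_prob 0 1 mnf (fun x => normr_ge0 (f x))).
have C0 : 0 <= C.
  have := le_trans (normr_ge0 _) (fC 0).
  by rewrite expr0n/= addr0 mulr1.
apply: (@le_lt_trans _ _ (\int[mu]_x ((C * K)%:E * (normal_pdf 0 2 x)%:E))%E).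
  apply: ge0_le_integral => //.
  - by move=> x _; rewrite lee_fin mulr_ge0// normal_pdf_ge0.
  - apply/measurable_EFinP; apply: measurable_funM => //.
    exact: measurable_normal_pdf.
  - apply: measurable_funeM; apply/measurable_EFinP.
    exact: measurable_normal_pdf.
  - move=> x _; rewrite -EFinM lee_fin -mulrA.
    apply: (@le_trans _ _ (C * (1 + x ^+ 2) * normal_pdf 0 1 x)).
      by apply: ler_wpM2r; [exact: normal_pdf_ge0|exact: fC].
    by rewrite -mulrA; apply: ler_wpM2l => //; exact: hK.
rewrite ge0_integralZl//.
- by rewrite integral_normal_pdf mule1 ltry.
- by apply/measurable_EFinP; exact: measurable_normal_pdf.
- by move=> x _; rewrite lee_fin normal_pdf_ge0.
- by rewrite lee_fin mulr_ge0.
Qed.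

Lemma bounded_subquadratic (f : R -> R) (C : R) :
  measurable_fun [set: R] f -> (forall y, `|f y| <= C) -> subquadratic f.
Proof.
move=> mf fC; split => //; exists C => y.
apply: (le_trans (fC y)); rewrite mulrDr mulr1 lerDl mulr_ge0 ?sqr_ge0//.
exact: le_trans (normr_ge0 _) (fC y).
Qed.

Lemma subquadratic_cst (c : R) : subquadratic (fun=> c).
Proof. by apply: (@bounded_subquadratic _ `|c|). Qed.

Lemma subquadraticD (f g : R -> R) :
  subquadratic f -> subquadratic g -> subquadratic (fun y => f y + g y).
Proof.
move=> [mf [C fC]] [mg [D gD]]; split; first exact: measurable_funD.
exists (C + D) => y; rewrite mulrDl.
by apply: le_trans (ler_normD _ _) _; exact: lerD.
Qed.

Lemma subquadraticZ (c : R) (f : R -> R) :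
  subquadratic f -> subquadratic (fun y => c * f y).
Proof.
move=> [mf [C fC]]; split; first exact: measurable_funM.
exists (`|c| * C) => y; rewrite normrM -mulrA.
exact: ler_wpM2l.
Qed.

Lemma subquadraticN (f : R -> R) :
  subquadratic f -> subquadratic (fun y => - f y).
Proof.
by move=> qf; under eq_fun do rewrite -mulN1r; exact: subquadraticZ.
Qed.

Lemma subquadraticB (f g : R -> R) :
  subquadratic f -> subquadratic g -> subquadratic (fun y => f y - g y).
Proof. by move=> qf qg; apply: subquadraticD => //; exact: subquadraticN. Qed.

Lemma subquadratic_sqr : subquadratic (fun y : R => y ^+ 2).
Proof.
split; first exact: measurable_funX.
by exists 1 => y; rewrite mul1r ger0_norm ?sqr_ge0// lerDr.
Qed.

Lemma subquadratic_id : subquadratic (fun y : R => y).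
Proof.
split => //; exists 1 => y; rewrite mul1r ler_norml.
have h1 : 0 <= (1 + y) ^+ 2 by exact: sqr_ge0.
have h2 : 0 <= (1 - y) ^+ 2 by exact: sqr_ge0.
have h3 : 0 <= y ^+ 2 by exact: sqr_ge0.
by apply/andP; split; nra.
Qed.

Lemma gED (f g : R -> R) : subquadratic f -> subquadratic g ->
  gE (fun y => f y + g y) = gE f + gE g.
Proof. by move=> qf qg; apply: RintegralD => //; exact: integrable_subquadratic. Qed.

Lemma gEB (f g : R -> R) : subquadratic f -> subquadratic g ->
  gE (fun y => f y - g y) = gE f - gE g.
Proof. by move=> qf qg; apply: RintegralB => //; exact: integrable_subquadratic. Qed.

Lemma gEZ (c : R) (f : R -> R) : subquadratic f ->
  gE (fun y => c * f y) = c * gE f.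
Proof. by move=> qf; apply: RintegralZl => //; exact: integrable_subquadratic. Qed.

Lemma gE_cst (c : R) : gE (fun=> c) = c.
Proof.
rewrite /gE Rintegral_cst//.
by rewrite [X in fine X](@probability_setT _ _ _ gauss) mulr1.
Qed.

Lemma le_gE (f g : R -> R) : subquadratic f -> subquadratic g ->
  (forall y, f y <= g y) -> gE f <= gE g.
Proof.
move=> qf qg fg; apply: le_Rintegral => //; exact: integrable_subquadratic.
Qed.

Lemma le_norm_gE (f g : R -> R) : subquadratic f -> subquadratic g ->
  (forall y, `|f y| <= g y) -> `|gE f| <= gE g.
Proof.
move=> qf qg fg; rewrite ler_norml; apply/andP; split.
  rewrite lerNl -mulN1r -gEZ//; apply: le_gE => //.
    exact: subquadraticZ.
  by move=> y; rewrite mulN1r lerNl; have := fg y; rewrite ler_norml => /andP[].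
by apply: le_gE => // y; apply: le_trans (fg y); exact: ler_norm.
Qed.

Lemma EFin_gE (f : R -> R) : subquadratic f ->
  ((gE f)%:E = \int[gauss]_y (f y)%:E)%E.
Proof.
move=> qf; rewrite /gE /Rintegral fineK//; apply: integrable_fin_num => //.
exact: integrable_subquadratic.
Qed.

End gaussian_expectation.

(** * Calculus in one variable *)

Section calculus.
Context {R : realType}.

(** For a and b in either order, as the increments below have no sign. *)
Lemma mean_value (f f' : R -> R) : (forall x : R, is_derive x 1 f (f' x)) ->
  forall a b, exists2 c, `|c - a| <= `|b - a| & f b - f a = f' c * (b - a).
Proof.
move=> df a b.
have cf (x y : R) : {within `[x, y], continuous f}.
  apply: derivable_within_continuous => z _; by case: (df z).
have [ab|ba|->] := ltgtP a b; last by exists b; rewrite ?subrr ?normr0 ?mulr0.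
- have [c /[!in_itv]/= /andP[ac cb] E] := MVT ab (fun z _ => df z) (cf a b).
  exists c => //; rewrite !gtr0_norm ?subr_gt0//; lra.
- have [c /[!in_itv]/= /andP[ac cb] E] := MVT ba (fun z _ => df z) (cf b a).
  exists c; last by rewrite -opprB E -mulrN opprB.
  rewrite !ltr0_norm ?subr_lt0//; lra.
Qed.

(** A quadratic remainder bound passes through an expectation, whereas
    differentiability alone does not. With lipschitz_sqr_remainder this is how
    derivatives are taken under the expectation sign. *)
Lemma is_derive_sqr_remainder (f : R -> R) (x l C : R) :
  (forall s, `|f (x + s) - f x - s * l| <= C * s ^+ 2) -> is_derive x 1 f l.
Proof.
move=> H.
have cvl : h^-1 *: ((f \o shift x) (h *: 1) - f x) @[h --> 0^'] --> l.
  apply/cvgrPdist_le => e e0.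
  have C1 : 0 < `|C| + 1 by rewrite ltr_wpDl.
  near=> h.
  have h0 : h != 0 by near: h; exact: nbhs_dnbhs_neq.
  rewrite /= /GRing.scale /= mulr1 (addrC h).
  have -> : l - h^-1 * (f (x + h) - f x) = - h^-1 * (f (x + h) - f x - h * l).
    by field.
  rewrite normrM normrN normfV ler_pdivrMl ?normr_gt0//.
  apply: (le_trans (H h)); rewrite -real_normK ?num_real// expr2 mulrCA.
  apply: ler_wpM2l => //.
  apply: (@le_trans _ _ ((`|C| + 1) * `|h|)).
    by apply: ler_wpM2r => //; rewrite (le_trans (ler_norm _))// lerDl.
  rewrite mulrC -ler_pdivlMr//; near: h.
  by apply: dnbhs0_le; rewrite divr_gt0.
split; first by apply/cvg_ex; exists l.
exact: cvg_lim cvl.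
Unshelve. all: by end_near. Qed.

Lemma lipschitz_sqr_remainder (f f' : R -> R) (L : R) :
  (forall x : R, is_derive x 1 f (f' x)) ->
  (forall x y, `|f' x - f' y| <= L * `|x - y|) ->
  forall x s, `|f (x + s) - f x - s * f' x| <= L * s ^+ 2.
Proof.
move=> df Lf' x s; have [c cx E] := mean_value df x (x + s).
rewrite E (_ : x + s - x = s) in cx *; last by ring.
have -> : f' c * s - s * f' x = s * (f' c - f' x) by ring.
rewrite normrM -(real_normK (num_real s)) expr2 mulrCA; apply: ler_wpM2l => //.
apply: (le_trans (Lf' _ _)); apply: ler_wpM2l => //.
have := le_trans (normr_ge0 _) (Lf' 1 0).
by rewrite subr0 normr1 mulr1.
Qed.

Lemma bounded_deriv_lipschitz (f f' : R -> R) (B : R) :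
  (forall x : R, is_derive x 1 f (f' x)) -> (forall x, `|f' x| <= B) ->
  forall x y, `|f x - f y| <= B * `|x - y|.
Proof.
move=> df Bf' x y; have [c _ ->] := mean_value df y x.
by rewrite normrM; apply: ler_wpM2r.
Qed.

Lemma is_derive_continuous (f f' : R -> R) :
  (forall x : R, is_derive x 1 f (f' x)) -> continuous f.
Proof.
move=> df x; apply: differentiable_continuous; apply/derivable1_diffP.
by case: (df x).
Qed.

Lemma lipschitz_continuous (V : normedModType R) (f : V -> R) (L : R) :
  (forall x y, `|f x - f y| <= L * `|x - y|) -> continuous f.
Proof.
move=> Lf x; apply/cvgrPdist_le => e e0.
have L1 : 0 < `|L| + 1 by rewrite ltr_wpDl.
near=> y; apply: (le_trans (Lf _ _)).
apply: (@le_trans _ _ ((`|L| + 1) * `|x - y|)).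
  by apply: ler_wpM2r => //; rewrite (le_trans (ler_norm _))// lerDl.
rewrite mulrC -ler_pdivlMr//; near: y.
by apply: cvgr_dist_le; [exact: cvg_id|rewrite divr_gt0].
Unshelve. all: by end_near. Qed.

End calculus.

(** * Gaussian integration by parts *)

Section gaussian_by_parts.
Context {R : realType}.
Notation mu := (@lebesgue_measure R).
Notation gauss := (normal_prob (0 : R) 1).

Lemma is_derive_normal_pdf (x : R) :
  is_derive x 1 (normal_pdf (0 : R) 1) (- x * normal_pdf 0 1 x).
Proof.
have -> : normal_pdf (0 : R) 1 = fun y => normal_peak 1 * expR (- (y ^+ 2 / 2)).
  by apply/funext => y; exact: normal_pdf01E.
by apply: is_derive_eq; rewrite /GRing.scale/=; field.
Qed.

Lemma normal_pdf01_decay (x : R) : 1 <= x ->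
  (1 + x) * normal_pdf 0 1 x <= 4 * normal_peak 1 / x.
Proof.
move=> x1; rewrite normal_pdf01E expRN.
have := expR_ge1Dx (x ^+ 2 / 2); set e := expR _ => he.
have e0 : 0 < e by exact: expR_gt0.
rewrite mulrA ler_pdivrMr// mulrAC ler_pdivlMr; last lra.
have p0 : 0 <= @normal_peak R 1 by exact: normal_peak_ge0.
rewrite (_ : _ * x = normal_peak 1 * ((1 + x) * x)); last by ring.
rewrite (_ : 4 * _ * e = normal_peak 1 * (4 * e)); last by ring.
by apply: ler_wpM2l => //; nra.
Qed.

(** The density satisfies phi' (y) = - y phi (y), so (g' - y g) phi is the
    derivative of g phi, which vanishes at both infinities. *)
Lemma gauss_ibp (g g' : R -> R) (C : R) :
  (forall x : R, is_derive x 1 g (g' x)) -> continuous g' ->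
  (forall x, `|g x| <= C * (1 + `|x|)) -> subquadratic g' ->
  gE (fun y => y * g y) = gE g'.
Proof.
move=> dg cg' gC qg'.
have cg := is_derive_continuous dg.
have C0 : 0 <= C.
  by have := le_trans (normr_ge0 _) (gC 0); rewrite normr0 addr0 mulr1.
have qyg : subquadratic (fun y => y * g y).
  split; first by apply: measurable_funM => //; exact: continuous_measurable_fun.
  exists (2 * C) => y; rewrite normrM.
  apply: (@le_trans _ _ (`|y| * (C * (1 + `|y|)))); first exact: ler_wpM2l.
  rewrite -(real_normK (num_real y)); set z := `|y|.
  rewrite (_ : z * _ = C * (z * (1 + z))); last by ring.
  rewrite (_ : 2 * C * _ = C * (2 * (1 + z ^+ 2))); last by ring.
  by apply: ler_wpM2l => //; have := sqr_ge0 (1 - z); nra.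
pose H := fun x : R => g x * normal_pdf 0 1 x.
pose k := fun x : R => (g' x - x * g x) * normal_pdf 0 1 x.
have dH (x : R) : is_derive x 1 H (k x).
  have := is_derive_normal_pdf x => dp; have dgx := dg x.
  have := is_deriveM dgx dp; rewrite /GRing.scale /= => h.
  by apply: (is_derive_eq h); rewrite /k; ring.
have qk : subquadratic (fun y => g' y - y * g y) by exact: subquadraticB.
have ck : continuous k.
  move=> x; apply: cvgM; last by apply: continuous_normal_pdf; rewrite oner_eq0.
  by apply: cvgB; [exact: cg'|apply: cvgM; [exact: cvg_id|exact: cg]].
have ik : mu.-integrable [set: R] (fun x => (k x)%:E).
  have ig := integrable_subquadratic qk.
  apply/integrableP; split.
    by apply/measurable_EFinP; exact: continuous_measurable_fun.
  have mn : measurable_fun [set: R] (fun y => `|g' y - y * g y|).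
    by apply: measurableT_comp => //; exact: (proj1 qk).
  have := ge0_integral_normal_prob 0 1 mn (fun x => normr_ge0 _).
  under [RHS]eq_integral do rewrite -[normal_pdf _ _ _]ger0_norm ?normal_pdf_ge0// -normrM.
  by move=> /esym; under eq_integral do rewrite -abse_EFin; move=> ->; case/integrableP: ig.
suff : (\int[mu]_x (k x)%:E = 0)%E.
  rewrite -(@integral_normal_prob R 0 1 (fun y => g' y - y * g y)); last first.
    exact: integrable_subquadratic.
  by move=> /eqP; rewrite -EFin_gE// eqe gEB// subr_eq0 => /eqP ->.
pose kn := fun n : nat => fun x : R => ((k \_ `[- n%:R, n%:R]) x)%:E.
have cv1 : (\int[mu]_x kn n x @[n --> \oo] --> \int[mu]_x (k x)%:E)%E.
  have mk : measurable_fun [set: R] k by exact: continuous_measurable_fun.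
  have := @dominated_convergence _ _ _ mu setT measurableT kn
    (fun x => (k x)%:E) (fun x => `|(k x)%:E|%E).
  case => //.
  - move=> n; apply/measurable_EFinP.
    by apply/measurable_restrict => //; rewrite setTI; exact: measurable_funTS.
  - exact/measurable_EFinP.
  - apply: aeW => x _; apply: cvg_near_cst; near=> n.
    rewrite /kn patchE ifT// inE/= in_itv/= -ler_norml.
    near: n; exact: nbhs_infty_ger.
  - exact: integrable_abse.
  - apply: aeW => x n _; rewrite /kn patchE; case: ifP => // _.
    by rewrite abse0.
have cv2 : (\int[mu]_x kn n x @[n --> \oo] --> 0)%E.
  have E : \forall n \near \oo, (\int[mu]_x kn n x = (H n%:R - H (- n%:R))%:E)%E.
    near=> n.
    have -> : (\int[mu]_x kn n x = \int[mu]_(x in `[(- n%:R)%R, n%:R%R]) (k x)%:E)%E.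
      rewrite [RHS]integral_mkcond; apply: eq_integral => x _.
      by rewrite /kn !patchE; case: ifP.
    rewrite EFinB.
    rewrite (@continuous_FTC2 _ k H)//.
    - rewrite gtrN// ltr0n; near: n; exact: nbhs_infty_gt.
    - exact: continuous_subspaceT.
    - split.
      + by move=> x _; case: (dH x).
      + by apply: cvg_at_right_filter; exact: (is_derive_continuous dH).
      + by apply: cvg_at_left_filter; exact: (is_derive_continuous dH).
    - by move=> x _; rewrite derive1E; apply: derive_val.
  suff : ((H n%:R - H (- n%:R))%:E @[n --> \oo] --> 0%:E)%E.
    apply: cvg_trans; apply: near_eq_cvg; near=> n; apply/esym.
    by near: n; exact: E.
  apply/fine_cvgP; split; first by apply: nearW.
  rewrite /comp /=.
  have Hb n : (0 < n)%N -> `|H n%:R - H (- n%:R)| <= 8 * C * normal_peak 1 * (n%:R)^-1.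
    move=> n0.
    have n1 : (1 : R) <= n%:R by rewrite ler1n.
    have pN : normal_pdf 0 1 (- n%:R : R) = normal_pdf 0 1 n%:R.
      by rewrite !normal_pdf01E sqrrN.
    rewrite /H pN -mulrBl normrM (ger0_norm (normal_pdf_ge0 _ _ _)).
    have := normal_pdf01_decay n1; have := normal_pdf_ge0 0 1 (n%:R : R).
    set p := normal_pdf _ _ _ => p0 hp.
    apply: (@le_trans _ _ (2 * C * ((1 + n%:R) * p))).
      rewrite mulrA; apply: ler_wpM2r => //.
      apply: (le_trans (ler_normB _ _)).
      have := gC n%:R; have := gC (- n%:R); rewrite normrN (ger0_norm (ler0n _ _)); lra.
    rewrite (_ : 8 * C * _ / _ = 2 * C * (4 * normal_peak 1 / n%:R)); last by ring.
    by apply: ler_wpM2l => //; rewrite mulr_ge0.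
  apply/cvgr0Pnorm_le => e e0; near=> n.
  have n0 : (0 < n)%N by near: n; exact: nbhs_infty_gt.
  apply: (le_trans (Hb n n0)).
  rewrite ler_pdivrMr ?ltr0n// -ler_pdivrMl//; near: n.
  exact: nbhs_infty_ger.
by apply: cvg_unique cv1 cv2.
Unshelve. all: by end_near. Qed.

End gaussian_by_parts.

(** * The heat flow *)

Section heat_flow.
Context {R : realType}.

(** The Lipschitz bound on f2 is what controls the remainder when f1 is
    differentiated under an expectation. *)
Definition C2b (B : R) (f f1 f2 : R -> R) := [/\
  forall x : R, is_derive x 1 f (f1 x),
  forall x : R, is_derive x 1 f1 (f2 x),
  forall x, [/\ `|f x| <= B, `|f1 x| <= B & `|f2 x| <= B] &
  forall x y, `|f2 x - f2 y| <= B * `|x - y|].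

(** The heat semigroup at time s^2 / 2. *)
Definition heat (f : R -> R) (s x : R) : R := gE (fun y => f (x + s * y)).

Lemma continuous_affine_comp (f : R -> R) (x s : R) :
  continuous f -> continuous (fun y => f (x + s * y)).
Proof.
move=> cf y; apply: (@continuous_comp _ _ _ (fun y => x + s * y) f).
  apply: cvgD; first exact: cvg_cst.
  by apply: cvgM; [exact: cvg_cst|exact: cvg_id].
exact: cf.
Qed.

Lemma subquadratic_heat (f : R -> R) (B x s : R) :
  continuous f -> (forall x, `|f x| <= B) ->
  subquadratic (fun y => f (x + s * y)).
Proof.
move=> cf fB; apply: (@bounded_subquadratic _ _ B) => //.
by apply: continuous_measurable_fun; exact: continuous_affine_comp.
Qed.

Lemma subquadraticMid (f : R -> R) (B : R) :
  continuous f -> (forall x, `|f x| <= B) -> subquadratic (fun y => y * f y).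
Proof.
move=> cf fB; have [m [C hC]] := @subquadratic_id R.
split; first by apply: measurable_funM => //; exact: continuous_measurable_fun.
exists (C * B) => y; rewrite normrM mulrAC.
by apply: ler_pM => //.
Qed.

Lemma norm_heat_le (f : R -> R) (B s x : R) :
  continuous f -> (forall x, `|f x| <= B) -> `|heat f s x| <= B.
Proof.
move=> cf fB; rewrite -[leRHS](@gE_cst R); apply: le_norm_gE => //.
  exact: subquadratic_heat.
exact: subquadratic_cst.
Qed.

Lemma is_derive_heat_x (f f' : R -> R) (B s x : R) :
  (forall x : R, is_derive x 1 f (f' x)) ->
  (forall x, `|f x| <= B) -> (forall x, `|f' x| <= B) ->
  (forall x y, `|f' x - f' y| <= B * `|x - y|) ->
  is_derive x 1 (heat f s) (heat f' s x).
Proof.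
move=> df fB f'B Lf'.
have cf := is_derive_continuous df.
have cf' := lipschitz_continuous Lf'.
apply: (@is_derive_sqr_remainder _ _ _ _ B) => h.
have q0 := subquadratic_heat x s cf fB.
have q1 := subquadratic_heat (x + h) s cf fB.
have q2 := subquadratic_heat x s cf' f'B.
rewrite /heat -gEZ// -gEB// -gEB//; last 2 first.
- exact: subquadraticB.
- exact: subquadraticZ.
rewrite -[leRHS](@gE_cst R); apply: le_norm_gE.
- by apply: subquadraticB; [exact: subquadraticB|exact: subquadraticZ].
- exact: subquadratic_cst.
- move=> y; rewrite (_ : x + h + s * y = x + s * y + h); last by ring.
  exact: lipschitz_sqr_remainder.
Qed.

(** The heat equation in the variable s: differentiating under the expectation
    gives E [Y f1 (x + s Y)], and integrating by parts gives s E [f2 (x + s Y)]. *)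
Lemma is_derive_heat_s (f f1 f2 : R -> R) (B s x : R) :
  (forall x : R, is_derive x 1 f (f1 x)) ->
  (forall x : R, is_derive x 1 f1 (f2 x)) -> continuous f2 ->
  (forall x, `|f x| <= B) -> (forall x, `|f1 x| <= B) ->
  (forall x, `|f2 x| <= B) ->
  is_derive s 1 (fun s => heat f s x) (s * heat f2 s x).
Proof.
move=> df df1 cf2 fB f1B f2B.
have cf := is_derive_continuous df.
have cf1 := is_derive_continuous df1.
have Lf1 := bounded_deriv_lipschitz df1 f2B.
have -> : s * heat f2 s x = gE (fun y => y * f1 (x + s * y)).
  rewrite /heat -gEZ; last exact: subquadratic_heat f2B.
  apply/esym; apply: (@gauss_ibp _ _ _ B).
  - move=> y; have dh : is_derive y 1 (fun y : R => x + s * y) s.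
      by apply: is_derive_eq; rewrite /GRing.scale/=; ring.
    have := @is_derive1_comp R f1 (fun y : R => x + s * y) y _ _ (df1 _) dh.
    by rewrite mulrC.
  - have cf2' := @continuous_affine_comp f2 x s cf2.
    by move=> y; apply: cvgM; [exact: cvg_cst|exact: cf2'].
  - move=> y; apply: (le_trans (f1B _)); rewrite ler_peMr//.
      exact: le_trans (normr_ge0 _) (f1B 0).
    by rewrite lerDl.
  - by apply: subquadraticZ; exact: subquadratic_heat f2B.
apply: (@is_derive_sqr_remainder _ _ _ _ (gE (fun y => B * y ^+ 2))) => h.
have q0 := subquadratic_heat x s cf fB.
have q1 := subquadratic_heat x (s + h) cf fB.
have q2 : subquadratic (fun y => y * f1 (x + s * y)).
  apply: (@subquadraticMid _ B); first exact: continuous_affine_comp.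
  by move=> y.
have q3 : subquadratic (fun y : R => B * y ^+ 2).
  exact/subquadraticZ/subquadratic_sqr.
rewrite /heat -gEZ// -gEB// -gEB//; last 2 first.
- exact: subquadraticB.
- exact: subquadraticZ.
rewrite (mulrC _ (h ^+ 2)) -gEZ//; apply: le_norm_gE.
- by apply: subquadraticB; [exact: subquadraticB|exact: subquadraticZ].
- exact: subquadraticZ.
- move=> y; rewrite (_ : x + (s + h) * y = x + s * y + h * y); last by ring.
  have := lipschitz_sqr_remainder df Lf1 (x + s * y) (h * y).
  by rewrite exprMn mulrA (mulrCA _ B) mulrA (mulrC h).
Qed.

Lemma heat1 (f : R -> R) : heat f 1 0 = gE f.
Proof. by rewrite /heat; congr gE; apply/funext => y; rewrite add0r mul1r. Qed.

Lemma heat0 (f : R -> R) x : heat f 0 x = f x.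
Proof.
rewrite /heat -[RHS](@gE_cst R); congr gE.
by apply/funext => y; rewrite mul0r addr0.
Qed.

(** Since cos'' = - cos, the heat equation makes heat cos s c * expR (s^2 / 2)
    constant in s. *)
Lemma gE_cos (c u : R) : gE (fun y => cos (c + u * y)) = cos c * expR (- (u ^+ 2 / 2)).
Proof.
pose F s := heat (@cos R) s c * expR (s ^+ 2 / 2).
have cosB (x : R) : `|cos x| <= 1 by rewrite ler_norml cos_geN1 cos_le1.
have sinB (x : R) : `|- sin x| <= 1.
  by rewrite normrN ler_norml sin_geN1 sin_le1.
have ncosB (x : R) : `|- cos x| <= 1 by rewrite normrN.
have dF (s : R) : is_derive s 1 F 0.
  have h1 : is_derive s 1 (fun s => heat (@cos R) s c)
      (s * heat (fun x => - cos x) s c).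
    apply: (@is_derive_heat_s _ (fun x => - sin x) _ 1) => //.
    by move=> x; apply: continuousN; exact: continuous_cos.
  have -> : F = fun s => heat (@cos R) s c * expR (s ^+ 2 / 2) by [].
  apply: is_derive_eq; rewrite /GRing.scale/=.
  have -> : heat (fun x => - cos x) s c = - heat (@cos R) s c.
    rewrite /heat -mulN1r -gEZ; last first.
      by apply: (@subquadratic_heat _ 1) => //; exact: continuous_cos.
    by congr gE; apply/funext => y; rewrite mulN1r.
  by field.
have := is_derive_0_is_cst u 0 dF.
rewrite /F heat0 expr0n/= mul0r expR0 mulr1 => <-.
by rewrite -mulrA -expRD subrr expR0 mulr1.
Qed.

Lemma gE_sqr : gE (fun y : R => y ^+ 2) = 1.
Proof.
transitivity (gE (fun y : R => y * y)).
  by congr gE; apply/funext => y; rewrite expr2.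
rewrite (@gauss_ibp _ (fun y => y) (fun=> 1) 1) ?gE_cst//.
- by move=> x; exact: cvg_cst.
- by move=> x; rewrite mul1r lerDr.
- exact: subquadratic_cst.
Qed.

Lemma gE_id : gE (fun y : R => y) = 0.
Proof.
transitivity (gE (fun y : R => y * 1)).
  by congr gE; apply/funext => y; rewrite mulr1.
rewrite (@gauss_ibp _ (fun=> 1) (fun=> 0) 1) ?gE_cst//.
- by move=> x; exact: cvg_cst.
- by move=> x; rewrite normr1 mul1r lerDl.
- exact: subquadratic_cst.
Qed.

Lemma heat_lipschitz (f : R -> R) (B L s s' x x' : R) :
  (forall x, `|f x| <= B) -> (forall x y, `|f x - f y| <= L * `|x - y|) ->
  `|heat f s x - heat f s' x'| <= L * `|x - x'| + L * 2 * `|s - s'|.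
Proof.
move=> fB Lf; have cf := lipschitz_continuous Lf.
have L0 : 0 <= L.
  by have := le_trans (normr_ge0 _) (Lf 1 0); rewrite subr0 normr1 mulr1.
have q (a b : R) : subquadratic (fun y => f (a + b * y)).
  exact: subquadratic_heat fB.
have q1 : subquadratic (fun y : R => L * `|s - s'| * (1 + y ^+ 2)).
  apply/subquadraticZ/subquadraticD; last exact: subquadratic_sqr.
  exact: subquadratic_cst.
rewrite /heat -gEB//; set c := L * `|x - x'|.
have -> : c + L * 2 * `|s - s'| =
    gE (fun y : R => c + L * `|s - s'| * (1 + y ^+ 2)).
  rewrite gED//; last exact: subquadratic_cst.
  rewrite gEZ; last first.
    by apply: subquadraticD; [exact: subquadratic_cst|exact: subquadratic_sqr].
  rewrite gED; [|exact: subquadratic_cst|exact: subquadratic_sqr].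
  by rewrite !gE_cst gE_sqr; ring.
apply: le_norm_gE; first exact: subquadraticB.
  by apply: subquadraticD => //; exact: subquadratic_cst.
move=> y; apply: (le_trans (Lf _ _)); rewrite /c -mulrA -mulrDr ler_wpM2l//.
rewrite (_ : _ - _ = (x - x') + (s - s') * y); last by ring.
apply: (le_trans (ler_normD _ _)); rewrite lerD2l normrM ler_wpM2l//.
rewrite -(real_normK (num_real y)); have := sqr_ge0 (1 - `|y|).
have := normr_ge0 y; nra.
Qed.

End heat_flow.

(** * The normal distribution function *)

Section gaussian_cdf.
Context {R : realType}.
Notation mu := (@lebesgue_measure R).
Notation gauss := (normal_prob (0 : R) 1).
Notation phi := (normal_pdf (0 : R) 1).

Definition Phi (x : R) : R := \int[mu]_(t in `]-oo, x]) phi t.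

Lemma is_derive_Phi (x : R) : is_derive x 1 Phi (phi x).
Proof.
have xx1 : x < x + 1 by rewrite ltrDl.
have i : mu.-integrable [set` Interval -oo%O (BRight (x + 1))] (EFin \o phi).
  by apply: integrableS (@integrable_normal_pdf R 0 1).
have cp : {for x, continuous phi}.
  by apply: continuous_normal_pdf; rewrite oner_eq0.
have [d e] := @continuous_FTC1 R phi -oo%O x _ xx1 i (ltNyr _) cp.
by apply: DeriveDef; [exact: d|rewrite -e derive1E].
Qed.

Lemma phi_gt0 (x : R) : 0 < phi x.
Proof.
by rewrite normal_pdf01E mulr_gt0 ?expR_gt0// normal_peak_gt0// oner_eq0.
Qed.

Lemma phi_le1 (x : R) : phi x <= 1.
Proof.
apply: (le_trans (normal_pdf_ub _ _ (oner_neq0 R))).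
rewrite /normal_peak expr1n mul1r -mulr_natr.
have p2 : 2 <= pi *+ 1 :> R by exact: pi_ge2.
have {}p2 : 1 <= pi * 2 :> R by rewrite mulr1n in p2; lra.
rewrite invf_le1 ?sqrtr_gt0; last exact: lt_le_trans p2.
by rewrite -[leLHS]sqrtr1 ler_sqrt// (le_trans _ p2).
Qed.

Lemma phi_mono (x y : R) : `|x| <= `|y| -> phi y <= phi x.
Proof.
move=> xy; rewrite !normal_pdf01E ler_wpM2l ?normal_peak_ge0// ler_expR.
rewrite lerN2 ler_pM2r ?invr_gt0// -(real_normK (num_real x)).
by rewrite -(real_normK (num_real y)) lerXn2r ?nnegrE.
Qed.

Lemma Phi_cdf (x : R) : (Phi x)%:E = gauss `]-oo, x]%classic.
Proof.
rewrite /Phi /Rintegral fineK//.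
apply: integrable_fin_num => //.
exact: integrableS (@integrable_normal_pdf R 0 1).
Qed.

Lemma Phi_lt : {mono Phi : x y / x < y}.
Proof.
apply: leW_mono; apply: le_mono => x y xy.
have [c _ E] := mean_value is_derive_Phi x y.
by rewrite -subr_gt0 E mulr_gt0 ?phi_gt0// subr_gt0.
Qed.

Lemma Phi_le : {mono Phi : x y / x <= y}.
Proof. by apply: le_mono => x y; rewrite Phi_lt. Qed.

Lemma Phi_gt0 (x : R) : 0 < Phi x.
Proof.
apply: (@le_lt_trans _ _ (Phi (x - 1))); last by rewrite Phi_lt gtrDl oppr_lt0.
by rewrite -lee_fin Phi_cdf; exact: measure_ge0.
Qed.

Lemma Phi_lt1 (x : R) : Phi x < 1.
Proof.
apply: (@lt_le_trans _ _ (Phi (x + 1))); first by rewrite Phi_lt ltrDl.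
by rewrite -lee_fin Phi_cdf; exact: probability_le1.
Qed.

Lemma Phi_lipschitz (x y : R) : `|Phi x - Phi y| <= 1 * `|x - y|.
Proof.
apply: bounded_deriv_lipschitz is_derive_Phi _ _ _ => z.
by rewrite ger0_norm ?phi_le1// ltW// phi_gt0.
Qed.

Lemma continuous_Phi : continuous Phi.
Proof. exact: is_derive_continuous is_derive_Phi. Qed.

Let idR : measurableTypeR R -> R := idfun.
HB.instance Definition _ :=
  @isMeasurableFun.Build _ _ _ _ idR (@measurable_id _ _ setT).

Lemma Phi_above (u : R) : u < 1 -> exists x, u < Phi x.
Proof.
move=> u1.
have : (cdf (idR : {RV gauss >-> R}) x @[x --> +oo%R] --> 1)%E by exact: cvg_cdfy1.
move=> /(_ [set y | (u%:E < y)%E]) [|x [xr hx]].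
  by apply: open_ereal_gt'; rewrite lte_fin.
exists (x + 1); rewrite -lte_fin Phi_cdf.
by apply: (hx (x + 1)); rewrite ltrDl.
Qed.

Lemma Phi_below (u : R) : 0 < u -> exists x, Phi x < u.
Proof.
move=> u0.
have : (cdf (idR : {RV gauss >-> R}) x @[x --> -oo%R] --> 0)%E by exact: cvg_cdfNy0.
move=> /(_ [set y | (y < u%:E)%E]) [|x [xr hx]].
  by apply: open_ereal_lt'; rewrite lte_fin.
exists (x - 1); rewrite -lte_fin Phi_cdf.
by apply: (hx (x - 1)); rewrite gtrDl oppr_lt0.
Qed.

Definition Phinv (u : R) : R := xget 0 [set x | Phi x = u].

Lemma PhiK : cancel Phi Phinv.
Proof.
move=> x; rewrite /Phinv; case: xgetP => [y _ /= h|/(_ x) /(_ erefl)//].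
by apply/eqP; rewrite eq_le -(Phi_le y x) -(Phi_le x y) h lexx.
Qed.

Lemma PhinvK (u : R) : 0 < u -> u < 1 -> Phi (Phinv u) = u.
Proof.
move=> u0 u1; have [a au] := Phi_below u0; have [b ub] := Phi_above u1.
have ab : a <= b by rewrite -Phi_le; lra.
have [c _ <-] : exists2 c, c \in `[a, b] & Phi c = u.
  apply: IVT => //; first by apply: continuous_subspaceT; exact: continuous_Phi.
  by rewrite min_l ?max_r ?Phi_le// !ltW.
by rewrite PhiK.
Qed.

Lemma is_derive_Phinv (u : R) : 0 < u -> u < 1 ->
  is_derive u 1 Phinv (phi (Phinv u))^-1.
Proof.
move=> u0 u1; rewrite -{1}(PhinvK u0 u1).
apply: is_derive_inverse.
- by near=> z; exact: PhiK.
- by near=> z; exact: continuous_Phi.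
- exact: is_derive_Phi.
- by rewrite gt_eqF// phi_gt0.
Unshelve. all: by end_near. Qed.

Lemma Phinv_le (u v : R) : 0 < u -> u <= v -> v < 1 -> Phinv u <= Phinv v.
Proof. by move=> u0 uv v1; rewrite -Phi_le !PhinvK//; lra. Qed.

(** Phi t + expR (1 - t) is nonincreasing and tends to 1. Far from sharp, but an
    exponential rate beats the polynomial factors it meets. *)
Lemma normal_tail (x : R) : 1 - Phi x <= expR (1 - x).
Proof.
rewrite leNgt; apply/negP => h.
have [y hy] : exists y, 1 - (1 - Phi x - expR (1 - x)) < Phi y.
  by apply: Phi_above; lra.
pose g := fun t : R => Phi t + expR (1 - t).
have dg (t : R) : is_derive t 1 g (phi t - expR (1 - t)).
  have := is_derive_Phi t => dP.
  by apply: is_derive_eq; rewrite /GRing.scale/=; ring.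
have g'0 (t : R) : phi t - expR (1 - t) <= 0.
  rewrite subr_le0 normal_pdf01E.
  have p1 : @normal_peak R 1 <= 1.
    have := phi_le1 0; rewrite normal_pdf01E expr0n/= mul0r oppr0 expR0.
    by rewrite mulr1.
  apply: (@le_trans _ _ (1 * expR (- (t ^+ 2 / 2)))).
    by rewrite ler_pM2r// expR_gt0.
  rewrite mul1r ler_expR; have := sqr_ge0 (t - 1); nra.
have yx : x <= y.
  rewrite -Phi_le; apply: ltW; apply: le_lt_trans hy.
  by have := expR_gt0 (1 - x); lra.
have [c _ E] := mean_value dg x y.
have : g y - g x <= 0 by rewrite E mulr_le0_ge0// subr_ge0.
by rewrite /g; have := expR_gt0 (1 - y); lra.
Qed.

End gaussian_cdf.

(** * Derivatives at a minimum *)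

Section derivative_tests.
Context {R : realType}.

Lemma mean_value_between (f f' : R -> R) :
  (forall x : R, is_derive x 1 f (f' x)) ->
  forall a b, a <= b -> exists2 c, a <= c <= b & f b - f a = f' c * (b - a).
Proof.
move=> df a b ab.
have cf : {within `[a, b], continuous f}.
  apply: derivable_within_continuous => z _; by case: (df z).
have [c /[!in_itv]/= ac E] := MVT_segment ab (fun z _ => df z) cf.
by exists c.
Qed.

Lemma is_derive_eps (g : R -> R) (x l e : R) : is_derive x 1 g l -> 0 < e ->
  exists2 d, 0 < d & forall h, `|h| < d -> `|g (x + h) - g x - h * l| <= e * `|h|.
Proof.
move=> [dg gl] e0.
have : h^-1 *: ((g \o shift x) (h *: 1) - g x) @[h --> 0^'] --> l.
  by rewrite -gl; exact: dg.
move=> /cvgrPdist_le /(_ e e0) [d /= d0 hd]; exists d => // h hltd.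
have [->|h0] := eqVneq h 0.
  by rewrite addr0 subrr mul0r subrr !normr0 mulr0.
have /= := hd h; rewrite sub0r normrN => /(_ hltd h0).
rewrite /= /GRing.scale /= mulr1 (addrC h).
have -> : l - h^-1 * (g (x + h) - g x) = - (g (x + h) - g x - h * l) / h.
  by field.
by rewrite normrM normrN normfV ler_pdivrMr// normr_gt0.
Qed.

(** One-sided, since a minimum over a time interval may be attained at its
    right end. *)
Lemma left_min_derive_le0 (g : R -> R) (s l : R) : 0 < s ->
  is_derive s 1 g l -> (forall t, 0 <= t <= s -> g s <= g t) -> l <= 0.
Proof.
move=> s0 dg mg; rewrite leNgt; apply/negP => l0.
have [d d0 hd] := is_derive_eps dg (divr_gt0 l0 (ltr0n R 2)).
pose h := Num.min s (d / 2).
have h0 : 0 < h by rewrite lt_min s0 divr_gt0.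
have hs : h <= s by rewrite ge_min lexx.
have hd2 : h <= d / 2 by rewrite ge_min lexx orbT.
have := hd (- h); rewrite normrN gtr0_norm// => /(_ ltac:(lra)).
have : g s <= g (s + - h) by apply: mg; lra.
rewrite ler_norml => ? /andP[_]; nra.
Qed.

Lemma min_derive_eq0 (g : R -> R) (x l : R) :
  is_derive x 1 g l -> (forall t, g x <= g t) -> l = 0.
Proof.
move=> dg mg; apply/eqP; rewrite eq_le; apply/andP; split.
  rewrite leNgt; apply/negP => l0.
  have [d d0 hd] := is_derive_eps dg (divr_gt0 l0 (ltr0n R 2)).
  have := hd (- (d / 2)); rewrite normrN gtr0_norm ?divr_gt0// => /(_ ltac:(lra)).
  have := mg (x + - (d / 2)); rewrite ler_norml => ? /andP[_]; nra.
rewrite leNgt; apply/negP => l0; rewrite -oppr_gt0 in l0.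
have [d d0 hd] := is_derive_eps dg (divr_gt0 l0 (ltr0n R 2)).
have := hd (d / 2); rewrite gtr0_norm ?divr_gt0// => /(_ ltac:(lra)).
have := mg (x + d / 2); rewrite ler_norml => ? /andP[_]; nra.
Qed.

Lemma min_second_derive_ge0 (g g' : R -> R) (x l : R) :
  (forall t : R, is_derive t 1 g (g' t)) -> is_derive x 1 g' l ->
  (forall t, g x <= g t) -> 0 <= l.
Proof.
move=> dg dg' mg; rewrite leNgt; apply/negP => l0; rewrite -oppr_gt0 in l0.
have g'x := min_derive_eq0 (dg x) mg.
have [d d0 hd] := is_derive_eps dg' (divr_gt0 l0 (ltr0n R 2)).
have xd : x < x + d / 2 by rewrite ltrDl divr_gt0.
have cg : {within `[x, x + d / 2], continuous g}.
  apply: derivable_within_continuous => z _; by case: (dg z).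
have [c /[!in_itv]/= /andP[xc cx] E] := MVT xd (fun z _ => dg z) cg.
have := mg (x + d / 2); rewrite -subr_ge0 E.
have := hd (c - x); rewrite gtr0_norm ?subr_gt0// => /(_ ltac:(lra)).
rewrite g'x subr0 [x + (c - x)]addrC subrK ler_norml => /andP[_ h1] h2.
have xc0 : 0 < c - x by rewrite subr_gt0.
have gc : g' c < 0 by have := mulr_gt0 l0 xc0; nra.
have h3 : 0 < x + d / 2 - x by lra.
by move: h2; rewrite leNgt nmulr_rlt0// h3.
Qed.

End derivative_tests.

(** * The heat flow on the scale of Phi *)

Section height.
Context {R : realType}.
Notation phi := (normal_pdf (0 : R) 1).
Variables (B d : R) (f f1 f2 : R -> R).
Hypotheses (d0 : 0 < d) (fC2 : C2b B f f1 f2).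
Hypothesis fd : forall x, d <= f x <= 1 - d.

Let cf : continuous f.
Proof. by case: fC2 => df _ _ _; exact: is_derive_continuous df. Qed.

Let fB x : `|f x| <= B. Proof. by case: fC2 => _ _ /(_ x)[]. Qed.
Let f1B x : `|f1 x| <= B. Proof. by case: fC2 => _ _ /(_ x)[]. Qed.
Let f2B x : `|f2 x| <= B. Proof. by case: fC2 => _ _ /(_ x)[]. Qed.
Let cf2 : continuous f2.
Proof. by case: fC2 => _ _ _; exact: lipschitz_continuous. Qed.

(** The level, in standard deviations, at which heat f s x sits. On this scale
    the heat equation becomes u_s = s (u_xx - u u_x^2), see
    is_derive_height_s; slope and curv are the derivatives u_x and u_xx. *)
Definition height (s x : R) : R := Phinv (heat f s x).
Definition slope (s x : R) : R := heat f1 s x / phi (height s x).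
Definition curv (s x : R) : R :=
  heat f2 s x / phi (height s x) + height s x * slope s x ^+ 2.

Lemma heat_itv (s x : R) : d <= heat f s x <= 1 - d.
Proof.
have q := subquadratic_heat x s cf fB.
apply/andP; split.
  rewrite -[leLHS](@gE_cst R); apply: le_gE => //; first exact: subquadratic_cst.
  by move=> y; case/andP: (fd (x + s * y)).
rewrite -[leRHS](@gE_cst R); apply: le_gE => //; first exact: subquadratic_cst.
by move=> y; case/andP: (fd (x + s * y)).
Qed.

Lemma Phi_height (s x : R) : Phi (height s x) = heat f s x.
Proof. have /andP[h1 h2] := heat_itv s x; apply: PhinvK; have := d0; lra. Qed.

Definition height_bound : R := Num.max `|Phinv d| `|Phinv (1 - d)|.

Lemma norm_height_le (s x : R) : `|height s x| <= height_bound.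
Proof.
have /andP[h1 h2] := heat_itv s x.
have a1 : Phinv d <= height s x by apply: Phinv_le => //; have := d0; lra.
have a2 : height s x <= Phinv (1 - d) by apply: Phinv_le => //; have := d0; lra.
have b1 := lerNnormlW (lexx `|Phinv d|); have b2 := ler_norm (Phinv (1 - d)).
rewrite /height_bound ler_norml lerNl !le_max; apply/andP; split.
  by apply/orP; left; have := d0; lra.
by apply/orP; right; have := d0; lra.
Qed.

Lemma norm_slope_le (s x : R) : `|slope s x| <= B / phi height_bound.
Proof.
rewrite normrM normfV (gtr0_norm (phi_gt0 _)); apply: ler_pM => //.
- by rewrite invr_ge0 ltW// phi_gt0.
- by apply: norm_heat_le => //; case: fC2 => _ df1 _ _; exact: is_derive_continuous df1.
- rewrite lef_pV2 ?posrE ?phi_gt0//; apply: phi_mono.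
  by apply: le_trans (norm_height_le s x) (ler_norm _).
Qed.

Lemma is_derive_height_x (s x : R) : is_derive x 1 (height s) (slope s x).
Proof.
have /andP[h1 h2] := heat_itv s x.
case: fC2 => df df1 _ _.
have Lf1 := bounded_deriv_lipschitz df1 f2B.
have dh := @is_derive_heat_x _ f f1 B s x df fB f1B Lf1.
have dP : is_derive (heat f s x) 1 Phinv (phi (height s x))^-1.
  by apply: is_derive_Phinv; have := d0; lra.
by have := @is_derive1_comp R Phinv (heat f s) x _ _ dP dh; rewrite mulrC.
Qed.

Lemma is_derive_slope (s x : R) : is_derive x 1 (slope s) (curv s x).
Proof.
case: fC2 => df df1 _ Lf2.
have dh1 := @is_derive_heat_x _ f1 f2 B s x df1 f1B f2B Lf2.
have dhx := is_derive_height_x s x.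
have dp := is_derive_normal_pdf (height s x).
have dpc := @is_derive1_comp R phi (height s) x _ _ dp dhx.
have p0 : phi (height s x) != 0 by rewrite gt_eqF// phi_gt0.
have dV := @is_deriveV R (phi \o height s) x _ 1 p0 dpc.
have := is_deriveM dh1 dV; rewrite /GRing.scale /= => h.
apply: (is_derive_eq h); rewrite /curv /slope; field; exact: p0.
Qed.

Lemma is_derive_height_s (s x : R) :
  is_derive s 1 (fun s => height s x)
    (s * (curv s x - height s x * slope s x ^+ 2)).
Proof.
have /andP[h1 h2] := heat_itv s x.
case: fC2 => df df1 _ _.
have dh := @is_derive_heat_s _ f f1 f2 B s x df df1 cf2 fB f1B f2B.
have dP : is_derive (heat f s x) 1 Phinv (phi (height s x))^-1.
  by apply: is_derive_Phinv; have := d0; lra.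
have h := @is_derive1_comp R Phinv (fun s => heat f s x) s _ _ dP dh.
by apply: (is_derive_eq h); rewrite /curv addrK; ring.
Qed.

Lemma height_lipschitz (s s' x x' : R) :
  `|height s x - height s' x'| <=
  (phi height_bound)^-1 * (B * `|x - x'| + B * 2 * `|s - s'|).
Proof.
have df : forall x : R, is_derive x 1 f (f1 x) by case: fC2.
have Lf := bounded_deriv_lipschitz df f1B.
apply: (le_trans _ (ler_wpM2l _ (heat_lipschitz s s' x x' fB Lf))); last first.
  by rewrite invr_ge0 ltW// phi_gt0.
rewrite ler_pdivlMl ?phi_gt0// -!Phi_height.
wlog ab : s s' x x' / height s x <= height s' x'.
  move=> H; have [|/ltW] := leP (height s x) (height s' x'); first exact: H.
  by move=> h; rewrite (distrC (height s x)) (distrC (Phi _)); exact: H.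
have [c /andP[c1 c2] E] := mean_value_between (@is_derive_Phi R) ab.
rewrite (distrC (height s x)) (distrC (Phi _)) E normrM ler_wpM2r// (gtr0_norm (phi_gt0 _)).
apply: phi_mono; rewrite (ger0_norm (_ : 0 <= height_bound)); last first.
  by rewrite le_max normr_ge0.
have := norm_height_le s x; have := norm_height_le s' x'.
move: height_bound => S /ler_normlP[_ h1] /ler_normlP[h2 _].
apply/ler_normlP; split; last exact: le_trans h1.
by apply: le_trans h2; rewrite lerN2.
Qed.

Lemma height0 (x : R) : height 0 x = Phinv (f x).
Proof. by rewrite /height heat0. Qed.

(** The Lipschitz bound in s and x jointly gives continuity of the three-variable
    functions whose minimum is taken below. *)
Lemma height_continuous (T : topologicalType) (u v : T -> R) :
  continuous u -> continuous v -> continuous (fun t => height (u t) (v t)).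
Proof.
move=> cu cv t; apply/cvgrPdist_le => e e0.
pose K := (phi height_bound)^-1 * B + 1.
have B0 : 0 <= B := le_trans (normr_ge0 _) (fB 0).
have pV : 0 < (phi height_bound)^-1 by rewrite invr_gt0 phi_gt0.
have K0 : 0 < K by rewrite /K ltr_wpDl// mulr_ge0// ltW.
near=> t'.
have h1 : `|v t - v t'| <= e / (3 * K).
  by near: t'; apply: cvgr_dist_le; [exact: cv|rewrite divr_gt0// mulr_gt0].
have h2 : `|u t - u t'| <= e / (3 * K).
  by near: t'; apply: cvgr_dist_le; [exact: cu|rewrite divr_gt0// mulr_gt0].
apply: (le_trans (height_lipschitz _ _ _ _)).
apply: (@le_trans _ _ (K * (`|v t - v t'| + 2 * `|u t - u t'|))).
  rewrite -(mulrA B) -mulrDr mulrA ler_wpM2r ?addr_ge0 ?mulr_ge0//.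
  by rewrite /K lerDl.
rewrite mulrC -ler_pdivlMr// (_ : e / K = e / (3 * K) * 3); first lra.
by field; rewrite gt_eqF.
Unshelve. all: by end_near. Qed.

End height.

(** * Borell's maximum principle *)

Section borell_arith.
Context {R : realType}.

(** The contradiction at a negative minimum (s, x, y) of a penalised gap. Here
    a0, a1, a2 are heights, p0, p1, p2 slopes and q0, q1, q2 curvatures of three
    flows, k and eps are the weights of the space and time penalties, and the
    hypotheses are the first and second order conditions. The space conditions
    make the three slopes agree up to terms of order k, so in the time condition
    the terms a p^2 combine into (a0 - l a1 - m a2) p0^2, which is at most 0, plus
    an error. The error is linear in k x and k y, while k (x^2 + y^2) is
    bounded at a negative minimum; Young's inequality with weight th then makes
    it smaller than eps. *)
Lemma no_negative_minimum (l m s x y k eps S P th a0 a1 a2 p0 p1 p2 q0 q1 q2 : R) :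
  0 < l -> 0 < m -> l + m = 1 -> 0 <= s <= 1 -> 0 < k -> 0 < eps ->
  l * p0 - l * p1 + 2 * k * x = 0 -> m * p0 - m * p2 + 2 * k * y = 0 ->
  0 <= q0 - l * q1 - m * q2 + 4 * k ->
  s * (q0 - a0 * p0 ^+ 2) - l * (s * (q1 - a1 * p1 ^+ 2))
    - m * (s * (q2 - a2 * p2 ^+ 2)) + eps <= 0 ->
  `|a0| <= S -> `|a1| <= S -> `|a2| <= S ->
  `|p0| <= P -> `|p1| <= P -> `|p2| <= P ->
  a0 - l * a1 - m * a2 + eps * s + k * (x ^+ 2 + y ^+ 2) < 0 ->
  0 < th -> 4 * k + 4 * P * S * (2 * S * th + k / (2 * th)) < eps -> False.
Proof.
move=> l0 m0 lm /andP[s0 s1] k0 e0 Ex Ey hq hs ha0 ha1 ha2 hp0 hp1 hp2 hC th0 hk.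
have S0 : 0 <= S := le_trans (normr_ge0 _) ha0.
have P0 : 0 <= P := le_trans (normr_ge0 _) hp0.
have hkxy : k * (x ^+ 2 + y ^+ 2) <= 2 * S.
  have es : 0 <= eps * s by rewrite mulr_ge0// ltW.
  move: ha0 ha1 ha2 => /ler_normlP[? ?] /ler_normlP[? ?] /ler_normlP[? ?].
  have : l * a1 <= l * S by rewrite ler_pM2l.
  have : m * a2 <= m * S by rewrite ler_pM2l.
  have : l * S + m * S = S by rewrite -mulrDl lm mul1r.
  lra.
have cross (u v z r a : R) : u * p0 - u * r + 2 * k * z = 0 -> `|r| <= P ->
    `|a| <= S -> - (a * (u * (r ^+ 2 - p0 ^+ 2))) <= 4 * P * S * (k * `|z|).
  move=> E hr ha.
  have -> : u * (r ^+ 2 - p0 ^+ 2) = 2 * k * z * (r + p0).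
    have -> : 2 * k * z = u * r - u * p0 by lra.
    ring.
  apply: (le_trans (ler_norm _)); rewrite normrN !normrM (gtr0_norm k0) normr_nat.
  have h : `|r + p0| <= 2 * P by have := ler_normD r p0; lra.
  rewrite (_ : 4 * P * S * _ = S * (2 * k * `|z| * (2 * P))); last by ring.
  have kz : 0 <= 2 * k * `|z| by rewrite !mulr_ge0// ltW.
  by apply: ler_pM => //; [exact: mulr_ge0|exact: ler_wpM2l].
have hx := cross l l x p1 a1 Ex hp1 ha1.
have hy := cross m m y p2 a2 Ey hp2 ha2.
have hT : a0 * p0 ^+ 2 - l * (a1 * p1 ^+ 2) - m * (a2 * p2 ^+ 2) <=
    4 * P * S * (k * `|x| + k * `|y|).
  have C0 : a0 - l * a1 - m * a2 <= 0.
    have := mulr_ge0 (ltW e0) s0; have := sqr_ge0 x; have := sqr_ge0 y.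
    move=> ? ? ?; have : 0 <= k * (x ^+ 2 + y ^+ 2) by rewrite mulr_ge0 ?(ltW k0) ?addr_ge0.
    lra.
  have : (a0 - l * a1 - m * a2) * p0 ^+ 2 <= 0 by rewrite mulr_le0_ge0 ?sqr_ge0.
  have -> : a0 * p0 ^+ 2 - l * (a1 * p1 ^+ 2) - m * (a2 * p2 ^+ 2) =
    (a0 - l * a1 - m * a2) * p0 ^+ 2 + - (a1 * (l * (p1 ^+ 2 - p0 ^+ 2)))
      + - (a2 * (m * (p2 ^+ 2 - p0 ^+ 2))) by ring.
  rewrite mulrDr; lra.
have young (z : R) : `|z| <= th * z ^+ 2 + 1 / (4 * th).
  rewrite -(real_normK (num_real z)) -subr_ge0.
  have -> : th * `|z| ^+ 2 + 1 / (4 * th) - `|z| =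
    (2 * th * `|z| - 1) ^+ 2 / (4 * th) by field; rewrite gt_eqF.
  by rewrite divr_ge0 ?sqr_ge0// mulr_ge0// ltW.
have hb : k * `|x| + k * `|y| <= 2 * S * th + k / (2 * th).
  have h1 : k * `|x| <= k * (th * x ^+ 2 + 1 / (4 * th)) by rewrite ler_pM2l.
  have h2 : k * `|y| <= k * (th * y ^+ 2 + 1 / (4 * th)) by rewrite ler_pM2l.
  have h3 : th * (k * (x ^+ 2 + y ^+ 2)) <= th * (2 * S) by rewrite ler_pM2l.
  have -> : k / (2 * th) = k * (1 / (4 * th)) + k * (1 / (4 * th)).
    by field; rewrite gt_eqF.
  lra.
have PS0 : 0 <= 4 * P * S by rewrite !mulr_ge0.
have hT' := le_trans hT (ler_wpM2l PS0 hb).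
set T := a0 * p0 ^+ 2 - _ - _ in hT'.
set K := 4 * P * S * (2 * S * th + k / (2 * th)) in hT' hk.
have K0 : 0 <= K by apply: mulr_ge0 => //; apply: le_trans hb; rewrite addr_ge0 ?mulr_ge0 ?(ltW k0).
have E : eps <= - (s * (q0 - l * q1 - m * q2)) + s * T by rewrite /T; lra.
have h1 : s * T <= K.
  apply: (@le_trans _ _ (s * K)); first exact: ler_wpM2l.
  by rewrite ler_piMl.
have h2 : - (s * (q0 - l * q1 - m * q2)) <= 4 * k.
  rewrite -mulrN; apply: (@le_trans _ _ (s * (4 * k))).
    by apply: ler_wpM2l => //; lra.
  by rewrite ler_piMl// mulr_ge0// ltW.
lra.
Qed.

End borell_arith.

(** The weight th is chosen first, then k small depending on th. *)
Lemma exists_small_penalty (R : realType) (eta A Q S : R) :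
  0 < eta -> 0 <= A -> 0 <= Q -> 0 <= S -> exists th k, [/\ 0 < th, 0 < k,
    k * A <= eta & 4 * k + Q * (2 * S * th + k / (2 * th)) < eta].
Proof.
move=> e0 A0 Q0 S0.
have d0 : 0 < 4 * (2 * Q * S + 1) by rewrite mulr_gt0// ltr_wpDl// !mulr_ge0.
exists (eta / (4 * (2 * Q * S + 1))); set th := eta / _.
have th0 : 0 < th by rewrite divr_gt0.
have q0 : 0 <= Q / (2 * th) by rewrite divr_ge0// mulr_ge0// ltW.
set a := A + 4 + Q / (2 * th).
have a0 : 0 < a by rewrite /a; lra.
exists (eta / (2 * a)); set k := eta / _.
have k0 : 0 < k by rewrite divr_gt0// mulr_gt0.
have ka : k * a = eta / 2 by rewrite /k; field; rewrite gt_eqF.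
have thE : th * (2 * Q * S + 1) = eta / 4.
  by rewrite /th; field; rewrite gt_eqF//; lra.
have kA : k * A + 4 * k + k * (Q / (2 * th)) = eta / 2 by rewrite -ka /a; ring.
have kq : 0 <= k * (Q / (2 * th)) by rewrite mulr_ge0// ltW.
have kA0 : 0 <= k * A by rewrite mulr_ge0// ltW.
split => //; first lra.
have -> : Q * (2 * S * th + k / (2 * th)) = th * (2 * Q * S) + k * (Q / (2 * th)).
  by field; rewrite gt_eqF.
lra.
Qed.

Section linear_combination.
Context {R : realType}.

Lemma is_derive_comb (l m k t : R) (u v w c q : R -> R) (u' v' w' c' q' : R) :
  is_derive t 1 u u' -> is_derive t 1 v v' -> is_derive t 1 w w' ->
  is_derive t 1 c c' -> is_derive t 1 q q' ->
  is_derive t 1 (fun t => u t - l * v t - m * w t + c t + k * q t)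
    (u' - l * v' - m * w' + c' + k * q').
Proof.
move=> du dv dw dc dq; apply: is_derive_eq; rewrite /GRing.scale/=; ring.
Qed.

Lemma is_derive_sum_sqr (a b t : R) :
  is_derive t 1 (fun t => (a + t) ^+ 2 + (b + t) ^+ 2) (2 * (a + t) + 2 * (b + t)).
Proof. by apply: is_derive_eq; rewrite /GRing.scale/=; ring. Qed.

Lemma is_derive_sum_sqr2 (a b t : R) :
  is_derive t 1 (fun t => 2 * (a + t) + 2 * (b + t)) 4.
Proof. by apply: is_derive_eq; rewrite /GRing.scale/=; ring. Qed.

Lemma is_derive_sqrl (y t : R) : is_derive t 1 (fun t => t ^+ 2 + y ^+ 2) (2 * t).
Proof. by apply: is_derive_eq; rewrite /GRing.scale/=; ring. Qed.

Lemma is_derive_sqrr (x t : R) : is_derive t 1 (fun t => x ^+ 2 + t ^+ 2) (2 * t).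
Proof. by apply: is_derive_eq; rewrite /GRing.scale/=; ring. Qed.

Lemma is_derive_affine_comp (u u' : R -> R) (a b t : R) :
  (forall t : R, is_derive t 1 u (u' t)) ->
  is_derive t 1 (fun t => u (a + b * t)) (b * u' (a + b * t)).
Proof.
move=> du; have da : is_derive t 1 (fun t : R => a + b * t) b.
  by apply: is_derive_eq; rewrite /GRing.scale/=; ring.
by have := @is_derive1_comp R u _ t _ _ (du (a + b * t)) da; rewrite mulrC.
Qed.

Lemma is_derive_shift (u u' : R -> R) (a t : R) :
  (forall t : R, is_derive t 1 u (u' t)) ->
  is_derive t 1 (fun t => u (a + t)) (u' (a + t)).
Proof.
move=> du; have := is_derive_affine_comp a 1 t du.
by rewrite !mul1r; under eq_fun do rewrite mul1r.
Qed.

Lemma is_derive_shift0 (u : R -> R) (a l : R) :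
  is_derive a 1 u l -> is_derive (0 : R) 1 (fun t => u (a + t)) l.
Proof.
move=> du; have da : is_derive (0 : R) 1 (fun t : R => a + t) 1.
  by apply: is_derive_eq; ring.
have du' : is_derive (a + 0) 1 u l by rewrite addr0.
by have := @is_derive1_comp R u _ 0 _ _ du' da; rewrite mulr1.
Qed.

End linear_combination.

Section max_principle.
Context {R : realType}.
Notation phi := (normal_pdf (0 : R) 1).
Variables (l m B d : R) (f f1 f2 g g1 g2 h h1 h2 : R -> R).
Hypotheses (l0 : 0 < l) (m0 : 0 < m) (lm : l + m = 1) (d0 : 0 < d).
Hypotheses (fC2 : C2b B f f1 f2) (gC2 : C2b B g g1 g2) (hC2 : C2b B h h1 h2).
Hypothesis fd : forall x, d <= f x <= 1 - d.
Hypothesis gd : forall x, d <= g x <= 1 - d.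
Hypothesis hd : forall x, d <= h x <= 1 - d.
Hypothesis init :
  forall x y, l * Phinv (g x) + m * Phinv (h y) <= Phinv (f (l * x + m * y)).

Let S : R := height_bound d.
Let P : R := B / phi S.

Let gap (s x y : R) : R :=
  height f s (l * x + m * y) - l * height g s x - m * height h s y.

Let gap_ge (s x y : R) : - (2 * S) <= gap s x y.
Proof.
have := norm_height_le d0 fC2 fd s (l * x + m * y).
have := norm_height_le d0 gC2 gd s x; have := norm_height_le d0 hC2 hd s y.
rewrite -/S /gap; move: (height _ _ _) (height _ _ _) (height _ _ _) => a b c.
have ml : m = 1 - l by rewrite -lm; ring.
have l' := l0; have m' := m0.
move=> /ler_normlP[_ ha] /ler_normlP[_ hb] /ler_normlP[hc _].
have : l * b <= l * S by rewrite ler_pM2l.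
have : m * c <= m * S by rewrite ler_pM2l.
rewrite ml; lra.
Qed.

(** Borell's argument. If the gap were negative at time 1, adding a small multiple
    of s and of x^2 + y^2 would leave it negative there; the quadratic penalty
    forces a minimum, and init keeps this minimum away from time 0. The second
    derivative is tested in the direction (1, 1), along which l x + m y moves at
    unit speed because l + m = 1. *)
Lemma max_principle (x0 y0 : R) :
  l * height g 1 x0 + m * height h 1 y0 <= height f 1 (l * x0 + m * y0).
Proof.
rewrite -subr_ge0 opprD addrA -/(gap 1 x0 y0) leNgt; apply/negP => gap0.
have S0 : 0 <= S by rewrite /S /height_bound le_max normr_ge0.
have P0 : 0 <= P.
  by have := norm_slope_le d0 fC2 fd 0 0; apply: le_trans.
have [eta eta0 etaE] : exists2 eta, 0 < eta & gap 1 x0 y0 = - (3 * eta).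
  exists (- gap 1 x0 y0 / 3); first by rewrite divr_gt0 ?oppr_gt0.
  by rewrite mulrC divfK ?pnatr_eq0// opprK.
have A0 : 0 <= x0 ^+ 2 + y0 ^+ 2 by rewrite addr_ge0 ?sqr_ge0.
have Q0 : 0 <= 4 * P * S := mulr_ge0 (mulr_ge0 (ler0n _ 4) P0) S0.
have [th [k [th0 k0 kA hk]]] := exists_small_penalty eta0 A0 Q0 S0.
pose D (z : R * R * R) :=
  gap z.1.1 z.1.2 z.2 + eta * z.1.1 + k * (z.1.2 ^+ 2 + z.2 ^+ 2).
have cD : continuous D.
  have c11 : continuous (fun z : R * R * R => z.1.1).
    by move=> z; exact: cvg_comp cvg_fst cvg_fst.
  have c12 : continuous (fun z : R * R * R => z.1.2).
    by move=> z; exact: cvg_comp cvg_fst cvg_snd.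
  have c2 : continuous (fun z : R * R * R => z.2) by move=> z; exact: cvg_snd.
  have cM (u : R) (v : R * R * R -> R) : continuous v ->
      continuous (fun z => u * v z).
    by move=> cv z; apply: cvgM; [exact: cvg_cst|exact: cv].
  have cz : continuous (fun z : R * R * R => l * z.1.2 + m * z.2).
    by move=> z; apply: cvgD; [exact: (cM l _ c12)|exact: (cM m _ c2)].
  have cF := height_continuous d0 fC2 fd c11 cz.
  have cG := cM l _ (height_continuous d0 gC2 gd c11 c12).
  have cH := cM m _ (height_continuous d0 hC2 hd c11 c2).
  move=> z; apply: cvgD; first apply: cvgD.
  - by apply: cvgB; [apply: cvgB; [exact: cF|exact: cG]|exact: cH].
  - exact: (cM eta _ c11).
  - apply: (cM k (fun z => z.1.2 ^+ 2 + z.2 ^+ 2)) => {}z.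
    apply: cvgD; rewrite ?expr2; apply: cvgM; by [exact: c12|exact: c2].
have D0 : D (1, x0, y0) < 0 by rewrite /D/= mulr1 etaE; lra.
(* outside this box the penalty beats the lower bound of the gap *)
have [rho [rho1 rhoS rhox rhoy]] : exists rho,
    [/\ 1 <= rho, 2 * S / k <= rho, `|x0| <= rho & `|y0| <= rho].
  exists (Num.max (2 * S / k + 1) (Num.max `|x0| `|y0|)).
  rewrite !le_max lerDr lexx !orbT lerDl ler01.
  have -> : 0 <= 2 * S / k by rewrite divr_ge0 ?(ltW k0)// mulr_ge0.
  by rewrite lexx !orbT.
pose box : set (R * R * R) := (`[0, 1] `*` `[- rho, rho]) `*` `[- rho, rho].
have cbox : compact box.
  by apply: compact_setX; [apply: compact_setX|]; exact: segment_compact.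
have box0 : box (1, x0, y0).
  by rewrite /box /=; split; [split|]; rewrite /= in_itv/= ?ler01 ?lexx//
    -ler_norml.
have [z zbox zmin] := compact_EVT_min (ex_intro _ _ box0) cbox
  (continuous_subspaceT cD).
case: z zbox zmin => -[s x] y; rewrite inE /box/= => -[[/= sI xI] yI] zmin.
rewrite in_itv/= in sI.
have Dneg : D (s, x, y) < 0 by apply: le_lt_trans (zmin _ _) D0; rewrite inE.
have big (t u v : R) : 0 <= t -> rho <= `|u| \/ rho <= `|v| -> 0 <= D (t, u, v).
  move=> t0 huv; have := gap_ge t u v; have := mulr_ge0 (ltW eta0) t0.
  rewrite /D/= => et hg.
  suff : 2 * S <= k * (u ^+ 2 + v ^+ 2) by lra.
  have r2 : 2 * S <= k * rho ^+ 2.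
    rewrite -ler_pdivrMl// mulrC; apply: (le_trans rhoS).
    by rewrite expr2 ler_peMl// (le_trans ler01).
  apply: (le_trans r2); rewrite ler_pM2l//.
  have rho0 : 0 <= rho by apply: le_trans rho1.
  case: huv => hu.
    apply: (@le_trans _ _ (u ^+ 2)); last by rewrite lerDl sqr_ge0.
    by rewrite -(real_normK (num_real u)) lerXn2r ?nnegrE.
  apply: (@le_trans _ _ (v ^+ 2)); last by rewrite lerDr sqr_ge0.
  by rewrite -(real_normK (num_real v)) lerXn2r ?nnegrE.
have gmin (t u v : R) : 0 <= t <= 1 -> D (s, x, y) <= D (t, u, v).
  move=> /andP[t0 t1].
  have [hu|hu] := leP rho `|u|; first by apply: le_trans (ltW Dneg) (big _ _ _ t0 _); left.
  have [hv|hv] := leP rho `|v|; first by apply: le_trans (ltW Dneg) (big _ _ _ t0 _); right.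
  apply: zmin; rewrite inE /box/=; split; [split|]; rewrite /= in_itv/= ?t0 ?t1//.
    by rewrite -ler_norml ltW.
  by rewrite -ler_norml ltW.
have s_gt0 : 0 < s.
  rewrite lt_neqAle eq_sym; case/andP: sI => -> _; rewrite andbT.
  apply/eqP => s0; move: Dneg; rewrite /D /gap /= s0 !height0 mulr0 addr0.
  have := init x y; have := mulr_ge0 (ltW k0) (addr_ge0 (sqr_ge0 x) (sqr_ge0 y)).
  lra.
set z := l * x + m * y.
have df s' x' := is_derive_height_x d0 fC2 fd s' x'.
have dg s' x' := is_derive_height_x d0 gC2 gd s' x'.
have dh s' x' := is_derive_height_x d0 hC2 hd s' x'.
have Ex : l * slope f f1 s z - l * slope g g1 s x + 2 * k * x = 0.
  have dF := is_derive_affine_comp (m * y) l x (df s).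
  have := min_derive_eq0 (is_derive_comb l m k dF (dg s x)
    (is_derive_cst (height h s y) x 1) (is_derive_cst (eta * s) x 1)
    (is_derive_sqrl y x)).
  rewrite (addrC (m * y)) -/z; move: (slope _ _ _ _) (slope _ _ _ _) => p q H.
  rewrite -[RHS]H; first by ring.
  by move=> t; rewrite /= -/z [m * y + _]addrC; exact: (gmin s t y sI).
have Ey : m * slope f f1 s z - m * slope h h1 s y + 2 * k * y = 0.
  have dF := is_derive_affine_comp (l * x) m y (df s).
  have := min_derive_eq0 (is_derive_comb l m k dF
    (is_derive_cst (height g s x) y 1) (dh s y) (is_derive_cst (eta * s) y 1)
    (is_derive_sqrr x y)).
  rewrite -/z; move: (slope _ _ _ _) (slope _ _ _ _) => p q H.
  rewrite -[RHS]H; first by ring.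
  by move=> t; exact: (gmin s x t sI).
(* second derivative in the direction (1, 1) *)
have hq : 0 <= curv f f1 f2 s z - l * curv g g1 g2 s x - m * curv h h1 h2 s y + 4 * k.
  have dW t := is_derive_comb l m k (is_derive_shift z t (df s))
    (is_derive_shift x t (dg s)) (is_derive_shift y t (dh s))
    (is_derive_cst (eta * s) t 1) (is_derive_sum_sqr x y t).
  have dW' := is_derive_comb l m k
    (is_derive_shift0 (is_derive_slope d0 fC2 fd s z))
    (is_derive_shift0 (is_derive_slope d0 gC2 gd s x))
    (is_derive_shift0 (is_derive_slope d0 hC2 hd s y))
    (is_derive_cst (0 : R) (0 : R) 1) (is_derive_sum_sqr2 x y 0).
  have : 0 <= curv f f1 f2 s z - l * curv g g1 g2 s x - m * curv h h1 h2 s y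
      + 0 + k * 4.
    apply: (min_second_derive_ge0 dW dW') => t.
    have := gmin s (x + t) (y + t) sI; rewrite /D /gap /=.
    have -> : l * (x + t) + m * (y + t) = z + t.
      by rewrite /z -[in RHS](mul1r t) -lm; ring.
    by rewrite [z + 0]addr0 [x + 0]addr0 [y + 0]addr0.
  move: (curv f f1 f2 s z) (curv g g1 g2 s x) (curv h h1 h2 s y) => q0 q1 q2.
  by rewrite addr0 (mulrC k).
have hs : s * (curv f f1 f2 s z - height f s z * slope f f1 s z ^+ 2)
    - l * (s * (curv g g1 g2 s x - height g s x * slope g g1 s x ^+ 2))
    - m * (s * (curv h h1 h2 s y - height h s y * slope h h1 s y ^+ 2)) + eta <= 0.
  have dl : is_derive s 1 (fun t => eta * t) eta.
    by apply: is_derive_eq; rewrite /GRing.scale/=; ring.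
  have := left_min_derive_le0 s_gt0 (is_derive_comb l m k
    (is_derive_height_s d0 fC2 fd s z) (is_derive_height_s d0 gC2 gd s x)
    (is_derive_height_s d0 hC2 hd s y) dl (is_derive_cst (x ^+ 2 + y ^+ 2) s 1)).
  rewrite mulr0 addr0; apply => t /andP[t0 ts].
  apply: (gmin t x y); rewrite t0/= (le_trans ts)//.
  by case/andP: sI.
exact: (no_negative_minimum l0 m0 lm sI k0 eta0 Ex Ey hq hs
  (norm_height_le d0 fC2 fd s z) (norm_height_le d0 gC2 gd s x)
  (norm_height_le d0 hC2 hd s y) (norm_slope_le d0 fC2 fd s z)
  (norm_slope_le d0 gC2 gd s x) (norm_slope_le d0 hC2 hd s y) Dneg th0 hk).
Qed.

End max_principle.

(** * Smoothing Lipschitz functions *)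

Section smoothing.
Context {R : realType}.
Notation mu := (@lebesgue_measure R).

(** Two successive averages over windows of length r turn a Lipschitz function
    into one with a Lipschitz second derivative. *)
Definition avg (r : R) (u : R -> R) (x : R) : R :=
  r^-1 * \int[mu]_(t in `]x, x + r]) u t.

Lemma avg_primitive (r : R) (u : R -> R) (a : R) : 0 < r -> continuous u ->
  exists F : R -> R, (forall x : R, a < x -> is_derive x 1 F (u x)) /\
    forall x, a < x -> avg r u x = r^-1 * (F (x + r) - F x).
Proof.
move=> r0 cu.
have iu (b : R) : mu.-integrable [set` Interval (BLeft a) (BRight b)]
    (fun x => (u x)%:E).
  apply: continuous_compact_integrable; first exact: segment_compact.
  exact: continuous_subspaceT.
exists (fun y => \int[mu]_(t in [set` Interval (BLeft a) (BRight y)]) u t); split.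
  move=> x ax.
  have xx1 : x < x + 1 by rewrite ltrDl.
  have [d e] := @continuous_FTC1_closed R u a x _ xx1 (iu _) ax (cu x).
  by apply: DeriveDef; [exact: d|rewrite -e derive1E].
move=> x ax; rewrite /avg; congr (_ * _); apply/esym.
by apply: Rintegral_itvB; [exact: iu|rewrite bnd_simp ltW|rewrite bnd_simp lerDl ltW].
Qed.

Lemma is_derive_avg (r : R) (u : R -> R) (x : R) : 0 < r -> continuous u ->
  is_derive x 1 (avg r u) (r^-1 * (u (x + r) - u x)).
Proof.
move=> r0 cu; have [F [dF FE]] := avg_primitive (x - 1) r0 cu.
apply: (@near_eq_is_derive _ _ _ (fun y => r^-1 * (F (y + r) - F y))).
  near=> y; rewrite FE//; near: y.
  by apply: lt_nbhsr; rewrite gtrDl oppr_lt0.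
have d1 : is_derive x 1 F (u x) by apply: dF; rewrite gtrDl oppr_lt0.
have d2 : is_derive (x + r) 1 F (u (x + r)).
  by apply: dF; rewrite ltrD2l (lt_trans _ r0)// oppr_lt0.
have d3 : is_derive x 1 (fun y => y + r) 1.
  by apply: is_derive_eq; rewrite addr0.
have d4 := @is_derive1_comp R F (fun y => y + r) x _ _ d2 d3.
by apply: is_derive_eq; rewrite /GRing.scale/=; ring.
Unshelve. all: by end_near. Qed.

Lemma avg_close (r L : R) (u : R -> R) (x : R) : 0 < r ->
  (forall x y, `|u x - u y| <= L * `|x - y|) -> `|avg r u x - u x| <= L * r.
Proof.
move=> r0 Lu; have cu := lipschitz_continuous Lu.
have [F [dF ->]] := avg_primitive (x - 1) r0 cu; last by rewrite gtrDl oppr_lt0.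
have xr : x < x + r by rewrite ltrDl.
have dF' z : x <= z -> is_derive z 1 F (u z).
  by move=> xz; apply: dF; apply: lt_le_trans xz; rewrite gtrDl oppr_lt0.
have cF : {within `[x, x + r], continuous F}.
  apply: derivable_within_continuous => z; rewrite in_itv/= => /andP[xz _].
  by case: (dF' z xz).
have dF'' z : z \in `]x, x + r[ -> is_derive z 1 F (u z).
  by rewrite in_itv/= => /andP[xz _]; apply: dF'; exact: ltW.
have [c /[!in_itv]/= /andP[xc cx] ->] := MVT xr dF'' cF.
rewrite [x + r - x]addrC addKr mulrC mulfK ?gt_eqF//.
apply: (le_trans (Lu _ _)); apply: ler_wpM2l.
  by have := le_trans (normr_ge0 _) (Lu 1 0); rewrite subr0 normr1 mulr1.
by rewrite gtr0_norm ?subr_gt0// lerBlDl ltW.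
Qed.

Lemma avg_deriv_le (r L : R) (u : R -> R) (x : R) : 0 < r ->
  (forall x y, `|u x - u y| <= L * `|x - y|) ->
  `|r^-1 * (u (x + r) - u x)| <= L.
Proof.
move=> r0 Lu; rewrite normrM normfV (gtr0_norm r0) ler_pdivrMl// mulrC.
by apply: (le_trans (Lu _ _)); rewrite [x + r - x]addrC addKr gtr0_norm.
Qed.

Lemma smooth_approx (L r : R) (u : R -> R) : 0 < r ->
  (forall x y, `|u x - u y| <= L * `|x - y|) -> (forall x, `|u x| <= 1) ->
  exists f f1 f2 B, C2b B f f1 f2 /\ forall x, `|f x - u x| <= 2 * L * r.
Proof.
move=> r0 Lu u1; have cu := lipschitz_continuous Lu.
have L0 : 0 <= L.
  by have := le_trans (normr_ge0 _) (Lu 1 0); rewrite subr0 normr1 mulr1.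
have dv x := is_derive_avg x r0 cu.
have Lv := bounded_deriv_lipschitz dv (fun x => avg_deriv_le x r0 Lu).
have cv := lipschitz_continuous Lv.
set v := avg r u in dv Lv cv *.
have df x := is_derive_avg x r0 cv.
have fu x : `|avg r v x - u x| <= 2 * L * r.
  rewrite (_ : avg r v x - u x = (avg r v x - v x) + (v x - u x)); last by ring.
  apply: (le_trans (ler_normD _ _)).
  have := avg_close x r0 Lu; have := avg_close x r0 Lv; rewrite -/v.
  move: (`|_|) (`|_|) => p q; lra.
pose f1 x := r^-1 * (v (x + r) - v x).
pose w x := r^-1 * (u (x + r) - u x).
pose f2 x := r^-1 * (w (x + r) - w x).
have df1 (x : R) : is_derive x 1 f1 (f2 x).
  have d3 : is_derive x 1 (fun y : R => y + r) 1.
    by apply: is_derive_eq; rewrite addr0.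
  have d4 := @is_derive1_comp R v (fun y => y + r) x _ _ (dv (x + r)) d3.
  have d5 := dv x.
  rewrite /f1; apply: is_derive_eq.
  by rewrite /f2 /w /GRing.scale/= ; ring.
have wL x : `|w x| <= L by exact: avg_deriv_le.
have rV0 : 0 <= r^-1 by rewrite invr_ge0 ltW.
have f2B x : `|f2 x| <= r^-1 * (2 * L).
  rewrite normrM ger0_norm// ler_wpM2l//; apply: (le_trans (ler_normB _ _)).
  by have := wL (x + r); have := wL x; move: (`|_|) (`|_|) => p q; lra.
have Lw x y : `|w x - w y| <= r^-1 * (2 * L) * `|x - y|.
  rewrite /w -mulrBr normrM (ger0_norm rV0) -mulrA ler_wpM2l//.
  rewrite (_ : u (x + r) - u x - (u (y + r) - u y) =
    (u (x + r) - u (y + r)) - (u x - u y)); last by ring.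
  apply: (le_trans (ler_normB _ _)).
  have := Lu (x + r) (y + r); have := Lu x y.
  rewrite (_ : x + r - (y + r) = x - y); last by ring.
  move: (`|u x - u y|) (`|u _ - _|) (`|x - y|) => p q t; lra.
have Lf2 x y : `|f2 x - f2 y| <= r^-1 * (2 * (r^-1 * (2 * L))) * `|x - y|.
  rewrite /f2 -mulrBr normrM (ger0_norm rV0) -mulrA ler_wpM2l//.
  rewrite (_ : w (x + r) - w x - (w (y + r) - w y) =
    (w (x + r) - w (y + r)) - (w x - w y)); last by ring.
  apply: (le_trans (ler_normB _ _)).
  have := Lw (x + r) (y + r); have := Lw x y.
  rewrite (_ : x + r - (y + r) = x - y); last by ring.
  move: (`|w x - w y|) (`|w _ - _|) (`|x - y|) => p q t; lra.
have c0 : 0 <= 2 * L * r by rewrite !mulr_ge0// ltW.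
have c1 : 0 <= r^-1 * (2 * L) by rewrite !mulr_ge0.
have c2 : 0 <= r^-1 * (2 * (r^-1 * (2 * L))) by rewrite !mulr_ge0.
set C1 := r^-1 * (2 * L) in f2B c1 Lw Lf2 c2.
set C2 := r^-1 * (2 * C1) in Lf2 c2.
exists (avg r v), f1, f2, (1 + 2 * L * r + L + C1 + C2); split => //.
split => // [x|x y]; last first.
  by apply: (le_trans (Lf2 x y)); apply: ler_wpM2r => //; lra.
split.
- have := ler_normD (avg r v x - u x) (u x); rewrite subrK.
  have := fu x; have := u1 x; move: (`|_|) (`|_|) (`|_|) => p q t; lra.
- have : `|f1 x| <= L by exact: avg_deriv_le.
  move: (`|_|) => p; lra.
- have := f2B x; move: (`|_|) => p; lra.
Qed.

Lemma C2b_le (B B' : R) (f f1 f2 : R -> R) : B <= B' -> C2b B f f1 f2 ->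
  C2b B' f f1 f2.
Proof.
move=> BB' [d1 d2 b L]; split => // [x|x y].
  by have [? ? ?] := b x; split; apply: le_trans BB'.
by apply: (le_trans (L x y)); apply: ler_wpM2r.
Qed.

Lemma C2b_shift (B c : R) (f f1 f2 : R -> R) : C2b B f f1 f2 ->
  C2b (B + `|c|) (fun x => f x + c) f1 f2.
Proof.
move=> [d1 d2 b L]; have Bc : B <= B + `|c| by rewrite lerDl.
split => // [x|x|x y].
- have := d1 x => ?; apply: is_derive_eq; exact: addr0.
- have [b0 b1 b2] := b x; split; [|exact: le_trans Bc|exact: le_trans Bc].
  by apply: (le_trans (ler_normD _ _)); rewrite lerD2r.
- by apply: (le_trans (L x y)); apply: ler_wpM2r.
Qed.

End smoothing.

(** * Ehrhard's inequality *)

Section ehrhard.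
Context {R : realType}.
Notation phi := (normal_pdf (0 : R) 1).

Definition lipschitz_with (N : R) (h : R -> R) :=
  forall x y, `|h x - h y| <= N * `|x - y|.

(** A uniform continuity statement for the mean Phi (l a + m b). Phi^-1 is not
    uniformly continuous near 0, but where a or b is very negative while the other
    stays bounded above, the mean itself is below e. *)
Lemma Phi_modulus (l m M e : R) : 0 < l -> 0 < m -> l + m = 1 -> 0 < e ->
  exists2 d, 0 < d & forall a b s t, s <= M -> t <= M ->
    Phi a <= Phi s + d -> Phi b <= Phi t + d ->
    Phi (l * a + m * b) <= Phi (l * s + m * t) + e.
Proof.
move=> l0 m0 lm e0.
have PM := Phi_lt1 M.
have [M' hM'] : exists x, (1 + Phi M) / 2 < Phi x by apply: Phi_above; lra.
have [z hz] := Phi_below e0.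
pose L := (`|z| + `|M'|) / l + (`|z| + `|M'|) / m.
have zM0 : 0 <= `|z| + `|M'| by rewrite addr_ge0.
have ql0 : 0 <= (`|z| + `|M'|) / l by rewrite divr_ge0// ltW.
have qm0 : 0 <= (`|z| + `|M'|) / m by rewrite divr_ge0// ltW.
have L0 : 0 <= L by rewrite addr_ge0.
have zn : - z <= `|z| by rewrite -normrN ler_norm.
have Mn : M' <= `|M'| by exact: ler_norm.
have l1 : l <= 1 by lra.
have m1 : m <= 1 by lra.
have tail (u v a b : R) : 0 < u -> 0 < v <= 1 -> (`|z| + `|M'|) / u <= L ->
    a <= - L -> b <= M' -> Phi (u * a + v * b) <= e.
  move=> u0 /andP[v0 v1] uL aL bM; apply: (le_trans _ (ltW hz)); rewrite Phi_le.
  have h1 : u * a <= u * (- L) by rewrite ler_pM2l.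
  have h2 : v * b <= v * `|M'| by rewrite ler_pM2l// (le_trans bM).
  have h3 : v * `|M'| <= `|M'| by rewrite ler_piMl.
  have h4 : `|z| + `|M'| <= u * L by rewrite mulrC -ler_pdivrMr.
  lra.
pose K := L + e + `|M'|.
have cK : 0 < phi K by exact: phi_gt0.
have [d [dgt0 d1 d2]] : exists d, [/\ 0 < d, d <= (1 - Phi M) / 2 & d <= e * phi K].
  exists (Num.min ((1 - Phi M) / 2) (e * phi K)).
  by rewrite lt_min !ge_min !lexx orbT divr_gt0 ?subr_gt0// mulr_gt0.
exists d => // a b s t sM tM.
have ub (x y : R) : y <= M -> Phi x <= Phi y + d ->
    x <= M'.
  move=> yM h; rewrite -Phi_le; apply: (le_trans h); apply: (le_trans _ (ltW hM')).
  have : Phi y <= Phi M by rewrite Phi_le.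
  move: d1; move: (Phi y) (Phi M); clear; move=> *; lra.
have close (x y : R) : - L <= x -> x <= M' ->
    Phi x <= Phi y + d -> x - e <= y.
  move=> xL xM h; rewrite leNgt; apply/negP => yx.
  have xe : x - e <= x by rewrite gerBl ltW.
  have [c /andP[c1 c2] E] := mean_value_between (@is_derive_Phi R) xe.
  have pc : phi K <= phi c.
    apply: phi_mono; rewrite (ger0_norm (_ : 0 <= K)) ?addr_ge0 ?(ltW e0)//.
    by have := normr_ge0 M'; move=> ?; apply/ler_normlP; rewrite /K; split; lra.
  have h1 : Phi y < Phi (x - e) by rewrite Phi_lt.
  have h2 : e * phi K <= e * phi c by rewrite ler_pM2l.
  have E' : Phi x - Phi (x - e) = e * phi c by rewrite E; ring.
  move: h h1 h2 d2 E'.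
  move: (Phi x) (Phi y) (Phi (x - e)) (e * phi K) (e * phi c); clear; move=> *; lra.
move=> ha hb; have aM := ub _ _ sM ha; have bM := ub _ _ tM hb.
have P0 : 0 <= Phi (l * s + m * t) by rewrite ltW// Phi_gt0.
have [aL|aL] := leP a (- L).
  apply: (@le_trans _ _ e); last by rewrite lerDr.
  by apply: tail aL bM => //; rewrite ?m0 ?m1// /L lerDl.
have [bL|bL] := leP b (- L).
  apply: (@le_trans _ _ e); last by rewrite lerDr.
  by rewrite addrC; apply: tail bL aM => //; rewrite ?l0 ?l1// /L lerDr.
have sa := close _ _ (ltW aL) aM ha; have tb := close _ _ (ltW bL) bM hb.
have h : l * a + m * b <= l * s + m * t + e.
  have : l * (a - e) <= l * s by rewrite ler_pM2l.
  have : m * (b - e) <= m * t by rewrite ler_pM2l.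
  have : l * e + m * e = e by rewrite -mulrDl lm mul1r.
  lra.
apply: (@le_trans _ _ (Phi (l * s + m * t + e))); first by rewrite Phi_le.
rewrite -lerBlDl; apply: (le_trans (ler_norm _)); apply: (le_trans (Phi_lipschitz _ _)).
by rewrite mul1r [_ + e - _]addrC addKr gtr0_norm.
Qed.

Lemma subquadratic_Phi (N : R) (h : R -> R) : lipschitz_with N h ->
  subquadratic (fun y => Phi (h y)).
Proof.
move=> Lh; apply: (@bounded_subquadratic _ _ 1).
  have ch := lipschitz_continuous Lh.
  apply: continuous_measurable_fun => x.
  by apply: (@continuous_comp _ _ _ h Phi); [exact: ch|exact: continuous_Phi].
by move=> y; rewrite ger0_norm ltW ?Phi_lt1 ?Phi_gt0.
Qed.

Lemma gE_Phi_le (N M : R) (h : R -> R) : lipschitz_with N h ->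
  (forall x, h x <= M) -> gE (fun y => Phi (h y)) <= Phi M.
Proof.
move=> Lh hM; rewrite -[leRHS](@gE_cst R); apply: le_gE.
- exact: subquadratic_Phi Lh.
- exact: subquadratic_cst.
- by move=> y; rewrite Phi_le.
Qed.

Lemma gE_Phi_gt0 (N : R) (h : R -> R) : lipschitz_with N h ->
  0 < gE (fun y => Phi (h y)).
Proof.
move=> Lh; set c := Phi (h 0 - 2 * N).
have c0 : 0 < c by exact: Phi_gt0.
have N0 : 0 <= N.
  by have := le_trans (normr_ge0 _) (Lh 1 0); rewrite subr0 normr1 mulr1.
have q1 : subquadratic (fun y : R => 1 - 4^-1 * y ^+ 2).
  by apply: subquadraticB; [exact: subquadratic_cst|apply/subquadraticZ/subquadratic_sqr].
(* on [-2, 2] the function Phi \o h is at least c; 1 - y^2/4 is negative elsewhere *)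
apply: (@lt_le_trans _ _ (gE (fun y => c * (1 - 4^-1 * y ^+ 2)))).
  rewrite gEZ// gEB; [|exact: subquadratic_cst|exact/subquadraticZ/subquadratic_sqr].
  rewrite gE_cst gEZ; last exact: subquadratic_sqr.
  by rewrite gE_sqr mulr_gt0//; lra.
apply: le_gE; [exact: subquadraticZ|exact: subquadratic_Phi Lh|move=> y].
have [y2|y2] := leP `|y| 2.
  apply: (@le_trans _ _ c).
    by rewrite ler_piMr ?(ltW c0)// gerBl mulr_ge0// sqr_ge0.
  rewrite Phi_le; have := Lh 0 y; rewrite sub0r normrN => /ler_normlP[_ h1].
  have : N * `|y| <= N * 2 by rewrite ler_wpM2l.
  lra.
apply: (@le_trans _ _ 0); last by rewrite ltW// Phi_gt0.
rewrite mulr_ge0_le0 ?(ltW c0)// -(real_normK (num_real y)).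
move: y2; move: `|y| => z z2; nra.
Qed.

Lemma Phi_gE_Phi (N M : R) (h : R -> R) : lipschitz_with N h ->
  (forall x, h x <= M) ->
  Phi (Phinv (gE (fun y => Phi (h y)))) = gE (fun y => Phi (h y)).
Proof.
move=> Lh hM; apply: PhinvK; first exact: gE_Phi_gt0 Lh.
by apply: le_lt_trans (gE_Phi_le Lh hM) (Phi_lt1 _).
Qed.

(** The three functions Phi o h_i are smoothed and shifted by constants, which
    keeps them away from 0 and 1 and, thanks to Phi_modulus, preserves the
    hypothesis. The maximum principle then compares time 0, where the heights are
    the h_i up to the perturbation, with time 1, where they are the averages. *)
Theorem functional_ehrhard (l m N M : R) (h0 h1 h2 : R -> R) :
  0 < l -> 0 < m -> l + m = 1 ->
  lipschitz_with N h0 -> lipschitz_with N h1 -> lipschitz_with N h2 ->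
  (forall x, h0 x <= M) -> (forall x, h1 x <= M) -> (forall x, h2 x <= M) ->
  (forall x y, l * h1 x + m * h2 y <= h0 (l * x + m * y)) ->
  l * Phinv (gE (fun y => Phi (h1 y))) + m * Phinv (gE (fun y => Phi (h2 y)))
    <= Phinv (gE (fun y => Phi (h0 y))).
Proof.
move=> l0 m0 lm L0 L1 L2 M0 M1 M2 hyp.
rewrite -Phi_le (Phi_gE_Phi L0 M0).
pose H1 := Phinv (gE (fun y => Phi (h1 y))).
pose H2 := Phinv (gE (fun y => Phi (h2 y))).
have PM : 0 < 1 - Phi M by rewrite subr_gt0 Phi_lt1.
suff key e : 0 < e -> e <= (1 - Phi M) / 4 ->
    Phi (l * H1 + m * H2) <= gE (fun y => Phi (h0 y)) + 2 * e.
  apply/ler_addgt0Pr => e e0; pose e' := Num.min (e / 2) ((1 - Phi M) / 4).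
  have e'0 : 0 < e' by rewrite lt_min !divr_gt0.
  apply: (le_trans (key _ e'0 _)); first by rewrite ge_min lexx orbT.
  by rewrite lerD2l mulrC -ler_pdivlMr// ge_min lexx.
move=> e0 eM; have [d d0 hd] := Phi_modulus M l0 m0 lm e0.
have [r [r0 rd re]] : exists r, [/\ 0 < r, 3 * r <= d & 2 * r <= e].
  exists (Num.min (d / 3) (e / 2)).
  have m1 : Num.min (d / 3) (e / 2) <= d / 3 by rewrite ge_min lexx.
  have m2 : Num.min (d / 3) (e / 2) <= e / 2 by rewrite ge_min lexx orbT.
  by rewrite lt_min !divr_gt0//; split => //; lra.
have N0 : 0 <= N.
  by have := le_trans (normr_ge0 _) (L0 1 0); rewrite subr0 normr1 mulr1.
(* approximants within r of Phi o h_i; adding r + e to the first and 2 r to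
   the others restores the right order between them *)
have approx (h : R -> R) : lipschitz_with N h -> exists f f1 f2 B,
    C2b B f f1 f2 /\ forall x, Phi (h x) - r <= f x <= Phi (h x) + r.
  move=> Lh.
  have Lu x y : `|Phi (h x) - Phi (h y)| <= N * `|x - y|.
    by apply: (le_trans (Phi_lipschitz _ _)); rewrite mul1r.
  have u1 x : `|Phi (h x)| <= 1.
    by rewrite ger0_norm ltW ?Phi_lt1 ?Phi_gt0.
  have r'0 : 0 < r / (2 * N + 1) by rewrite divr_gt0// ltr_wpDl// mulr_ge0.
  have [f [f1 [f2 [B [fC fu]]]]] := smooth_approx r'0 Lu u1.
  exists f, f1, f2, B; split => // x.
  have : `|f x - Phi (h x)| <= r.
    apply: (le_trans (fu x)); rewrite mulrA ler_pdivrMr ?ltr_wpDl ?mulr_ge0//.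
    by rewrite mulrC ler_pM2l// lerDl.
  by rewrite ler_distl.
have [f [f1 [f2 [Bf [fC fP]]]]] := approx _ L0.
have [g [g1 [g2 [Bg [gC gP]]]]] := approx _ L1.
have [k [k1 [k2 [Bk [kC kP]]]]] := approx _ L2.
pose B := Num.max (Bf + `|r + e|) (Num.max (Bg + `|2 * r|) (Bk + `|2 * r|)).
have fC' : C2b B (fun x => f x + (r + e)) f1 f2.
  by apply: (C2b_le _ (C2b_shift (r + e) fC)); rewrite /B le_max lexx.
have gC' : C2b B (fun x => g x + 2 * r) g1 g2.
  by apply: (C2b_le _ (C2b_shift (2 * r) gC)); rewrite /B !le_max lexx orbT.
have kC' : C2b B (fun x => k x + 2 * r) k1 k2.
  by apply: (C2b_le _ (C2b_shift (2 * r) kC)); rewrite /B !le_max lexx !orbT.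
have fd x : r <= f x + (r + e) <= 1 - r.
  have /andP[b1 b2] := fP x; have := Phi_gt0 (h0 x).
  have : Phi (h0 x) <= Phi M by rewrite Phi_le.
  move: b1 b2 re eM e0 r0; move: (f x) (Phi (h0 x)) (Phi M); clear; move=> *; lra.
have gkd (u h : R -> R) : (forall x, h x <= M) ->
    (forall x, Phi (h x) - r <= u x <= Phi (h x) + r) ->
    forall x, r <= u x + 2 * r <= 1 - r.
  move=> hM uh x; have /andP[b1 b2] := uh x; have := Phi_gt0 (h x).
  have : Phi (h x) <= Phi M by rewrite Phi_le.
  move: b1 b2 re eM e0 r0; move: (u x) (Phi (h x)) (Phi M); clear; move=> *; lra.
have gd := gkd g h1 M1 gP; have kd := gkd k h2 M2 kP.
have PhiKr (u : R) : r <= u <= 1 - r -> Phi (Phinv u) = u.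
  move=> /andP[u1 u2]; apply: PhinvK; first exact: lt_le_trans u1.
  by apply: (le_lt_trans u2); rewrite gtrBl.
have init x y : l * Phinv (g x + 2 * r) + m * Phinv (k y + 2 * r) <=
    Phinv (f (l * x + m * y) + (r + e)).
  rewrite -Phi_le (PhiKr _ (fd _)).
  apply: (@le_trans _ _ (Phi (l * h1 x + m * h2 y) + e)).
    apply: hd; rewrite ?M1 ?M2//.
      have /andP[_ b2] := gP x; rewrite (PhiKr _ (gd _)).
      move: b2 rd; move: (g x) (Phi (h1 x)); clear; move=> *; lra.
    have /andP[_ b2] := kP y; rewrite (PhiKr _ (kd _)).
    move: b2 rd; move: (k y) (Phi (h2 y)); clear; move=> *; lra.
  have /andP[b1 _] := fP (l * x + m * y).
  have : Phi (l * h1 x + m * h2 y) <= Phi (h0 (l * x + m * y)).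
    by rewrite Phi_le; exact: hyp.
  move: b1; move: (f _) (Phi _) (Phi _); clear; move=> *; lra.
have := max_principle l0 m0 lm r0 fC' gC' kC' fd gd kd init 0 0.
rewrite !mulr0 addr0 /height !heat1 => main0.
have cC (C : R) (u u1 u2 : R -> R) : C2b C u u1 u2 -> subquadratic u.
  move=> [du _ b _]; apply: (@bounded_subquadratic _ _ C).
    exact: continuous_measurable_fun (is_derive_continuous du).
  by move=> x; have [] := b x.
have itv (C : R) (u u1 u2 : R -> R) : C2b C u u1 u2 ->
    (forall x, r <= u x <= 1 - r) -> r <= gE u <= 1 - r.
  move=> uC ur; have qu := cC _ _ _ _ uC; apply/andP; split.
    rewrite -[leLHS](@gE_cst R); apply: le_gE => //; first exact: subquadratic_cst.
    by move=> x; case/andP: (ur x).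
  rewrite -[leRHS](@gE_cst R); apply: le_gE => //; first exact: subquadratic_cst.
  by move=> x; case/andP: (ur x).
have main : Phi (l * Phinv (gE (fun x => g x + 2 * r)) +
    m * Phinv (gE (fun x => k x + 2 * r))) <= gE (fun x => f x + (r + e)).
  by rewrite -[leRHS](PhiKr _ (itv _ _ _ _ fC' fd)) Phi_le.
have up (u h : R -> R) (C : R) (u1 u2 : R -> R) : lipschitz_with N h ->
    C2b C (fun x => u x + 2 * r) u1 u2 ->
    (forall x, r <= u x + 2 * r <= 1 - r) ->
    (forall x, Phi (h x) - r <= u x <= Phi (h x) + r) ->
    Phinv (gE (fun y => Phi (h y))) <= Phinv (gE (fun x => u x + 2 * r)).
  move=> Lh uC ur uh; apply: Phinv_le.
  - exact: gE_Phi_gt0 Lh.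
  - apply: le_gE; [exact: subquadratic_Phi Lh|exact: cC uC|move=> x].
    have /andP[b1 _] := uh x; move: b1 r0; move: (u x) (Phi _); clear; move=> *; lra.
  - have /andP[_ b] := itv _ _ _ _ uC ur.
    by apply: (le_lt_trans b); rewrite gtrBl.
apply: (@le_trans _ _ (gE (fun x => f x + (r + e)))).
  apply: le_trans main; rewrite Phi_le; apply: lerD.
    by rewrite ler_pM2l//; exact: up L1 gC' gd gP.
  by rewrite ler_pM2l//; exact: up L2 kC' kd kP.
rewrite -[2 * e](@gE_cst R) -gED; last 2 first.
- exact: subquadratic_Phi L0.
- exact: subquadratic_cst.
apply: le_gE; first exact: cC fC'.
  by apply: subquadraticD; [exact: subquadratic_Phi L0|exact: subquadratic_cst].
move=> x; have /andP[_ b2] := fP x.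
by move: b2 re; move: (f x) (Phi _); clear; move=> *; lra.
Qed.

End ehrhard.

(** * Averages of affine functions *)

Section gaussian_affine.
Context {R : realType}.
Notation mu := (@lebesgue_measure R).
Notation phi := (normal_pdf (0 : R) 1).

Lemma phi_prime_le1 (x : R) : `|- x * phi x| <= 1.
Proof.
rewrite normrM normrN (gtr0_norm (phi_gt0 _)) normal_pdf01E.
have p1 : @normal_peak R 1 <= 1.
  by have := phi_le1 (0 : R); rewrite normal_pdf01E expr0n/= mul0r oppr0 expR0 mulr1.
rewrite mulrCA -[leRHS]mulr1; apply: ler_pM => //.
- exact: normal_peak_ge0.
- rewrite expRN ler_pdivrMr ?expR_gt0// mul1r.
  apply: (le_trans _ (expR_ge1Dx _)); rewrite -(real_normK (num_real x)).
  by have := sqr_ge0 (`|x| - 1); move: (`|x|) => z; nra.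
Qed.

Lemma phi_lipschitz (x y : R) : `|phi x - phi y| <= 1 * `|x - y|.
Proof. exact: bounded_deriv_lipschitz (@is_derive_normal_pdf R) phi_prime_le1 x y. Qed.

(** Completing the square in the product of two normal densities. *)
Lemma heat_phi (p c : R) :
  heat phi p c = phi (c / Num.sqrt (1 + p ^+ 2)) / Num.sqrt (1 + p ^+ 2).
Proof.
have q20 : 0 < 1 + p ^+ 2 by rewrite ltr_pwDl// sqr_ge0.
set q := Num.sqrt _; have q0 : 0 < q by rewrite sqrtr_gt0.
have q2 : q ^+ 2 = 1 + p ^+ 2 by rewrite sqr_sqrtr// ltW.
have qn0 : q != 0 by rewrite gt_eqF.
have cphi : continuous phi by apply: continuous_normal_pdf; rewrite oner_eq0.
have sq : subquadratic (fun y => phi (c + p * y)).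
  apply: (@subquadratic_heat _ _ 1) => // x.
  by rewrite ger0_norm ?phi_le1// ltW// phi_gt0.
apply: EFin_inj; rewrite /heat EFin_gE// ge0_integral_normal_prob; last 2 first.
- exact: (proj1 sq).
- by move=> x; rewrite ltW// phi_gt0.
rewrite -[RHS]mule1 -(@integral_normal_pdf R (- (c * p / q ^+ 2)) q^-1).
rewrite -ge0_integralZl; last 4 first.
- exact: measurableT.
- by apply/measurable_EFinP; exact: measurable_normal_pdf.
- by move=> x _; rewrite lee_fin normal_pdf_ge0.
- by rewrite lee_fin divr_ge0 ?(ltW q0)// ltW// phi_gt0.
apply: eq_integral => y _; rewrite -EFinM; congr EFin.
rewrite !normal_pdf01E normal_pdfE ?invr_eq0// /normal_fun.
have -> : normal_peak q^-1 = q * @normal_peak R 1.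
  rewrite /normal_peak exprVn expr1n mul1r -mulrnAr sqrtrM ?invr_ge0 ?sqr_ge0//.
  by rewrite -exprVn sqrtr_sqr gtr0_norm ?invr_gt0// invfM invrK.
set k := @normal_peak R 1.
rewrite mulrACA -expRD.
rewrite (_ : _ / q * (q * k * _) = k * k * (expR (- ((c / q) ^+ 2 / 2)) *
  expR (- (y - - (c * p / q ^+ 2)) ^+ 2 / (q^-1 ^+ 2 *+ 2)))); last by field.
rewrite -expRD; congr (_ * expR _); rewrite -(mulr_natr (q^-1 ^+ 2)).
rewrite (_ : - (y - - (c * p / q ^+ 2)) ^+ 2 / (q^-1 ^+ 2 * 2) =
  - (q ^+ 2 * (y + c * p / q ^+ 2) ^+ 2 / 2)); last by field.
rewrite expr_div_n q2; field; exact: lt0r_neq0.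
Qed.

(** A quadratic majorant of the upper tail, whose expectation is explicit. *)
Lemma Phi_quad_lower (A x : R) : 0 < A -> 1 - Phi x <= (1 - Phi A) + (x - 2 * A) ^+ 2 / A ^+ 2.
Proof.
move=> A0; have [xA|Ax] := leP A x.
  have h : Phi A <= Phi x by rewrite Phi_le.
  have h' : 0 <= (x - 2 * A) ^+ 2 / A ^+ 2 by rewrite divr_ge0 ?sqr_ge0.
  move: h h'; move: (_ / _) (Phi _) (Phi _); clear; move=> *; lra.
have h : 1 <= (x - 2 * A) ^+ 2 / A ^+ 2.
  rewrite ler_pdivlMr ?exprn_gt0// mul1r -[leRHS]sqrrN lerXn2r ?nnegrE ?ltW//; lra.
have h1 := Phi_gt0 x; have h2 := Phi_lt1 A.
move: h h1 h2; move: (_ / _) (Phi _) (Phi _); clear; move=> *; lra.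
Qed.

(** If W is standard normal and independent of Y, the left-hand side is the
    probability of W - p Y <= c, and W - p Y has variance 1 + p^2. Both sides have
    the same derivative in c by heat_phi, and the same limit 1 at infinity. *)
Lemma gE_Phi_affine (p c : R) :
  gE (fun y => Phi (c + p * y)) = Phi (c / Num.sqrt (1 + p ^+ 2)).
Proof.
have q20 : 0 < 1 + p ^+ 2 by rewrite ltr_pwDl// sqr_ge0.
set q := Num.sqrt _; have q0 : 0 < q by rewrite sqrtr_gt0.
have PB (x : R) : `|Phi x| <= 1 by rewrite ger0_norm ltW ?Phi_lt1 ?Phi_gt0.
have pB (x : R) : `|phi x| <= 1.
  by rewrite ger0_norm ?phi_le1// ltW// phi_gt0.
pose D c := heat Phi p c - Phi (c / q).
have dD (t : R) : is_derive t 1 D 0.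
  have d1 := @is_derive_heat_x _ _ _ 1 p t (@is_derive_Phi R) PB pB phi_lipschitz.
  have d2 := is_derive_affine_comp 0 q^-1 t (@is_derive_Phi R).
  have DE : D = fun t => heat Phi p t - Phi (0 + q^-1 * t).
    by apply/funext => u; rewrite /D add0r mulrC.
  rewrite DE; apply: is_derive_eq.
  by rewrite heat_phi -/q add0r mulrC [q^-1 * t]mulrC subrr.
have Dc (t : R) : D t = D 0 by exact: is_derive_0_is_cst.
suff D0 : D c = 0 by apply/eqP; rewrite -subr_eq0; apply/eqP; exact: D0.
apply/eqP; rewrite -normr_eq0 eq_le normr_ge0 andbT.
apply/ler_addgt0Pr => e e0; rewrite add0r.
have [A1 hA1] : exists x, 1 - e / 3 < Phi x :> R by apply: Phi_above; lra.
pose A := Num.max `|A1| (Num.max (q * `|A1|) (Num.max 1 (3 * p ^+ 2 / e))).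
have A1A : A1 <= A by rewrite le_max (ler_norm _).
have qA : q * A1 <= A.
  by rewrite !le_max (ler_pM2l q0) (ler_norm _) orbT.
have A1' : 1 <= A by rewrite !le_max lexx !orbT.
have Ae : 3 * p ^+ 2 / e <= A by rewrite !le_max lexx !orbT.
have A0 : 0 < A := lt_le_trans ltr01 A1'.
have sq (a : R) : subquadratic (fun y => Phi (a + p * y)).
  by apply: (@subquadratic_heat _ _ 1) => //; exact: continuous_Phi.
rewrite (Dc c) -(Dc (2 * A)).
have h1 : 1 - e / 3 <= Phi (2 * A / q).
  apply: (le_trans (ltW hA1)); rewrite Phi_le ler_pdivlMr// mulrC.
  by apply: (le_trans qA); rewrite ler_peMl ?(ltW A0)// ler1n.
have h2 : 1 - heat Phi p (2 * A) <= 2 * e / 3.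
  rewrite -[X in X - _ <= _](@gE_cst R 1) /heat -gEB//; last exact: subquadratic_cst.
  apply: (@le_trans _ _ (gE (fun y => (1 - Phi A) + p ^+ 2 / A ^+ 2 * y ^+ 2))).
    apply: le_gE.
    - by apply: subquadraticB => //; exact: subquadratic_cst.
    - apply: subquadraticD; first exact: subquadratic_cst.
      exact/subquadraticZ/subquadratic_sqr.
    - move=> y; apply: (le_trans (Phi_quad_lower _ A0)).
      by rewrite [_ + _ * y]addrC addrK exprMn mulrAC.
  rewrite gED; [|exact: subquadratic_cst|exact/subquadraticZ/subquadratic_sqr].
  rewrite gE_cst gEZ; last exact: subquadratic_sqr.
  rewrite gE_sqr mulr1.
  have : p ^+ 2 / A ^+ 2 <= e / 3.
    rewrite ler_pdivrMr ?exprn_gt0//.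
    have : A <= A ^+ 2 by rewrite expr2 ler_peMl// ltW.
    move: Ae; rewrite ler_pdivrMr// => h h'.
    have : e * A <= e * A ^+ 2 by rewrite ler_pM2l.
    move: h; move: (p ^+ 2) (A ^+ 2); clear; move=> *; lra.
  have : Phi A1 <= Phi A by rewrite Phi_le.
  move: hA1; move: (_ / A ^+ 2) (Phi _) (Phi _); clear; move=> *; lra.
have h3 := Phi_lt1 (2 * A / q).
have h4 : heat Phi p (2 * A) <= 1.
  by have := norm_heat_le p (2 * A) (@continuous_Phi R) PB; apply: le_trans; rewrite ler_norm.
rewrite /D; move: h1 h2 h3 h4; move: (heat _ _ _) (Phi _); clear; move=> u v *.
by apply/ler_normlP; split; lra.
Qed.

End gaussian_affine.

(** * Gaussian averages of concave functions *)

Section gaussian_averaging.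
Context {R : realType} {V : normedModType R}.
Notation phi := (normal_pdf (0 : R) 1).

Definition concave_on (h : V -> R) := forall l m x y, 0 < l -> 0 < m ->
  l + m = 1 -> l * h x + m * h y <= h (l *: x + m *: y).

(** The class preserved by averaging. The Lipschitz constant bounds slopes
    along lines, and the upper bound keeps E [Phi o h] away from 1, where Phi^-1
    is undefined. *)
Definition capped_concave (N M : R) (h : V -> R) := [/\ concave_on h,
  forall x y, `|h x - h y| <= N * `|x - y| & forall x, h x <= M].

(** The quasi-arithmetic mean of h along a Gaussian multiple of a, on the scale
    of Phi: its composite with Phi is the ordinary average of Phi o h. *)
Definition gavg (a : V) (h : V -> R) (z : V) : R :=
  Phinv (gE (fun y => Phi (h (z + y *: a)))).

Lemma lipschitz_line (N : R) (h : V -> R) (a z : V) :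
  (forall x y, `|h x - h y| <= N * `|x - y|) ->
  lipschitz_with (N * `|a|) (fun y => h (z + y *: a)).
Proof.
move=> Lh x y; apply: (le_trans (Lh _ _)).
rewrite (_ : z + x *: a - (z + y *: a) = (x - y) *: a).
  by rewrite normrZ mulrA mulrAC.
by rewrite opprD addrACA subrr add0r scalerBl.
Qed.

(** The function v |-> Phi (Phi^-1 v + c) is concave; the right-hand side is its
    tangent line at Phi H, of slope phi (H + c) / phi H. *)
Lemma Phi_shift_tangent (c H t : R) : 0 <= c ->
  Phi (t + c) <= Phi (H + c) + expR (- (H * c + c ^+ 2 / 2)) * (Phi t - Phi H).
Proof.
move=> c0; set w := expR _.
pose D s := Phi (H + c) + w * (Phi s - Phi H) - Phi (s + c).
have phic s : phi (s + c) = expR (- (s * c + c ^+ 2 / 2)) * phi s.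
  by rewrite !normal_pdf01E mulrCA -expRD; congr (_ * expR _); field.
have dD (s : R) : is_derive s 1 D ((w - expR (- (s * c + c ^+ 2 / 2))) * phi s).
  have d1 := is_derive_Phi s.
  have d2 := is_derive_shift c s (@is_derive_Phi R).
  have DE : D = fun s => Phi (H + c) + w * (Phi s - Phi H) - Phi (c + s).
    by apply/funext => u; rewrite /D (addrC c).
  rewrite DE; apply: is_derive_eq.
  rewrite (addrC c) phic /GRing.scale/=; ring.
have DH : D H = 0 by rewrite /D subrr mulr0 addr0 subrr.
suff : 0 <= D t by rewrite subr_ge0.
have [Ht|/ltW tH] := leP H t.
  have [s /andP[s1 _]] := mean_value_between dD Ht.
  rewrite DH subr0 => ->; rewrite mulr_ge0 ?subr_ge0// mulr_ge0 ?(ltW (phi_gt0 _))//.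
  by rewrite subr_ge0 ler_expR lerN2 lerD2r ler_wpM2r.
have [s /andP[_ s1]] := mean_value_between dD tH.
rewrite DH sub0r => E; rewrite -oppr_le0 E mulr_le0_ge0 ?subr_ge0//.
rewrite mulr_le0_ge0 ?(ltW (phi_gt0 _))// subr_le0 ler_expR lerN2 lerD2r.
by rewrite ler_wpM2r.
Qed.

(** Jensen's inequality for the concave function v |-> Phi (Phi^-1 v + c). *)
Lemma Phi_mean_shift (N M c : R) (k : R -> R) : 0 <= c -> lipschitz_with N k ->
  (forall y, k y <= M) ->
  Phinv (gE (fun y => Phi (k y + c))) <= Phinv (gE (fun y => Phi (k y))) + c.
Proof.
move=> c0 Lk kM.
have Lkc : lipschitz_with N (fun y => k y + c).
  by move=> x y; rewrite opprD addrACA subrr addr0.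
have kcM y : k y + c <= M + c by rewrite lerD2r.
have q1 := subquadratic_Phi Lk; have q2 := subquadratic_Phi Lkc.
rewrite -Phi_le (Phi_gE_Phi Lkc kcM).
have EH := Phi_gE_Phi Lk kM; set H := Phinv _ in EH *.
have qw : subquadratic (fun y => expR (- (H * c + c ^+ 2 / 2)) * (Phi (k y) - Phi H)).
  by apply/subquadraticZ/subquadraticB => //; exact: subquadratic_cst.
apply: (@le_trans _ _ (gE (fun y => Phi (H + c) +
    expR (- (H * c + c ^+ 2 / 2)) * (Phi (k y) - Phi H)))).
  apply: le_gE => //; first by apply: subquadraticD => //; exact: subquadratic_cst.
  by move=> y; exact: Phi_shift_tangent.
rewrite gED//; last exact: subquadratic_cst.
rewrite gEZ; last by apply: subquadraticB => //; exact: subquadratic_cst.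
rewrite gEB//; last exact: subquadratic_cst.
by rewrite !gE_cst -EH subrr mulr0 addr0.
Qed.

(** Concavity is Ehrhard's inequality along the direction a. For the Lipschitz
    bound, h (x + .) <= h (y + .) + N |x - y|, and Phi_mean_shift moves the
    constant out of the mean. *)
Lemma capped_concave_gavg (N M : R) (a : V) (h : V -> R) :
  capped_concave N M h -> capped_concave N M (gavg a h).
Proof.
move=> [ch Lh hM].
have Ll z := lipschitz_line a z Lh.
have lM z y : h (z + y *: a) <= M by exact: hM.
have N0 : 0 <= N * `|a|.
  by have := le_trans (normr_ge0 _) (Ll 0 1 0); rewrite subr0 normr1 mulr1.
split.
- move=> l m x y l0 m0 lm; rewrite /gavg.
  apply: (functional_ehrhard l0 m0 lm (Ll _) (Ll _) (Ll _) (lM _) (lM _) (lM _)).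
  move=> s t; apply: (le_trans (ch _ _ _ _ l0 m0 lm)).
  rewrite (_ : l *: (x + s *: a) + m *: (y + t *: a) =
    l *: x + m *: y + (l * s + m * t) *: a)//.
  by rewrite !scalerDr !scalerA scalerDl addrACA.
- have half x y : gavg a h x - gavg a h y <= N * `|x - y|.
    have c0 : 0 <= N * `|x - y| by apply: le_trans (normr_ge0 _) (Lh x y).
    have := Phi_mean_shift c0 (Ll y) (lM y); rewrite lerBlDl; apply: le_trans.
    have Lc : lipschitz_with (N * `|a|) (fun t => h (y + t *: a) + N * `|x - y|).
      by move=> s t; rewrite opprD addrACA subrr addr0; exact: Ll.
    have cM t : h (y + t *: a) + N * `|x - y| <= M + N * `|x - y| by rewrite lerD2r.
    have e1 : Phi (gavg a h x) = _ := Phi_gE_Phi (Ll x) (lM x).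
    rewrite -Phi_le [leLHS]e1 [leRHS](Phi_gE_Phi Lc cM).
    apply: le_gE; [exact: subquadratic_Phi (Ll x)|exact: subquadratic_Phi Lc|].
    move=> t; rewrite Phi_le -lerBlDl; apply: (le_trans (ler_norm _)).
    apply: (le_trans (Lh _ _)).
    by rewrite opprD addrACA subrr addr0.
  move=> x y; apply/ler_normlP; split; last exact: half.
  by rewrite opprB distrC; exact: half.
- move=> x; rewrite -Phi_le /gavg (Phi_gE_Phi (Ll x) (lM x)).
  exact: gE_Phi_le (Ll x) (lM x).
Qed.

Lemma Phi_gavg (N M : R) (a z : V) (h : V -> R) : capped_concave N M h ->
  Phi (gavg a h z) = gE (fun y => Phi (h (z + y *: a))).
Proof.
by move=> [_ Lh hM]; exact: Phi_gE_Phi (lipschitz_line a z Lh) (fun y => hM _).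
Qed.

(** The slope is the supremum of the difference quotients to the right of 0. *)
Lemma concave_supergradient (L : R) (k : R -> R) :
  (forall l m x y, 0 < l -> 0 < m -> l + m = 1 ->
    l * k x + m * k y <= k (l * x + m * y)) -> lipschitz_with L k ->
  exists2 p, `|p| <= L & forall y, k y <= k 0 + p * y.
Proof.
move=> ck Lk.
pose S := [set (k y - k 0) / y | y in [set y | 0 < y]].
have SL s : S s -> `|s| <= L.
  move=> [y /= y0 <-]; rewrite normrM normfV ler_pdivrMr ?normr_gt0 ?gt_eqF//.
  by have := Lk y 0; rewrite subr0.
have S1 : S ((k 1 - k 0) / 1) by exists 1 => //=; exact: ltr01.
have hS : has_sup S.
  by split; [eexists; exact: S1|exists L => s /SL; apply: le_trans; exact: ler_norm].
exists (sup S).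
  apply/ler_normlP; split.
    have : (k 1 - k 0) / 1 <= sup S by apply: sup_upper_bound.
    by have /ler_normlP[] := SL _ S1; move: (_ / _) (sup S); clear; move=> *; lra.
  apply: ge_sup; first by eexists; exact: S1.
  by move=> s /SL; apply: le_trans; exact: ler_norm.
move=> y; have [y0|y0|<-] := ltgtP 0 y; last by rewrite mulr0 addr0.
- rewrite -lerBlDl -ler_pdivrMr//; apply: sup_upper_bound => //.
  by exists y.
- rewrite -lerBlDl -ler_ndivlMr//; apply: ge_sup; first by eexists; exact: S1.
  move=> s [t /= t0 <-].
  have yt : 0 < t - y by rewrite subr_gt0 (lt_trans y0).
  have := ck (- y / (t - y)) (t / (t - y)) t y.
  rewrite !divr_gt0 ?oppr_gt0// => /(_ isT isT).
  rewrite -mulrDl (addrC (- y)) divff ?gt_eqF// => /(_ erefl).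
  rewrite (_ : _ * t + _ * y = 0); last by field; rewrite gt_eqF.
  rewrite (_ : _ * k t + _ * k y = (- y * k t + t * k y) / (t - y)); last first.
    by field; rewrite gt_eqF.
  rewrite ler_pdivrMr// => h.
  rewrite ler_pdivrMr// mulrAC ler_ndivlMr//.
  by move: h; move: (k t) (k y) (k 0); clear; move=> *; lra.
Qed.

(** Along the line through z in the direction b, h is below the affine function
    c + p y with c = h z, whose average is c / q with q = sqrt (1 + p^2). Hence
    q * gavg b h z <= h z with 1 <= q <= 1 + N |b|; according to the sign of the
    average, one or the other bound on q is used. *)
Lemma gavg_compare (N M : R) (b z : V) (h : V -> R) : capped_concave N M h ->
  Num.min (gavg b h z) ((1 + N * `|b|) * gavg b h z) <= h z.
Proof.
move=> hcap; have EQ := Phi_gavg b z hcap.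
case: hcap => ch Lh hM; have Ll := lipschitz_line b z Lh.
have [p pL hp] : exists2 p, `|p| <= N * `|b| & forall y,
    h (z + y *: b) <= h (z + 0 *: b) + p * y.
  apply: (@concave_supergradient _ (fun y => h (z + y *: b))) => // l m x y l0 m0 lm.
  apply: (le_trans (ch _ _ _ _ l0 m0 lm)).
  rewrite (_ : l *: (z + x *: b) + m *: (z + y *: b) = z + (l * x + m * y) *: b)//.
  by rewrite !scalerDr !scalerA addrACA -!scalerDl lm scale1r.
rewrite scale0r addr0 in hp.
set c := h z in hp *; set Q := gavg b h z in EQ *.
have q20 : 0 < 1 + p ^+ 2 by rewrite ltr_pwDl// sqr_ge0.
set q := Num.sqrt (1 + p ^+ 2); have q0 : 0 < q by rewrite sqrtr_gt0.
have Qc : q * Q <= c.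
  rewrite mulrC -ler_pdivlMr// -Phi_le EQ -gE_Phi_affine.
  apply: le_gE => //; first exact: subquadratic_Phi Ll.
    apply: (@subquadratic_heat _ _ 1); first exact: continuous_Phi.
    by move=> x; rewrite ger0_norm ltW ?Phi_lt1 ?Phi_gt0.
  by move=> y; rewrite Phi_le.
have q1 : 1 <= q.
  by rewrite -[leLHS]sqrtr1 ler_sqrt ?(ltW q20)// lerDl sqr_ge0.
have qN : q <= 1 + N * `|b|.
  apply: (@le_trans _ _ (1 + `|p|)); last by rewrite lerD2l.
  have p1 : 0 <= 1 + `|p| by rewrite addr_ge0.
  rewrite -[leRHS](ger0_norm p1) -sqrtr_sqr ler_sqrt ?sqr_ge0//.
  have := normr_ge0 p; rewrite -(real_normK (num_real p)).
  by move: (`|p|); clear; move=> *; nra.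
rewrite ge_min; have [Q0|/ltW Q0] := leP 0 Q.
  by apply/orP; left; apply: le_trans Qc; rewrite ler_peMl.
by apply/orP; right; apply: le_trans Qc; rewrite ler_wnM2r.
Qed.

Definition gavgs (bs : seq V) (h : V -> R) : V -> R := foldr gavg h bs.

Lemma capped_concave_gavgs (N M : R) (bs : seq V) (h : V -> R) :
  capped_concave N M h -> capped_concave N M (gavgs bs h).
Proof. by move=> ch; elim: bs => //= b bs IH; exact: capped_concave_gavg. Qed.

Lemma gavgs_compare (N M : R) (bs : seq V) (z : V) (h : V -> R) : capped_concave N M h ->
  Num.min (gavgs bs h z) ((\prod_(b <- bs) (1 + N * `|b|)) * gavgs bs h z) <= h z.
Proof.
move=> ch; have N0 : forall b : V, 0 <= N * `|b|.
  move=> b; case: ch => _ Lh _.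
  by have := le_trans (normr_ge0 _) (Lh b 0); rewrite subr0.
elim: bs => [|b bs IH]; first by rewrite /= big_nil mul1r minxx.
rewrite /= big_cons.
have := gavg_compare b z (capped_concave_gavgs bs ch).
set g := gavgs bs h z in IH *; set Q := gavg b _ z.
set K := \prod_(b <- bs) _ in IH *.
have K1 : 1 <= K.
  rewrite /K; elim: (bs) => [|c cs IHc]; first by rewrite big_nil.
  by rewrite big_cons mulr_ege1// lerDl.
have K0 : 0 < K := lt_le_trans ltr01 K1.
have b1 : 1 <= 1 + N * `|b| by rewrite lerDl.
have b0 := lt_le_trans ltr01 b1.
set B := 1 + N * `|b| in b1 b0 *.
rewrite !ge_min in IH *.
have [Q0|Q0] := leP 0 Q.
  move=> QBg; have {QBg}Qg : Q <= g.
    by case/orP: QBg => //; apply: le_trans; rewrite ler_peMl.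
  have g0 := le_trans Q0 Qg.
  case/orP: IH => [gh|gh]; first by rewrite (le_trans Qg).
  by rewrite (le_trans Qg)// (le_trans _ gh)// ler_peMl.
move=> QBg; have {QBg}Qg : B * Q <= g.
  by case/orP: QBg => //; apply: le_trans; rewrite -[leRHS]mul1r ler_wnM2r// ltW.
apply/orP; right; rewrite (mulrC B) -mulrA.
case/orP: IH => [gh|gh]; last by apply: le_trans gh; rewrite ler_pM2l.
apply: le_trans gh; apply: le_trans Qg.
by rewrite ler_neMl// nmulr_lle0// ltW.
Qed.

End gaussian_averaging.

(** * The distance to a convex set *)

Section distance_to_set.
Context {R : realType} {V : normedModType R}.
Variable K : set V.
Hypothesis K0 : K !=set0.

Definition infdist (z : V) : R := inf [set `|z - k| | k in K].

Let hlb z : has_inf [set `|z - k| | k in K].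
Proof.
have [k Kk] := K0; split; first by exists `|z - k|, k.
by exists 0 => _ [k' _ <-].
Qed.

Lemma infdist_ge0 (z : V) : 0 <= infdist z.
Proof. by apply: lb_le_inf; [exact: (hlb z).1|move=> _ [k _ <-]]. Qed.

Lemma infdist_le (z k : V) : K k -> infdist z <= `|z - k|.
Proof. by move=> Kk; apply: ge_inf; [exact: (hlb z).2|exists k]. Qed.

Lemma infdist_near (z : V) (e : R) : 0 < e -> exists2 k, K k & `|z - k| < infdist z + e.
Proof.
by move=> e0; have [_ [k Kk <-] h] := inf_adherent e0 (hlb z); exists k.
Qed.

Lemma infdist_in (z : V) : K z -> infdist z = 0.
Proof.
move=> Kz; apply/eqP; rewrite eq_le infdist_ge0 andbT.
by have := infdist_le z Kz; rewrite subrr normr0.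
Qed.

Lemma infdist_gt0 (z : V) : closed K -> ~ K z -> 0 < infdist z.
Proof.
move=> cK nKz; rewrite lt_neqAle infdist_ge0 andbT eq_sym; apply/eqP => d0.
apply: nKz; apply: cK => B /nbhs_ballP [e /= e0 eB].
have [k Kk] := infdist_near z e0; rewrite d0 add0r => h.
by exists k; split => //; apply: eB; rewrite -ball_normE.
Qed.

Lemma infdist_lipschitz (x y : V) : `|infdist x - infdist y| <= `|x - y|.
Proof.
have half (u v : V) : infdist u - infdist v <= `|u - v|.
  apply/ler_addgt0Pr => e e0; have [k Kk h] := infdist_near v e0.
  have := infdist_le u Kk; have := ler_distD v u k.
  move: h; move: (infdist u) (infdist v) (`|_|) (`|_|) (`|_|).
  by clear; move=> *; lra.
by apply/ler_normlP; split; [rewrite opprB distrC; exact: half|exact: half].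
Qed.

Lemma infdist_convex (l m : R) (x y : V) : convex_set K -> 0 < l -> 0 < m ->
  l + m = 1 -> infdist (l *: x + m *: y) <= l * infdist x + m * infdist y.
Proof.
move=> cK l0 m0 lm; apply/ler_addgt0Pr => e e0.
have [a Ka ha] := infdist_near x e0; have [b Kb hb] := infdist_near y e0.
have Kab : K (l *: a + m *: b).
  have l01 : 0 <= l <= 1 by rewrite ltW//= -lm lerDl ltW.
  have := cK a b (Itv01 (andP l01).1 (andP l01).2) (mem_set Ka) (mem_set Kb).
  rewrite inE /conv/=.
  suff -> : m = unstable.onem l by [].
  by rewrite /unstable.onem -lm [l + m]addrC addrK.
apply: (le_trans (infdist_le _ Kab)).
rewrite (_ : _ - _ = l *: (x - a) + m *: (y - b)); last first.
  by rewrite opprD addrACA -!scalerBr.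
apply: (le_trans (ler_normD _ _)); rewrite !normrZ !gtr0_norm//.
have h1 : l * `|x - a| <= l * (infdist x + e) by rewrite ler_pM2l// ltW.
have h2 : m * `|y - b| <= m * (infdist y + e) by rewrite ler_pM2l// ltW.
apply: (le_trans (lerD h1 h2)).
by rewrite !mulrDr addrACA -(mulrDl l m e) lm mul1r.
Qed.

Lemma capped_concave_infdist (N M : R) : convex_set K -> 0 <= N ->
  capped_concave N M (fun z => M - N * infdist z).
Proof.
move=> cK N0; split.
- move=> l m x y l0 m0 lm; have := infdist_convex x y cK l0 m0 lm.
  move=> /(ler_wpM2l N0); have -> : M = l * M + m * M by rewrite -mulrDl lm mul1r.
  move: (infdist _) (infdist x) (infdist y) => u v w h.
  rewrite -subr_ge0 (_ : _ - _ = N * (l * v + m * w) - N * u) ?subr_ge0//.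
  have -> : m = 1 - l by rewrite -lm [l + m]addrC addrK.
  ring.
- move=> x y; rewrite (_ : _ - _ = N * infdist y - N * infdist x); last by ring.
  rewrite -mulrBr normrM ger0_norm// distrC.
  by apply: ler_wpM2l => //; exact: infdist_lipschitz.
- by move=> x; rewrite gerBl mulr_ge0// infdist_ge0.
Qed.

End distance_to_set.

(** * Loss of level below one half *)

Section level_comparison.
Context {R : realType}.
Notation phi := (normal_pdf (0 : R) 1).

Lemma Phi0 : Phi (0 : R) = 1 / 2.
Proof.
pose D (x : R) := Phi x + Phi (- x).
have dD (x : R) : is_derive x 1 D 0.
  have d1 := is_derive_Phi x.
  have d2 := is_derive_affine_comp 0 (-1) x (@is_derive_Phi R).
  have DE : D = fun x => Phi x + Phi (0 + -1 * x).
    by apply/funext => u; rewrite /D add0r mulN1r.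
  have even : phi (- x) = phi x by rewrite !normal_pdf01E sqrrN.
  rewrite DE; apply: (is_derive_eq (is_deriveD d1 d2)).
  by rewrite add0r !mulN1r even subrr.
have D0 (x : R) : D x = D 0 by exact: is_derive_0_is_cst.
have DE0 : D 0 = 2 * Phi 0 by rewrite /D oppr0; ring.
suff : D 0 = 1 by rewrite DE0; move: (Phi 0); clear; move=> *; lra.
apply/eqP; rewrite -subr_eq0 -normr_eq0 eq_le normr_ge0 andbT.
apply/ler_addgt0Pr => e e0; rewrite add0r.
have [a ha] : exists x, 1 - e < Phi x :> R by apply: Phi_above; lra.
have [b hb] := @Phi_below R e e0.
pose x := Num.max a (- b).
have h1 : Phi a <= Phi x by rewrite Phi_le /x le_max lexx.
have h2 : Phi (- x) <= Phi b by rewrite Phi_le lerNl /x le_max lexx orbT.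
have h3 := Phi_lt1 x; have h4 := Phi_gt0 (- x).
rewrite -(D0 x) /D; move: ha hb h1 h2 h3 h4.
move: (Phi a) (Phi b) (Phi x) (Phi (- x)); clear; move=> *.
by apply/ler_normlP; split; lra.
Qed.

(** The third hypothesis says that HY is negative by little: Phi HY is at
    least 1/2 - q/2, and Phi has slope at least phi 1 on [-1, 0]. Scaling a
    negative HY by C then moves Phi, which is 1-Lipschitz, by at most the stated
    error. For HY < -1 the error is already at least 1. *)
Lemma level_loss (C HX HY q : R) : 1 <= C -> Num.min HY (C * HY) <= HX ->
  1 - q <= Phi HY *+ 2 -> 0 <= q -> Phi HY - C * q / (2 * phi 1) <= Phi HX.
Proof.
move=> C1 minH hq q0; have C0 : 0 < C := lt_le_trans ltr01 C1.
have p0 : 0 < phi 1 by exact: phi_gt0.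
have loss0 : 0 <= C * q / (2 * phi 1).
  by rewrite divr_ge0 ?mulr_ge0 ?(ltW C0) ?(ltW p0).
have [HY0|HY0] := leP 0 HY.
  apply: (@le_trans _ _ (Phi HY)); first by rewrite gerBl.
  rewrite Phi_le; apply: le_trans minH; rewrite le_min lexx /=.
  by rewrite ler_peMl.
have CH : C * HY <= HX by apply: le_trans minH; rewrite le_min lexx andbT
  -[leRHS]mul1r ler_wnM2r// ltW.
have dlt : 1 / 2 - Phi HY <= q / 2 by move: hq; rewrite mulr2n;
  move: (Phi HY); clear; move=> *; lra.
have [HY1|HY1] := leP (-1) HY; last first.
  apply: (@le_trans _ _ 0); last by rewrite ltW// Phi_gt0.
  have h : phi 1 <= 1 / 2 - Phi HY.
    have [c /andP[c1 c2] E] := mean_value_between (@is_derive_Phi R) (lerN10 R).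
    have : phi 1 <= phi c.
      by apply: phi_mono; rewrite normr1; apply/ler_normlP; split; lra.
    have : Phi HY < Phi (-1) by rewrite Phi_lt.
    move: E; rewrite Phi0 sub0r opprK mulr1.
    move: (phi c) (phi 1) (Phi HY) (Phi (-1)); clear; move=> *; lra.
  have : 1 <= C * q / (2 * phi 1).
    rewrite ler_pdivlMr ?mulr_gt0// mul1r.
    apply: (@le_trans _ _ (C * (2 * phi 1))); last first.
      by rewrite ler_pM2l//; move: h dlt; move: (phi 1) (Phi HY); clear; move=> *; lra.
    by rewrite ler_peMl// mulr_ge0// ltW.
  have := Phi_lt1 HY; move: (Phi HY) (_ / _); clear; move=> *; lra.
have small : - HY * phi 1 <= q / 2.
  apply: (le_trans _ dlt).
  have [c /andP[c1 c2] E] := mean_value_between (@is_derive_Phi R) (ltW HY0).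
  rewrite -Phi0 E sub0r mulrC ler_wpM2r ?oppr_ge0 ?(ltW HY0)//.
  by apply: phi_mono; rewrite normr1; apply/ler_normlP; split; lra.
have h1 : Phi (C * HY) <= Phi HX by rewrite Phi_le.
have h2 : 1 / 2 - Phi (C * HY) <= C * - HY.
  rewrite -Phi0; apply: (le_trans (ler_norm _)).
  apply: (le_trans (Phi_lipschitz _ _)).
  by rewrite mul1r sub0r -mulrN ger0_norm// mulr_ge0 ?(ltW C0)// oppr_ge0 ltW.
have h3 : C * - HY <= C * q / (2 * phi 1).
  rewrite -mulrA ler_pM2l// ler_pdivlMr ?mulr_gt0// mulrCA.
  by move: small; move: (phi 1); clear; move=> *; lra.
have h4 : Phi HY <= 1 / 2 by rewrite -Phi0 Phi_le ltW.
move: h1 h2 h3 h4; move: (Phi _) (Phi _) (Phi _) (_ / (2 * _)).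
clear; move=> *; lra.
Qed.

(** The product is at most a constant times n^(2r), with r the number of
    factors, and expR n is at least a constant times n^(2r+1). *)
Lemma prod_expR_decay (bs : seq R) : (forall b, b \in bs -> 0 <= b) ->
  exists A, forall n : nat, (0 < n)%N ->
    (\prod_(b <- bs) (1 + n%:R ^+ 2 * b)) * expR (- n%:R) <= A / n%:R.
Proof.
move=> bs0; pose B := 1 + \sum_(b <- bs) b; pose r := size bs.
pose k := (2 * r)%N.+1.
have sum0 : 0 <= \sum_(b <- bs) b.
  by rewrite big_seq; apply: sumr_ge0 => b /bs0.
have bB b : b \in bs -> b <= \sum_(b <- bs) b.
  move=> bbs; rewrite (big_rem b)//= lerDl big_seq.
  by apply: sumr_ge0 => c /mem_rem /bs0.
exists (B ^+ r * k%:R ^+ k) => n n0.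
have n1 : (1 : R) <= n%:R by rewrite ler1n.
have n0' : (0 : R) < n%:R by rewrite ltr0n.
have k0 : (0 : R) < k%:R by rewrite ltr0n.
have prodB (cs : seq R) : (forall b, b \in cs -> 0 <= b <= \sum_(b <- bs) b) ->
    0 <= \prod_(b <- cs) (1 + n%:R ^+ 2 * b) <= (B * n%:R ^+ 2) ^+ size cs.
  elim: cs => [|c cs IH] h; first by rewrite big_nil expr0 ler01 lexx.
  have /andP[c0 c1] := h c (mem_head _ _).
  have /andP[p0 p1] := IH (fun b bcs => h b (@mem_behead _ (c :: cs) b bcs)).
  have nc0 : 0 <= 1 + n%:R ^+ 2 * c by rewrite addr_ge0// mulr_ge0.
  rewrite big_cons; apply/andP; split; first exact: mulr_ge0.
  rewrite [leRHS]exprS; apply: ler_pM => //.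
  rewrite /B mulrDl mul1r (mulrC (\sum_(b <- bs) b)); apply: lerD.
    by rewrite exprn_ege1.
  by rewrite ler_wpM2l.
have /andP[_ pr] : _ <= _ <= _ := prodB bs (fun b hb => introT andP (conj (bs0 b hb) (bB b hb))).
have ex : (n%:R / k%:R) ^+ k <= expR (n%:R : R).
  have -> : expR (n%:R : R) = expR (n%:R / k%:R) ^+ k.
    by rewrite -expRM_natr divfK// gt_eqF.
  rewrite lerXn2r ?nnegrE ?divr_ge0 ?expR_ge0//.
  by apply: (le_trans _ (expR_ge1Dx _)); rewrite lerDr.
rewrite expRN ler_pdivrMr ?expR_gt0//; apply: (le_trans pr).
have Bk0 : 0 <= B ^+ r * k%:R ^+ k / n%:R.
  by rewrite divr_ge0// mulr_ge0// exprn_ge0// addr_ge0.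
apply: (le_trans _ (ler_wpM2l Bk0 ex)).
rewrite exprMn -exprM expr_div_n -/r.
have -> : (n%:R : R) ^+ k = n%:R * n%:R ^+ (2 * r)%N by rewrite /k exprS.
have kk0 : (k%:R : R) ^+ k != 0 by rewrite expf_neq0// gt_eqF.
rewrite le_eqVlt; apply/orP; left; apply/eqP; move: kk0 (lt0r_neq0 n0').
move: ((k%:R : R) ^+ k) ((n%:R : R) ^+ (2 * r)%N) (B ^+ r) (n%:R : R).
by clear => a b c d a0 d0; field; rewrite a0 d0.
Qed.

End level_comparison.

(** * Borel sets of column vectors *)

Section borel_column_vectors.
Context {R : realType} {d : nat}.
Implicit Types (a b x : 'cV[R]_d).

Lemma open_measurable_cV (U : set 'cV[R]_d) : open U ->
  measurable (U : set (borel_cV R d)).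
Proof. by move=> oU; exact: sub_sigma_algebra. Qed.

Lemma closed_measurable_cV (K : set 'cV[R]_d) : closed K ->
  measurable (K : set (borel_cV R d)).
Proof.
move=> cK; rewrite -[X in measurable X]setCK; apply: measurableC.
by apply: open_measurable_cV; exact: closed_openC.
Qed.

Lemma continuous_measurable_cV (f : 'cV[R]_d -> R) : continuous f ->
  measurable_fun [set: borel_cV R d] (f : borel_cV R d -> R).
Proof.
move=> /continuousP cf; apply: (measurability _ (RGenOpens.measurableE R)).
move=> _ [_ [a [b ->] <-]]; rewrite setTI; apply: open_measurable_cV.
by apply: cf; exact: interval_open.
Qed.

Lemma measurable_coord (i : 'I_d) :
  measurable_fun [set: borel_cV R d] (fun x : borel_cV R d => (x : 'cV[R]_d) i 0).
Proof. by apply: continuous_measurable_cV; exact: coord_continuous. Qed.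

Definition open_box a b : set 'cV[R]_d :=
  [set x | forall i, a i 0 < x i 0 < b i 0].

Definition boxes : set (set 'cV[R]_d) :=
  [set A | exists a b, A = open_box a b].

Lemma measurable_open_box a b : measurable (open_box a b : set (borel_cV R d)).
Proof.
have -> : open_box a b = \bigcap_(i in [set: 'I_d])
    ((fun x : borel_cV R d => (x : 'cV[R]_d) i 0) @^-1` `]a i 0, b i 0[).
  apply/seteqP; split => x h i; first by move=> _; rewrite /= in_itv/=; exact: h.
  by have := h i I; rewrite /= in_itv.
apply: fin_bigcap_measurable => // i _.
by rewrite -[X in measurable X]setTI; exact: measurable_coord.
Qed.

Lemma setI_closed_boxes : setI_closed boxes.
Proof.
move=> _ _ [a [b ->]] [a' [b' ->]].
exists (\col_i Num.max (a i 0) (a' i 0)), (\col_i Num.min (b i 0) (b' i 0)).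
apply/seteqP; split => x.
  by move=> [h h'] i; rewrite !mxE gt_max lt_min; case/andP: (h i) => -> ->;
    case/andP: (h' i) => -> ->.
by move=> h; split => i; have := h i; rewrite !mxE gt_max lt_min => /andP[/andP[? ?] /andP[? ?]];
  apply/andP.
Qed.

(** Boxes with rational centres and radii 1/n form a countable base. *)
Lemma borel_cV_boxes : @measurable _ (borel_cV R d) = <<s boxes >>.
Proof.
apply/seteqP; split; last first.
  apply: smallest_sub; first exact: sigma_algebra_measurable.
  by move=> _ [a [b ->]]; exact: measurable_open_box.
apply: smallest_sub; first exact: smallest_sigma_algebra.
move=> U /= oU.
pose T := ('cV[rat]_d * nat)%type.
pose c (q : T) : 'cV[R]_d := \col_i ratr (q.1 i 0).
pose r (q : T) : R := q.2.+1%:R^-1.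
pose bx (q : T) := open_box (c q - const_mx (r q)) (c q + const_mx (r q)).
have -> : U = \bigcup_(q in [set: T]) (if `[< bx q `<=` U >] then bx q else set0).
  apply/seteqP; split => x; last first.
    by move=> [q _]; case: ifPn => [/asboolP|//]; exact.
  move=> Ux; have [e /= e0 eU] : exists2 e : R, 0 < e & ball x e `<=` U.
    by have /nbhs_ballP : nbhs x U by rewrite nbhsE; exists U.
  have [n ne] : exists n : nat, n.+1%:R^-1 < e / 2.
    exists (Num.truncn (e / 2)^-1); rewrite invf_plt ?posrE ?divr_gt0//.
    exact: truncnS_gt.
  have n0 : 0 < n.+1%:R^-1 :> R by rewrite invr_gt0.
  have hq (i : 'I_d) : exists q : rat, x i 0 - n.+1%:R^-1 < ratr q < x i 0 + n.+1%:R^-1.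
    have [|q] := @rat_in_itvoo R (x i 0 - n.+1%:R^-1) (x i 0 + n.+1%:R^-1).
      by rewrite ltrD2l gtrN.
    by rewrite in_itv/= => h; exists q.
  have [q hq'] := choice hq.
  exists ((\col_i q i, n) : T) => //.
  have bxU : bx (\col_i q i, n) `<=` U.
    move=> y hy; apply: eU; split => // i j.
    rewrite ord1; have := hy i; have := hq' i; move: ne; rewrite !mxE/= /ball/= /r/=.
    move: (x i 0) (y i 0) (ratr (q i)) (n.+1%:R^-1); clear -e => u v w t te.
    by move=> /andP[? ?] /andP[? ?]; apply/ltr_normlP; split; lra.
  case: ifPn => [_ i|/asboolP//]; rewrite !mxE /r/=.
  have := hq' i; move: (x i 0) (ratr (q i)) (n.+1%:R^-1); clear => u v w.
  by move=> /andP[? ?]; apply/andP; split; lra.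
apply: (@countable_bigcupT_measurable _ (g_sigma_algebraType boxes)).
  exact: countableP.
move=> q; case: ifPn => _; last exact: measurable0.
by apply: sub_sigma_algebra; exists (c q - const_mx (r q)), (c q + const_mx (r q)).
Qed.

Lemma measurable_fun_cV (dT : measure_display) (T : measurableType dT)
    (f : T -> borel_cV R d) :
  (forall i, measurable_fun [set: T] (fun t => (f t : 'cV[R]_d) i 0)) ->
  measurable_fun [set: T] f.
Proof.
move=> mf; apply: (measurability _ borel_cV_boxes) => _ [_ [a [b ->]] <-].
rewrite setTI.
have -> : f @^-1` open_box a b = \bigcap_(i in [set: 'I_d])
    ((fun t => (f t : 'cV[R]_d) i 0) @^-1` `]a i 0, b i 0[).
  apply/seteqP; split => x h i; first by move=> _; rewrite /= in_itv/=; exact: h.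
  by have := h i I; rewrite /= in_itv.
apply: fin_bigcap_measurable => // i _.
by rewrite -[X in measurable X]setTI; exact: mf.
Qed.

End borel_column_vectors.

Lemma eq_prob_boxes (R : realType) (d : nat) (P Q : probability (borel_cV R d) R) :
  (forall a b, P (open_box a b) = Q (open_box a b)) ->
  forall A, measurable A -> P A = Q A.
Proof.
move=> PQ A mA.
pose g (n : nat) : set (borel_cV R d) :=
  @open_box R d (const_mx (- n%:R)) (const_mx n%:R).
apply: (@measure_unique _ R (borel_cV R d) boxes g) => //.
- exact: borel_cV_boxes.
- exact: setI_closed_boxes.
- by move=> n; eexists; eexists.
- apply/seteqP; split => // x _.
  exists (Num.truncn (\sum_i `|(x : 'cV[R]_d) i 0|)).+1 => // i; rewrite !mxE -ltr_norml.
  apply: le_lt_trans (truncnS_gt _).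
  by rewrite (bigD1 i)//= lerDl sumr_ge0.
- by move=> _ [a [b ->]]; exact: PQ.
- by move=> n; apply: le_lt_trans (probability_le1 _ _) (ltry _);
    exact: measurable_open_box.
Qed.

(** * Integrals of bounded functions *)

Section bounded_integrals.
Context {dT : measure_display} {T : measurableType dT} {R : realType}.
Implicit Types (P Q : probability T R) (f g : T -> R).

Definition bdd f := measurable_fun [set: T] f /\ exists C, forall x, `|f x| <= C.

Lemma bdd_cst (c : R) : bdd (fun=> c).
Proof. by split => //; exists `|c|. Qed.

Lemma bddD f g : bdd f -> bdd g -> bdd (fun x => f x + g x).
Proof.
move=> [mf [C fC]] [mg [D gD]]; split; first exact: measurable_funD.
by exists (C + D) => x; apply: le_trans (ler_normD _ _) _; exact: lerD.
Qed.

Lemma bddM f g : bdd f -> bdd g -> bdd (fun x => f x * g x).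
Proof.
move=> [mf [C fC]] [mg [D gD]]; split; first exact: measurable_funM.
by exists (C * D) => x; rewrite normrM ler_pM.
Qed.

Lemma integrable_bdd P f : bdd f -> P.-integrable [set: T] (fun x => (f x)%:E).
Proof.
move=> [mf [C fC]].
have C0 : P.-integrable [set: T] (fun=> C%:E).
  by apply: (finite_measure_integrable_cst P C).
apply: le_integrable C0 => //; first exact/measurable_EFinP.
by move=> x _ /=; rewrite lee_fin (le_trans (fC x))// ler_norm.
Qed.

Lemma bdd_integralD P f g : bdd f -> bdd g ->
  \int[P]_x (f x + g x) = \int[P]_x f x + \int[P]_x g x.
Proof. by move=> bf bg; apply: RintegralD => //; exact: integrable_bdd. Qed.

Lemma bdd_integralZ P (c : R) f : bdd f -> \int[P]_x (c * f x) = c * \int[P]_x f x.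
Proof. by move=> bf; apply: RintegralZl => //; exact: integrable_bdd. Qed.

Lemma EFin_integral_bdd P f : bdd f ->
  (\int[P]_x f x)%:E = (\int[P]_x (f x)%:E)%E.
Proof.
move=> bf; rewrite /Rintegral fineK//; apply: integrable_fin_num => //.
exact: integrable_bdd.
Qed.

Lemma le_integral_bdd P f g : bdd f -> bdd g -> (forall x, f x <= g x) ->
  \int[P]_x f x <= \int[P]_x g x.
Proof. by move=> bf bg fg; apply: le_Rintegral => //; exact: integrable_bdd. Qed.

Lemma bdd_lim (f_ : nat -> T -> R) f (C : R) :
  (forall n, measurable_fun [set: T] (f_ n)) -> (forall n x, `|f_ n x| <= C) ->
  (forall x, f_ n x @[n --> \oo] --> f x) -> bdd f.
Proof.
move=> mf fC ff; split; first exact: (measurable_fun_cvg (fun n => mf n)).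
exists C => x; have cn : `|f_ n x| @[n --> \oo] --> `|f x| by exact: (cvg_norm (ff x)).
rewrite -(cvg_lim _ cn)//; apply: limr_le; first by apply/cvg_ex; exists `|f x|.
exact: nearW.
Qed.

Lemma bdd_cvg_integral P (f_ : nat -> T -> R) f (C : R) :
  (forall n, measurable_fun [set: T] (f_ n)) -> (forall n x, `|f_ n x| <= C) ->
  (forall x, f_ n x @[n --> \oo] --> f x) ->
  \int[P]_x f_ n x @[n --> \oo] --> \int[P]_x f x.
Proof.
move=> mf fC ff; have bf := bdd_lim mf fC ff.
have -> : (fun n => \int[P]_x f_ n x) = fine \o (fun n => \int[P]_x (f_ n x)%:E)%E by [].
apply: fine_cvg; rewrite (EFin_integral_bdd P bf).
have [|||||_ _] := @dominated_convergence _ _ _ P setT measurableT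
  (fun n x => (f_ n x)%:E) (fun x => (f x)%:E) (fun=> C%:E).
- by move=> n; apply/measurable_EFinP.
- by apply/measurable_EFinP; case: bf.
- by apply: aeW => x _; by apply: cvg_EFin; [exact: nearW|exact: ff].
- exact: (finite_measure_integrable_cst P C).
- by apply: aeW => x n _; rewrite lee_fin.
- exact.
Qed.

End bounded_integrals.

(** * Functions preserving equality of integrals *)

Section multipliers.
Context {dT : measure_display} {T : measurableType dT} {R : realType}.
Variables (P Q : probability T R) (G : set (T -> R)).
Hypothesis bG : forall t, G t -> bdd t.

(** Equality of the integrals of g t for every t in G only describes a linear
    space of functions g. Its multipliers form an algebra closed under bounded
    pointwise limits, on which a functional calculus can be run. *)
Definition agree (g : T -> R) := bdd g /\
  forall t, G t -> \int[P]_x (g x * t x) = \int[Q]_x (g x * t x).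

Definition multiplier (f : T -> R) := bdd f /\
  forall g, agree g -> agree (fun x => f x * g x).

Lemma agreeD f g : agree f -> agree g -> agree (fun x => f x + g x).
Proof.
move=> [bf hf] [bg hg]; split; first exact: bddD.
move=> t Gt; have bt := bG Gt; under eq_Rintegral do rewrite mulrDl.
under [RHS]eq_Rintegral do rewrite mulrDl.
by rewrite !bdd_integralD ?hf ?hg//; exact: bddM.
Qed.

Lemma agreeZ (c : R) f : agree f -> agree (fun x => c * f x).
Proof.
move=> [bf hf]; split; first by apply: bddM => //; exact: bdd_cst.
move=> t Gt; have bt := bG Gt; under eq_Rintegral do rewrite -mulrA.
under [RHS]eq_Rintegral do rewrite -mulrA.
by rewrite !bdd_integralZ ?hf//; exact: bddM.
Qed.

Lemma agree_lim (f_ : nat -> T -> R) (f : T -> R) (C : R) :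
  (forall n, agree (f_ n)) -> (forall n x, `|f_ n x| <= C) ->
  (forall x, f_ n x @[n --> \oo] --> f x) -> agree f.
Proof.
move=> hf fC ff; have mf n : measurable_fun [set: T] (f_ n) by case: (hf n) => [[]].
split; first exact: (bdd_lim mf fC ff).
move=> t Gt; have [mt [D tD]] := bG Gt.
have lim (Z : probability T R) :
    \int[Z]_x (f_ n x * t x) @[n --> \oo] --> \int[Z]_x (f x * t x).
  apply: (@bdd_cvg_integral _ _ _ Z _ _ (C * D)).
  - by move=> n; exact: measurable_funM.
  - by move=> n x; rewrite normrM ler_pM.
  - by move=> x; apply: cvgMl; exact: ff.
have limQ := lim Q; apply: (cvg_unique _ (lim P)) => //.
have E : (fun n => \int[P]_x (f_ n x * t x)) = (fun n => \int[Q]_x (f_ n x * t x)).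
  by apply/funext => n; exact: (hf n).2.
by rewrite /= E.
Qed.

Lemma multiplier_cst (c : R) : multiplier (fun=> c).
Proof. by split; [exact: bdd_cst|move=> g; exact: agreeZ]. Qed.

Lemma multiplierD f g : multiplier f -> multiplier g ->
  multiplier (fun x => f x + g x).
Proof.
move=> [bf hf] [bg hg]; split; first exact: bddD.
move=> h ah; under eq_fun do rewrite mulrDl.
by apply: agreeD; [exact: hf|exact: hg].
Qed.

Lemma multiplierM f g : multiplier f -> multiplier g ->
  multiplier (fun x => f x * g x).
Proof.
move=> [bf hf] [bg hg]; split; first exact: bddM.
by move=> h ah; under eq_fun do rewrite -mulrA; apply: hf; exact: hg.
Qed.

Lemma multiplierX f n : multiplier f -> multiplier (fun x => f x ^+ n).
Proof.
move=> mf; elim: n => [|n IH]; first exact: multiplier_cst.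
by under eq_fun do rewrite exprS; exact: multiplierM.
Qed.

Lemma multiplier_prod (I : Type) (s : seq I) (f : I -> T -> R) :
  (forall i, multiplier (f i)) -> multiplier (fun x => \prod_(i <- s) f i x).
Proof.
move=> mf; elim: s => [|i s IH].
  by under eq_fun do rewrite big_nil; exact: multiplier_cst.
by under eq_fun do rewrite big_cons; exact: multiplierM.
Qed.

Lemma multiplier_lim (f_ : nat -> T -> R) (f : T -> R) (C : R) :
  (forall n, multiplier (f_ n)) -> (forall n x, `|f_ n x| <= C) ->
  (forall x, f_ n x @[n --> \oo] --> f x) -> multiplier f.
Proof.
move=> hf fC ff; have mf n : measurable_fun [set: T] (f_ n) by case: (hf n) => [[]].
split; first exact: (bdd_lim mf fC ff).
move=> g ag; have [[mg [D gD]] _] := ag.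
apply: (@agree_lim (fun n x => f_ n x * g x) _ (C * D)).
- by move=> n; exact: (hf n).2.
- by move=> n x; rewrite normrM ler_pM.
- by move=> x; apply: cvgMl; exact: ff.
Qed.

(** Bounded partial sums of the exponential series. *)
Lemma multiplier_expR f : multiplier f -> multiplier (fun x => expR (f x)).
Proof.
move=> mf; have [[_ [C fC]] _] := mf.
apply: (@multiplier_lim (fun n x => series (exp_coeff (f x)) n) _ (expR C)).
- elim=> [|n IH].
    by rewrite /series/=; under eq_fun do rewrite big_geq//; exact: multiplier_cst.
  have -> : (fun x => series (exp_coeff (f x)) n.+1) =
      (fun x => series (exp_coeff (f x)) n + n`!%:R^-1 * f x ^+ n).
    by apply/funext => x; rewrite seriesSr /exp_coeff/= [_ / _]mulrC.
  apply: multiplierD => //; apply: multiplierM; first exact: multiplier_cst.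
  exact: multiplierX.
- move=> n x; apply: (@le_trans _ _ (series (exp_coeff `|f x|) n)).
    rewrite /series/=; apply: le_trans (ler_norm_sum _ _ _) _.
    by apply: ler_sum => i _; rewrite /exp_coeff/= normrM normrX normfV normr_nat.
  apply: (@le_trans _ _ (expR `|f x|)); last by rewrite ler_expR.
  rewrite /expR; apply: nondecreasing_cvgn_le; last exact: is_cvg_series_exp_coeff.
  apply/nondecreasing_seqP => k; rewrite seriesSr lerDl /exp_coeff/=.
  by rewrite divr_ge0// exprn_ge0.
- by move=> x; exact: is_cvg_series_exp_coeff.
Qed.

Lemma multiplier_integral f : agree (fun=> 1) -> G (fun=> 1) -> multiplier f ->
  \int[P]_x f x = \int[Q]_x f x.
Proof.
move=> a1 G1 [_ mf]; have [_ /(_ _ G1)] := mf _ a1.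
under eq_Rintegral do rewrite !mulr1.
by under [RHS]eq_Rintegral do rewrite !mulr1.
Qed.

End multipliers.

Section positivity_sets.
Context {dT : measure_display} {T : measurableType dT} {R : realType}.
Variables (P Q : probability T R) (G : set (T -> R)).
Hypothesis bG : forall t, G t -> bdd t.

(** An approximation of the indicator of y > 0 by entire functions of y, exact in
    the limit up to the value at 0. *)
Lemma cvg_expR_expR (y : R) : expR (- expR (- y) ^+ n) @[n --> \oo] -->
  (if 0 < y then 1 else if y == 0 then expR (-1) else 0).
Proof.
have expr0 (z : R) : 0 < z -> expR (- z) ^+ n @[n --> \oo] --> (0 : R).
  move=> z0; apply: cvg_expr; rewrite ger0_norm ?expR_ge0//.
  by rewrite expR_lt1 oppr_lt0.
have [y0|y0|<-] := ltgtP 0 y; last first.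
- rewrite oppr0 expR0; under eq_fun do rewrite expr1n; exact: cvg_cst.
- apply: (@squeeze_cvgr _ _ _ _ (fun=> 0) (fun n => expR (- - y) ^+ n)).
  + apply: nearW => n; rewrite expR_ge0/= -!expRM_natl ler_expR.
    rewrite opprK lerNl -mulrN; apply: le_trans (expR_ge1Dx _).
    by rewrite lerDr.
  + exact: cvg_cst.
  + by apply: expr0; rewrite oppr_gt0.
- rewrite -[X in _ --> X]expR0 -oppr0; apply: continuous_cvg.
    exact: continuous_expR.
  by apply: cvgN; exact: expr0.
Qed.

(** The limit in cvg_expR_expR takes values in {0, expR (-1), 1}, and powers
    remove the middle one. *)
Lemma multiplier_pos f : multiplier P Q G f ->
  multiplier P Q G (fun x => ((0 < f x)%R)%:R).
Proof.
move=> mf.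
pose v (y : R) : R := if 0 < y then 1 else if y == 0 then expR (-1) else 0.
have v01 y : 0 <= v y <= 1.
  have e1 : expR (-1) <= 1 :> R by rewrite -[leRHS]expR0 ler_expR lerN10.
  by rewrite /v; case: ifP => _; last case: ifP => _; rewrite ?lexx ?ler01 ?expR_ge0.
have mv : multiplier P Q G (fun x => v (f x)).
  apply: (multiplier_lim bG (f_ := fun n x => expR (- expR (- f x) ^+ n)) (C := 1)).
  - move=> n; apply: multiplier_expR => //; under eq_fun do rewrite -mulN1r.
    apply: multiplierM => //; first exact: multiplier_cst.
    apply: multiplierX => //; apply: multiplier_expR => //.
    under eq_fun do rewrite -mulN1r.
    by apply: multiplierM => //; exact: multiplier_cst.
  - by move=> n x; rewrite ger0_norm ?expR_ge0// -expR0 ler_expR oppr_le0.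
  - by move=> x; exact: cvg_expR_expR.
apply: (multiplier_lim bG (f_ := fun n x => v (f x) ^+ n.+1) (C := 1)).
- by move=> n; exact: multiplierX.
- move=> n x; have /andP[? ?] := v01 (f x).
  by rewrite normrX exprn_ile1// ger0_norm.
- move=> x; rewrite /v; case: ltP => h /=.
    by under eq_fun do rewrite expr1n; exact: cvg_cst.
  have lt1 : `|if f x == 0 then expR (-1) else (0:R)| < 1.
    by case: ifP => _; rewrite ?normr0// ger0_norm ?expR_ge0// expR_lt1 oppr_lt0.
  rewrite (cvg_shiftS (fun n => (if f x == 0 then expR (-1) else 0) ^+ n)).
  exact: cvg_expr.
Qed.

End positivity_sets.

(** * Trigonometric integrals determine a law *)

Definition dotv (R : realType) (d : nat) (u x : 'cV[R]_d) : R := (u^T *m x) 0 0.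

Section characteristic_functions.
Context {R : realType} {d : nat}.
Implicit Types (u v : 'cV[R]_d).

Lemma dotvE u (x : 'cV[R]_d) : dotv u x = \sum_i u i 0 * x i 0.
Proof. by rewrite /dotv mxE; apply: eq_bigr => i _; rewrite mxE. Qed.

Lemma dotvDl u v (x : 'cV[R]_d) : dotv (u + v) x = dotv u x + dotv v x.
Proof. by rewrite /dotv linearD mulmxDl mxE. Qed.

Lemma dotvBl u v (x : 'cV[R]_d) : dotv (u - v) x = dotv u x - dotv v x.
Proof. by rewrite /dotv linearB mulmxBl !mxE. Qed.

Lemma dotvDr u (x y : 'cV[R]_d) : dotv u (x + y) = dotv u x + dotv u y.
Proof. by rewrite /dotv mulmxDr mxE. Qed.

Lemma dotvZr u (c : R) (x : 'cV[R]_d) : dotv u (c *: x) = c * dotv u x.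
Proof. by rewrite /dotv -scalemxAr mxE. Qed.

Lemma dot0v (x : 'cV[R]_d) : dotv 0 x = 0.
Proof. by rewrite /dotv trmx0 mul0mx mxE. Qed.

Lemma dotv0 u : dotv u 0 = 0.
Proof. by rewrite /dotv mulmx0 mxE. Qed.

Lemma dotv_delta (i : 'I_d) (c : R) (x : 'cV[R]_d) : dotv (c *: delta_mx i 0) x = c * x i 0.
Proof.
rewrite dotvE (bigD1 i)//= big1 => [|j ji]; rewrite !mxE ?eqxx ?(negbTE ji) ?andbF ?mulr0 ?mul0r//.
by rewrite mulr1 addr0.
Qed.

Lemma measurable_dotv u :
  measurable_fun [set: borel_cV R d] (fun x : borel_cV R d => dotv u x).
Proof.
under eq_fun do rewrite dotvE.
apply: measurable_sum => i; apply: measurable_funM => //.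
exact: measurable_coord.
Qed.

Definition trig : set (borel_cV R d -> R) :=
  [set t | exists u (c : R), t = fun x => cos (dotv u x + c)].

Lemma bdd_cos (dT : measure_display) (T : measurableType dT) (f : T -> R) :
  measurable_fun [set: T] f -> bdd (fun x => cos (f x)).
Proof.
move=> mf; split; last first.
  by exists 1 => x; rewrite ler_norml cos_le1 cos_geN1.
apply: measurableT_comp mf; apply: continuous_measurable_fun.
exact: continuous_cos.
Qed.

Lemma bdd_trig t : trig t -> bdd t.
Proof.
move=> [u [c ->]]; apply: bdd_cos.
by apply: measurable_funD => //; exact: measurable_dotv.
Qed.

Lemma cvg_msin (t : R) : n.+1%:R * sin (t / n.+1%:R) @[n --> \oo] --> t.
Proof.
have lcos (x y : R) : `|cos x - cos y| <= 1 * `|x - y|.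
  apply: (@bounded_deriv_lipschitz _ cos (fun x => - sin x)) => // z.
  by rewrite normrN sin_max.
have lsin (s : R) : `|sin s - s| <= s ^+ 2.
  have := lipschitz_sqr_remainder (@is_derive_sin R) lcos 0 s.
  by rewrite add0r sin0 cos0 subr0 mulr1 mul1r.
apply/cvgrPdist_le => /= e e0; near=> n.
have n0 : 0 < n.+1%:R :> R by [].
have -> : t - n.+1%:R * sin (t / n.+1%:R) =
    - (n.+1%:R * (sin (t / n.+1%:R) - t / n.+1%:R)).
  by rewrite mulrBr [_ * (t / _)]mulrCA divff ?gt_eqF// mulr1 opprB.
rewrite normrN normrM gtr0_norm//.
apply: (@le_trans _ _ (n.+1%:R * (t / n.+1%:R) ^+ 2)); first by rewrite ler_pM2l.
have -> : n.+1%:R * (t / n.+1%:R) ^+ 2 = t ^+ 2 / n.+1%:R :> R.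
  by rewrite expr_div_n expr2; field; rewrite gt_eqF.
rewrite ler_pdivrMr// mulrC -ler_pdivrMr//.
near: n; exists (Num.truncn (t ^+ 2 / e)) => // n /= hn.
by apply: ltW; apply: lt_le_trans (truncnS_gt _) _; rewrite ler_nat.
Unshelve. all: by end_near. Qed.

Variables P Q : probability (borel_cV R d) R.
Hypothesis PQ : forall u (c : R),
  \int[P]_x cos (dotv u x + c) = \int[Q]_x cos (dotv u x + c).

Let mult := multiplier P Q trig.

Lemma trig1 : trig (fun=> 1).
Proof. by exists 0, 0; apply/funext => x; rewrite dot0v addr0 cos0. Qed.

Lemma agree1 : agree P Q trig (fun=> 1).
Proof.
split; first exact: bdd_cst.
move=> _ [u [c ->]]; under eq_Rintegral do rewrite mul1r.
by under [RHS]eq_Rintegral do rewrite mul1r.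
Qed.

(** The product of two cosines is a sum of two cosines. *)
Lemma multiplier_cos u c : mult (fun x => cos (dotv u x + c)).
Proof.
split; first by apply: bdd_trig; exists u, c.
move=> g [bg ag]; split.
  by apply: bddM => //; apply: bdd_trig; exists u, c.
move=> _ [v [e ->]].
have E (Z : probability (borel_cV R d) R) :
    \int[Z]_x (cos (dotv u x + c) * g x * cos (dotv v x + e)) =
    2^-1 * (\int[Z]_x (g x * cos (dotv (u + v) x + (c + e))) +
            \int[Z]_x (g x * cos (dotv (u - v) x + (c - e)))).
  have b1 w k : bdd (fun x : borel_cV R d => g x * cos (dotv w x + k)).
    by apply: bddM => //; apply: bdd_trig; exists w, k.
  rewrite -bdd_integralD// -bdd_integralZ; last exact: bddD.
  apply: eq_Rintegral => x _; rewrite dotvDl dotvBl.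
  have -> : dotv u x + dotv v x + (c + e) = (dotv u x + c) + (dotv v x + e) by ring.
  have -> : dotv u x - dotv v x + (c - e) = (dotv u x + c) - (dotv v x + e) by ring.
  move: (dotv u x + c) (dotv v x + e) => p q; by rewrite cosD cosB; field.
by rewrite !E !ag//; [exists (u - v), (c - e)|exists (u + v), (c + e)].
Qed.

(** The square of n sin ((x_i - c) / n) is a trigonometric polynomial that tends
    to (x_i - c)^2; the exponential makes the convergence bounded. *)
Lemma multiplier_gauss (i : 'I_d) (c : R) :
  mult (fun x => expR (- (((x : 'cV[R]_d) i 0 - c) ^+ 2))).
Proof.
apply: (multiplier_lim bdd_trig
  (f_ := fun n x => expR (- (n.+1%:R * sin (((x : 'cV[R]_d) i 0 - c) / n.+1%:R)) ^+ 2))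
  (C := 1)).
- move=> n; apply: (multiplier_expR bdd_trig).
  have -> : (fun x : borel_cV R d => - (n.+1%:R * sin (((x : 'cV[R]_d) i 0 - c) / n.+1%:R)) ^+ 2)
    = (fun x => - n.+1%:R ^+ 2 + n.+1%:R ^+ 2 *
        cos (dotv (n.+1%:R^-1 *: delta_mx i 0) x + (- c / n.+1%:R)) ^+ 2).
    apply/funext => x; rewrite dotv_delta.
    have -> : n.+1%:R^-1 * (x : 'cV[R]_d) i 0 + - c / n.+1%:R =
      ((x : 'cV[R]_d) i 0 - c) / n.+1%:R by ring.
    by rewrite exprMn sin2cos2; ring.
  apply: (multiplierD bdd_trig); first exact: (multiplier_cst _ _ bdd_trig).
  apply: multiplierM; first exact: (multiplier_cst _ _ bdd_trig).
  by apply: multiplierX; [exact: bdd_trig|exact: multiplier_cos].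
- by move=> n x; rewrite ger0_norm ?expR_ge0// -expR0 ler_expR oppr_le0 sqr_ge0.
- move=> x; apply: continuous_cvg; first exact: continuous_expR.
  by apply: cvgN; apply: cvgM; exact: cvg_msin.
Qed.

(** The indicator of a box is a product over the coordinates, each factor being
    the indicator that a Gaussian bump centred in the edge exceeds its value at
    the endpoints. *)
Theorem eq_prob_cos A : measurable A -> P A = Q A.
Proof.
apply: eq_prob_boxes => {A} a b.
have [ab|] := boolP [forall i, a i 0 < b i 0]; last first.
  move=> /forallPn[i]; rewrite -leNgt => ba.
  have -> : open_box a b = set0.
    apply/seteqP; split => // x /(_ i) /andP[ax xb].
    by have := lt_trans ax xb; rewrite ltNge ba.
  by rewrite !measure0.
pose f i (x : borel_cV R d) : R := expR (- ((x : 'cV[R]_d) i 0 - (a i 0 + b i 0) / 2) ^+ 2)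
  + - expR (- ((b i 0 - a i 0) / 2) ^+ 2).
have mf : mult (fun x => \prod_(i <- index_enum 'I_d) ((0 < f i x)%R)%:R).
  apply: (multiplier_prod bdd_trig) => i; apply: (multiplier_pos bdd_trig).
  apply: (multiplierD bdd_trig); first exact: multiplier_gauss.
  exact: (multiplier_cst _ _ bdd_trig).
have fE : (fun x => \prod_(i <- index_enum 'I_d) ((0 < f i x)%R)%:R) =
    \1_(open_box a b) :> (borel_cV R d -> R).
  apply/funext => x.
  have fi i : (0 < f i x) = (a i 0 < (x : 'cV[R]_d) i 0 < b i 0).
    have abi : a i 0 < b i 0 by move/forallP: ab.
    rewrite /f subr_gt0 ltr_expR ltrN2 -subr_gt0 subr_sqr.
    move: abi ((x : 'cV[R]_d) i 0); move: (a i 0) (b i 0) => p q pq z.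
    have -> : (q - p) / 2 - (z - (p + q) / 2) = q - z by field.
    have -> : (q - p) / 2 + (z - (p + q) / 2) = z - p by field.
    apply/idP/andP => [h|[pz zq]]; last by rewrite mulr_gt0 ?subr_gt0.
    by split; rewrite ltNge; apply/negP => h'; nra.
  rewrite indicE; case: (boolP (x \in _)); rewrite ?inE ?notin_setE => hx.
    by rewrite big1// => i _; rewrite fi hx.
  have [i hi] : exists i, ~~ (0 < f i x).
    apply/existsP; rewrite -negb_forall; apply/negP => /forallP h; apply: hx => i.
    by rewrite -fi.
  by rewrite (bigD1 i)//= (negbTE hi) mul0r.
have := multiplier_integral agree1 trig1 mf.
rewrite fE /Rintegral; have mb := measurable_open_box a b.
rewrite !integral_indic// !setIT => h.
by rewrite -[LHS]fineK ?fin_num_measure// h fineK// fin_num_measure.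
Qed.

End characteristic_functions.

(** * Images and products of probabilities *)

Lemma bdd_comp (d1 d2 : measure_display) (T1 : measurableType d1)
    (T2 : measurableType d2) (R : realType) (X : T1 -> T2) (f : T2 -> R) :
  measurable_fun [set: T1] X -> bdd f -> bdd (fun x => f (X x)).
Proof.
move=> mX [mf [C fC]]; split; last by exists C.
exact: measurableT_comp.
Qed.

Lemma bdd_integral_dirac (dT : measure_display) (T : measurableType dT)
    (R : realType) (a : T) (f : T -> R) : bdd f -> \int[\d_a]_x f x = f a.
Proof.
move=> [mf _]; rewrite /Rintegral integral_dirac//; first by rewrite diracT mul1e.
exact/measurable_EFinP.
Qed.

Section transfer.
Context {d1 : measure_display} {T1 : measurableType d1}.
Context {d2 : measure_display} {T2 : measurableType d2} {R : realType}.

Lemma bdd_integral_distribution (P : probability T1 R) (X : {mfun T1 >-> T2})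
    (f : T2 -> R) : bdd f ->
  \int[distribution P X]_y f y = \int[P]_x f (X x).
Proof.
move=> bf; rewrite /Rintegral integral_distribution//.
  by apply/measurable_EFinP; case: bf.
by apply: (integrable_bdd P (bdd_comp _ bf)); exact: measurable_funPT.
Qed.

Lemma bdd_fubini (P1 : probability T1 R) (P2 : probability T2 R)
    (f : T1 * T2 -> R) : bdd f ->
  \int[(P1 \x P2)%E]_z f z = \int[P1]_x \int[P2]_y f (x, y).
Proof.
move=> bf; have iz := integrable_bdd (P1 \x P2)%E bf.
rewrite /Rintegral -(integral12_prod_meas1 iz); congr fine.
apply: eq_integral => x _; rewrite /fubini_F/=.
have bfx : bdd (fun y => f (x, y)).
  by apply: (bdd_comp (X := fun y => (x, y))) => //; exact: pair1_measurable.
by rewrite -(EFin_integral_bdd P2 bfx).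
Qed.

End transfer.

(** * Sums of independent Gaussian multiples of vectors *)

Section gaussian_model.
Context {R : realType} {d : nat}.
Notation V := 'cV[R]_d.
Notation gauss := (normal_prob (0 : R) 1).

Lemma bdd_Phi_capped (N M : R) (h : V -> R) : capped_concave N M h ->
  bdd (fun x : borel_cV R d => Phi (h x)).
Proof.
move=> [_ Lh _]; split; last first.
  by exists 1 => x; rewrite ger0_norm ?ltW// ?Phi_gt0// Phi_lt1.
apply: continuous_measurable_cV => x.
apply: continuous_comp; last exact: continuous_Phi.
exact: lipschitz_continuous Lh x.
Qed.

Definition shift_along (a : V) (p : borel_cV R d * measurableTypeR R) : borel_cV R d :=
  (p.1 : V) + p.2 *: a.

Lemma measurable_shift_along (a : V) :
  measurable_fun [set: borel_cV R d * measurableTypeR R] (shift_along a).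
Proof.
apply: measurable_fun_cV => i.
have -> : (fun t => (shift_along a t : V) i 0) = (fun t => (t.1 : V) i 0 + t.2 * a i 0).
  by apply/funext => t; rewrite /shift_along !mxE.
apply: measurable_funD.
  apply: (measurableT_comp (measurable_coord i)); exact: measurable_fst.
by apply: measurable_funM => //; exact: measurable_snd.
Qed.

HB.instance Definition _ (a : V) :=
  isMeasurableFun.Build _ _ _ _ (shift_along a) (measurable_shift_along a).

Lemma integral_shift_along (mu : probability (borel_cV R d) R) (a : V)
    (f : borel_cV R d -> R) : bdd f ->
  \int[distribution (mu \x gauss)%E (shift_along a)]_x f x =
  \int[mu]_z gE (fun y => f ((z : V) + y *: a)).
Proof.
move=> bf; rewrite bdd_integral_distribution// bdd_fubini//.
by apply: bdd_comp => //; exact: measurable_shift_along.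
Qed.

(** One direction at a time: the image of mu times a standard normal law under
    (z, y) |-> z + y a. The new direction acts first on h, which is why the list
    grows at its end. *)
Lemma gaussian_model (s : seq V) : exists mu : probability (borel_cV R d) R,
  (forall N M (h : V -> R), capped_concave N M h ->
     \int[mu]_x Phi (h x) = Phi (gavgs s h 0)) /\
  (forall u (c : R), \int[mu]_x cos (dotv u x + c) =
     cos c * expR (- (\sum_(a <- s) dotv u a ^+ 2 / 2))).
Proof.
elim/last_ind: s => [|s a [mu [muh muc]]].
  exists (@dirac _ (borel_cV R d) 0 R); split => [N M h ch|u c].
    by rewrite (@bdd_integral_dirac _ (borel_cV R d) R (0 : V) _ (bdd_Phi_capped ch)).
  rewrite (@bdd_integral_dirac _ (borel_cV R d) R (0 : V) (fun x => cos (dotv u x + c))).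
    by rewrite big_nil oppr0 expR0 mulr1 dotv0 add0r.
  by apply: bdd_trig; exists u, c.
exists (distribution (mu \x gauss)%E (shift_along a)); split => [N M h ch|u c].
  rewrite (integral_shift_along mu a (bdd_Phi_capped ch)) /gavgs foldr_rcons.
  rewrite -(muh _ _ _ (capped_concave_gavg a ch)); apply: eq_Rintegral => z _.
  by rewrite (Phi_gavg a z ch).
rewrite integral_shift_along; last by apply: bdd_trig; exists u, c.
have -> : (fun z : borel_cV R d => gE (fun y => cos (dotv u ((z : V) + y *: a) + c))) =
    (fun z => expR (- (dotv u a ^+ 2 / 2)) * cos (dotv u z + c)).
  apply/funext => z; rewrite mulrC -gE_cos; congr gE; apply/funext => y.
  by congr cos; rewrite dotvDr dotvZr; ring.
rewrite bdd_integralZ ?muc; last by apply: bdd_trig; exists u, c.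
by rewrite mulrCA -expRD big_rcons/= addrC -opprD.
Qed.

End gaussian_model.

(** * Moments of Gaussian vectors *)

Section gaussian_moments.
Context {dT : measure_display} {T : measurableType dT} {R : realType}.
Variables (P : probability T R) (Z : T -> R) (m s : R).
Hypotheses (mZ : measurable_fun [set: T] (Z : T -> measurableTypeR R)) (s0 : 0 <= s).
Hypothesis lawZ : forall A : set (measurableTypeR R), measurable A ->
  P [set w | A (Z w)] = gaussian_law m s A.
Notation gauss := (normal_prob (0 : R) 1).

(** Both cases of gaussian_law are the image of the standard normal law under
    y |-> m + s y. *)
Lemma ge0_integral_gaussian (f : R -> R) : continuous f -> (forall x, 0 <= f x) ->
  (\int[P]_w (f (Z w))%:E = \int[gauss]_y (f (m + s * y))%:E)%E.
Proof.
move=> cf f0; have mf : measurable_fun [set: R] f by exact: continuous_measurable_fun.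
have mfE : measurable_fun [set: measurableTypeR R] (fun x => (f x)%:E).
  exact/measurable_EFinP.
pose X : {mfun T >-> measurableTypeR R} :=
  HB.pack_for {mfun T >-> measurableTypeR R} (Z : T -> measurableTypeR R)
    (isMeasurableFun.Build _ _ _ _ (Z : T -> measurableTypeR R) mZ).
rewrite -[LHS](@ge0_integral_distribution _ _ _ _ _ P X (fun x => (f x)%:E))//.
have [s_eq0|s_neq0] := eqVneq s 0.
  rewrite [LHS](eq_measure_integral (@dirac _ (measurableTypeR R) m R)).
    rewrite integral_dirac// diracT mul1e s_eq0.
    under eq_integral do rewrite mul0r addr0.
    by rewrite integral_cst//= [X in (_ * X)%E](@probability_setT _ _ _ gauss) mule1.
  by move=> A mA _; rewrite [LHS]lawZ// /gaussian_law s_eq0 eqxx.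
rewrite [LHS](eq_measure_integral (normal_prob m s)).
  by apply: ge0_integral_normal_affine => //; rewrite lt_neqAle eq_sym s_neq0.
by move=> A mA _; rewrite [LHS]lawZ// /gaussian_law (negbTE s_neq0).
Qed.

Lemma subquadratic_affine (f : R -> R) : continuous f -> subquadratic f ->
  subquadratic (fun y => f (m + s * y)).
Proof.
move=> cf [mf [C fC]]; split.
  by apply: continuous_measurable_fun; exact: continuous_affine_comp.
have C0 : 0 <= C.
  by have := le_trans (normr_ge0 _) (fC 0); rewrite expr0n/= addr0 mulr1.
exists (C * (1 + 2 * m ^+ 2 + 2 * s ^+ 2)) => y; apply: (le_trans (fC _)).
rewrite -mulrA; apply: ler_wpM2l => //.
have := sqr_ge0 (m - s * y); have := sqr_ge0 (m * y); have := sqr_ge0 y.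
move: (sqr_ge0 s); nra.
Qed.

(** A multiple of 1 + x^2 is added to make f nonnegative. *)
Lemma integral_gaussian (f : R -> R) : continuous f -> subquadratic f ->
  P.-integrable [set: T] (fun w => (f (Z w))%:E) /\
  \int[P]_w f (Z w) = gE (fun y => f (m + s * y)).
Proof.
move=> cf qf.
have int_ge0 (g : R -> R) : continuous g -> subquadratic g -> (forall x, 0 <= g x) ->
    P.-integrable [set: T] (fun w => (g (Z w))%:E) /\
    \int[P]_w g (Z w) = gE (fun y => g (m + s * y)).
  move=> cg qg g0; have E := ge0_integral_gaussian cg g0.
  split; last by rewrite /gE /Rintegral E.
  apply/integrableP; split.
    apply/measurable_EFinP; apply: measurableT_comp => //.
    exact: continuous_measurable_fun.
  under eq_integral do rewrite /= ger0_norm//.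
  by rewrite E -EFin_gE ?ltry//; exact: subquadratic_affine.
have [_ [C fC]] := qf.
pose q x : R := C * (1 + x ^+ 2).
have cq : continuous q.
  move=> x; apply: cvgMr; apply: cvgD; first exact: cvg_cst.
  exact: exprn_continuous.
have qq : subquadratic q.
  apply: subquadraticZ; apply: subquadraticD; first exact: subquadratic_cst.
  exact: subquadratic_sqr.
have q0 x : 0 <= q x by exact: le_trans (normr_ge0 _) (fC x).
have fq0 x : 0 <= f x + q x.
  by rewrite -lerBlDr sub0r; have := fC x; rewrite ler_norml => /andP[].
have cfq : continuous (fun x => f x + q x) by move=> x; apply: cvgD; [exact: cf|exact: cq].
have [i1 E1] := int_ge0 _ cfq (subquadraticD qf qq) fq0.
have [i2 E2] := int_ge0 _ cq qq q0.
have fE : (fun w => f (Z w)) = (fun w => (f (Z w) + q (Z w)) - q (Z w)).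
  by apply/funext => w; rewrite addrK.
split.
  have -> : (fun w => (f (Z w))%:E) = (fun w => ((f (Z w) + q (Z w))%:E - (q (Z w))%:E)%E).
    by apply/funext => w; rewrite -EFinB addrK.
  exact: integrableB.
rewrite fE RintegralB// E1 E2 gED; last 2 first.
- exact: subquadratic_affine.
- exact: subquadratic_affine.
by rewrite addrK.
Qed.

End gaussian_moments.

Section gaussian_vectors.
Context {dT : measure_display} {T : measurableType dT} {R : realType}.
Context {P : probability T R} {d : nat}.
Variables (X : {RV P >-> borel_cV R d}) (Sigma : 'M[R]_d).
Hypotheses (gX : gaussian_vector X) (mX : mean_zero X).
Hypothesis cX : has_covariance_matrix X Sigma.
Notation Z u := (fun w => dotv u (X w : 'cV[R]_d)).
Notation co i := (fun w => (X w : 'cV[R]_d) i 0).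
Notation intble f := (P.-integrable [set: T] (fun w => (f w)%:E)).

Lemma gaussian_dotv (u : 'cV[R]_d) : exists m s : R, forall f : R -> R,
  continuous f -> subquadratic f ->
  intble (fun w => f (Z u w)) /\
  \int[P]_w f (Z u w) = gE (fun y => f (m + s * y)).
Proof.
have [m [s [s0 law]]] := gX u; exists m, s => f cf qf.
apply: (@integral_gaussian _ _ _ P (Z u) m s) => //.
apply: (measurableT_comp (measurable_dotv u)); exact: measurable_funPT.
Qed.

Lemma Rintegral_lin (I : Type) (r : seq I) (c : I -> R) (f : I -> T -> R) :
  (forall i, intble (f i)) ->
  intble (fun w => \sum_(i <- r) c i * f i w) /\
  \int[P]_w (\sum_(i <- r) c i * f i w) = \sum_(i <- r) c i * \int[P]_w f i w.
Proof.
move=> fi; have cfi i : intble (fun w => c i * f i w).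
  by under eq_fun do rewrite EFinM; exact: integrableZl.
elim: r => [|i r [IH1 IH2]].
  under eq_fun do rewrite big_nil.
  split; first exact: integrable0.
  by under eq_Rintegral do rewrite big_nil; rewrite big_nil Rintegral_cst// mul0r.
split; first by under eq_fun do rewrite big_cons EFinD; exact: integrableD.
under eq_Rintegral do rewrite big_cons.
by rewrite (RintegralD measurableT (cfi i) IH1) IH2 big_cons (RintegralZl _ measurableT (fi i)).
Qed.

Lemma dotv_coord i w : Z (delta_mx i 0) w = co i w.
Proof. by rewrite -[delta_mx i 0]scale1r dotv_delta mul1r. Qed.

Lemma integrable_coord i : intble (co i) /\ intble (fun w => co i w ^+ 2).
Proof.
have [m [s ms]] := gaussian_dotv (delta_mx i 0).
have [i1 _] := ms id (fun x => cvg_id) subquadratic_id.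
have [i2 _] := ms (fun x => x ^+ 2) (@exprn_continuous _ 2) subquadratic_sqr.
by split; [move: i1|move: i2]; under eq_fun do rewrite /= dotv_coord.
Qed.

Lemma integrable_coordM i j : intble (fun w => co i w * co j w).
Proof.
have mco k : measurable_fun [set: T] (co k).
  apply: (measurableT_comp (measurable_coord k)); exact: measurable_funPT.
have [_ i2] := integrable_coord i; have [_ j2] := integrable_coord j.
have ij : intble (fun w => co i w ^+ 2 + co j w ^+ 2).
  by under eq_fun do rewrite EFinD; exact: integrableD.
apply: le_integrable ij => //.
  by apply/measurable_EFinP; exact: measurable_funM.
move=> w _; rewrite /= lee_fin [leRHS]ger0_norm ?addr_ge0 ?sqr_ge0//.
rewrite normrM -(real_normK (num_real (co i w))) -(real_normK (num_real (co j w))).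
move: (normr_ge0 (co i w)) (normr_ge0 (co j w)); move: `|_| `|_| => a b a0 b0.
have := sqr_ge0 (a - b); nra.
Qed.

Lemma integral_coord i : \int[P]_w co i w = 0.
Proof. by have := mX i; rewrite unlock /Rintegral => ->. Qed.

Lemma integral_coordM i j : \int[P]_w (co i w * co j w) = Sigma i j.
Proof.
have := cX i j; rewrite unlock !mX unlock => E.
rewrite -[RHS]/(fine (Sigma i j)%:E) -E /Rintegral.
congr fine; apply: eq_integral => w _; congr EFin.
by transitivity ((co i w - 0) * (co j w - 0)); first by rewrite !subr0.
Qed.

(** Products of coordinates are integrable because squares are, each coordinate
    being a linear functional of X. *)
Lemma gaussian_cov_form (u : 'cV[R]_d) :
  \int[P]_w (Z u w ^+ 2) = (u^T *m Sigma *m u) 0 0.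
Proof.
have E w : Z u w ^+ 2 =
    \sum_(p : 'I_d * 'I_d) u p.1 0 * u p.2 0 * (co p.1 w * co p.2 w).
  rewrite expr2 dotvE big_distrlr/= pair_bigA/=.
  by apply: eq_bigr => p _; ring.
under eq_Rintegral do rewrite E.
rewrite (Rintegral_lin _ _ (fun p : 'I_d * 'I_d => integrable_coordM p.1 p.2)).2.
rewrite -(pair_bigA _ (fun i j => u i 0 * u j 0 * \int[P]_w (co i w * co j w)))/=.
rewrite mxE exchange_big/=; apply: eq_bigr => j _; rewrite mxE big_distrl/=.
by apply: eq_bigr => i _; rewrite integral_coordM !mxE; ring.
Qed.

(** The parameters of the law of a linear functional are read off from its first
    two moments: the mean is 0 and the variance is the quadratic form. *)
Lemma gaussian_vector_cos (u : 'cV[R]_d) (c : R) :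
  \int[P]_w cos (Z u w + c) = cos c * expR (- ((u^T *m Sigma *m u) 0 0 / 2)).
Proof.
have [m [s ms]] := gaussian_dotv u.
have qid : subquadratic (fun y : R => m + s * y).
  apply: subquadraticD; first exact: subquadratic_cst.
  by apply: subquadraticZ; exact: subquadratic_id.
have m0 : m = 0.
  have [_] := ms id (fun x => cvg_id) subquadratic_id.
  have qy := subquadraticZ s (@subquadratic_id R).
  rewrite (gED (subquadratic_cst m) qy) gE_cst (gEZ _ subquadratic_id) gE_id mulr0 addr0.
  move=> <-; under eq_Rintegral do rewrite /= dotvE.
  rewrite (Rintegral_lin _ _ (fun i => (integrable_coord i).1)).2.
  by under eq_bigr do rewrite integral_coord mulr0; rewrite big1.
have s2 : (u^T *m Sigma *m u) 0 0 = s ^+ 2.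
  rewrite -gaussian_cov_form.
  rewrite (ms (fun x => x ^+ 2) (@exprn_continuous _ 2) subquadratic_sqr).2 m0.
  under eq_fun do rewrite add0r exprMn.
  by rewrite (gEZ _ subquadratic_sqr) gE_sqr mulr1.
have ccos : continuous (fun x : R => cos (x + c)).
  move=> x; apply: continuous_comp; last exact: continuous_cos.
  by apply: cvgD; [exact: cvg_id|exact: cvg_cst].
have qcos : subquadratic (fun x : R => cos (x + c)).
  apply: (bounded_subquadratic (C := 1)); first exact: continuous_measurable_fun.
  by move=> y; rewrite ler_norml cos_le1 cos_geN1.
rewrite (ms _ ccos qcos).2 m0 s2 -gE_cos; congr gE; apply/funext => y.
by rewrite add0r addrC.
Qed.

Lemma covariance_psd : psdmx Sigma.
Proof.
split.
  apply/matrixP => i j; rewrite mxE -!integral_coordM.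
  by under eq_Rintegral do rewrite mulrC.
move=> u; rewrite -gaussian_cov_form; apply: Rintegral_ge0 => w _.
exact: sqr_ge0.
Qed.

End gaussian_vectors.

(** * Positive semidefinite forms as sums of squares *)

Section sums_of_squares.
Context {R : realType} {d : nat}.
Implicit Types (A : 'M[R]_d) (u v a : 'cV[R]_d).

Definition mxform A u v : R := (u^T *m A *m v) 0 0.

Lemma mxformC A u v : A^T = A -> mxform A u v = mxform A v u.
Proof.
move=> As; rewrite /mxform -[in RHS](mxE trmx_key (fun i j => (v^T *m A *m u) j i)) -/(trmx _).
by rewrite !trmx_mul trmxK As mulmxA.
Qed.

Lemma mxformDl A u v w : mxform A (u + v) w = mxform A u w + mxform A v w.
Proof. by rewrite /mxform linearD !mulmxDl mxE. Qed.

Lemma mxformDr A u v w : mxform A u (v + w) = mxform A u v + mxform A u w.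
Proof. by rewrite /mxform mulmxDr mxE. Qed.

Lemma mxformZl A (c : R) u v : mxform A (c *: u) v = c * mxform A u v.
Proof. by rewrite /mxform linearZ -!scalemxAl mxE. Qed.

Lemma mxformZr A (c : R) u v : mxform A u (c *: v) = c * mxform A u v.
Proof. by rewrite /mxform -scalemxAr mxE. Qed.

Lemma mxform_delta A i j : mxform A (delta_mx i 0) (delta_mx j 0) = A i j.
Proof. by rewrite /mxform trmx_delta -rowE -colE !mxE. Qed.

Lemma mxform_rank1 a u v : mxform (a *m a^T) u v = dotv u a * dotv v a.
Proof.
rewrite /mxform mulmxA -mulmxA mxE big_ord1 /dotv; congr (_ * _).
by rewrite -[RHS](mxE trmx_key (fun i j => (v^T *m a) j i)) -/(trmx _) trmx_mul trmxK.
Qed.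

Lemma psd_Cauchy_Schwarz A u v : psdmx A -> 0 < mxform A v v ->
  mxform A u v ^+ 2 / mxform A v v <= mxform A u u.
Proof.
move=> [As Ap] v0; have := Ap (u + (- (mxform A u v / mxform A v v)) *: v).
rewrite -/(mxform _ _ _) !mxformDl !mxformDr !mxformZl !mxformZr (mxformC v u As).
move: v0; move: (mxform A u u) (mxform A u v) (mxform A v v) => p q r r0 h.
rewrite -subr_ge0; apply: le_trans h _; rewrite le_eqVlt; apply/orP; left.
by apply/eqP; field; rewrite gt_eqF.
Qed.

Lemma psd_diag_ge0 A i : psdmx A -> 0 <= A i i.
Proof. by move=> [_ /(_ (delta_mx i 0))]; rewrite -/(mxform _ _ _) mxform_delta. Qed.

Lemma psd_diag0 A : psdmx A -> (forall i, A i i = 0) -> A = 0.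
Proof.
move=> [As Ap] A0; apply/matrixP => i j; rewrite !mxE.
have h (t : R) : 0 <= 2 * t * A i j.
  have := Ap (delta_mx i 0 + t *: delta_mx j 0).
  rewrite -/(mxform _ _ _) !mxformDl !mxformDr !mxformZl !mxformZr !mxform_delta !A0.
  have -> : A j i = A i j by rewrite -[in LHS]As mxE.
  by congr (_ <= _); ring.
by apply/eqP; have := h (- A i j); have := h (A i j); nra.
Qed.

(** Gaussian elimination. With e the i-th basis vector and A i i <> 0, subtracting
    the square of A e / sqrt (A i i) leaves a positive semidefinite form by the
    Cauchy-Schwarz inequality. It clears the i-th diagonal entry, and entries
    already 0 stay 0 because the diagonal cannot become negative. *)
Lemma psd_sum_squares A : psdmx A -> exists s : seq 'cV[R]_d,
  forall u, (u^T *m A *m u) 0 0 = \sum_(a <- s) dotv u a ^+ 2.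
Proof.
have [n] := ubnP #|[pred i | A i i != 0]|; elim: n A => // n IH A An pA.
have [i Ai|A0] := pickP (fun i => A i i != 0); last first.
  exists [::] => u; rewrite big_nil (psd_diag0 pA) ?mulmx0 ?mul0mx ?mxE// => i.
  by apply/eqP/negbFE/A0.
have Ai0 : 0 < A i i by rewrite lt_neqAle eq_sym Ai psd_diag_ge0.
pose e : 'cV[R]_d := delta_mx i 0.
pose a := (Num.sqrt (A i i))^-1 *: (A *m e).
have aE u : dotv u a ^+ 2 = mxform A u e ^+ 2 / A i i.
  rewrite /a dotvZr exprMn exprVn sqr_sqrtr ?ltW// mulrC.
  by rewrite /mxform -mulmxA.
have subE u : mxform (A - a *m a^T) u u = mxform A u u - dotv u a ^+ 2.
  rewrite {1}/mxform mulmxBr mulmxBl mxE [in X in _ + X]mxE.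
  by rewrite -!/(mxform _ _ _) mxform_rank1 -expr2.
have pB : psdmx (A - a *m a^T).
  split; first by rewrite linearB/= trmx_mul trmxK pA.1.
  move=> u; rewrite -/(mxform _ _ _) subE aE subr_ge0 -(mxform_delta A i i).
  by apply: psd_Cauchy_Schwarz => //; rewrite mxform_delta.
have Bdiag j : (A - a *m a^T) j j = A j j - dotv (delta_mx j 0) a ^+ 2.
  by rewrite -!mxform_delta subE.
have [s hs] : exists s : seq 'cV[R]_d,
    forall u, (u^T *m (A - a *m a^T) *m u) 0 0 = \sum_(b <- s) dotv u b ^+ 2.
  apply: IH => //; move: An; rewrite ltnS; apply: leq_trans; apply: proper_card.
  apply/properP; split; last first.
    exists i; rewrite !inE// negbK Bdiag aE mxform_delta.
    by rewrite expr2 mulfK// subrr.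
  apply/fintype.subsetP => j; rewrite !inE; apply: contra => /eqP Aj.
  have := psd_diag_ge0 j pB; rewrite Bdiag Aj sub0r oppr_ge0 => h.
  by rewrite oppr_eq0 eq_le h sqr_ge0.
exists (a :: s) => u; rewrite big_cons -hs -!/(mxform _ _ _) subE; ring.
Qed.

End sums_of_squares.

(** * Approximating the indicator of a convex set *)

Section soft_indicator.
Context {R : realType} {V : normedModType R}.
Variable K : set V.
Hypothesis K0 : K !=set0.

(** For closed K, steep enough to tend to minus infinity off K, yet of slope
    polynomial in n. *)
Definition ramp (n : nat) (x : V) : R := n%:R - n%:R ^+ 2 * infdist K x.

Lemma ramp_in n x : K x -> ramp n x = n%:R.
Proof. by move=> Kx; rewrite /ramp infdist_in// mulr0 subr0. Qed.

Lemma cvg_Phi_nat : Phi (n%:R : R) @[n --> \oo] --> (1 : R).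
Proof.
apply/cvgrPdist_lt => e e0; have [x hx] := @Phi_above R (1 - e) ltac:(lra).
exists (Num.truncn x).+1 => // n /= hn.
rewrite ger0_norm ?subr_ge0 ?(ltW (Phi_lt1 _))// ltrBlDr -ltrBlDl.
apply: (lt_le_trans hx); rewrite Phi_le.
by apply: ltW; apply: lt_le_trans (truncnS_gt _) _; rewrite ler_nat.
Qed.

Lemma cvg_Phi_ramp x : closed K -> Phi (ramp n x) @[n --> \oo] --> (\1_K x : R).
Proof.
move=> cK; rewrite indicE; case: (boolP (x \in K)); rewrite ?inE ?notin_setE => Kx.
  by under eq_fun do rewrite ramp_in//; exact: cvg_Phi_nat.
have d0 := infdist_gt0 K0 cK Kx; set d := infdist K x in d0.
apply/cvgrPdist_lt => e e0; have [y hy] := Phi_below e0.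
exists (Num.truncn (d^-1 * (1 + `|y|))).+1 => // n /= hn.
rewrite sub0r normrN ger0_norm ?(ltW (Phi_gt0 _))//.
apply: (le_lt_trans _ hy); rewrite Phi_le /ramp -/d.
have nd : 1 + `|y| <= n%:R * d.
  rewrite -ler_pdivrMr// mulrC; apply: ltW; apply: lt_le_trans (truncnS_gt _) _.
  by rewrite ler_nat.
have n1 : 1 <= n%:R :> R by rewrite ler1n (leq_trans _ hn).
have : - `|y| <= y by rewrite lerNl ler_normr lexx orbT.
apply: le_trans; have y0 := normr_ge0 y.
move: nd n1 y0; move: (n%:R : R) `|y|; clear => N Y; nra.
Qed.

End soft_indicator.

(** * The comparison of Gaussian vectors *)

Section gaussian_value.
Context {dT : measure_display} {T : measurableType dT} {R : realType}.
Context {P : probability T R} {d : nat}.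
Variables (X : {RV P >-> borel_cV R d}) (Sigma : 'M[R]_d) (s : seq 'cV[R]_d).
Hypotheses (gX : gaussian_vector X) (mX : mean_zero X).
Hypothesis cX : has_covariance_matrix X Sigma.
Hypothesis Ss : forall u, (u^T *m Sigma *m u) 0 0 = \sum_(a <- s) dotv u a ^+ 2.

(** X and the model built from s have the same trigonometric integrals. *)
Lemma integral_Phi_gavgs (N M : R) (h : 'cV[R]_d -> R) : capped_concave N M h ->
  \int[P]_w Phi (h (X w : 'cV[R]_d)) = Phi (gavgs s h 0).
Proof.
move=> ch; have [mu [muh muc]] := gaussian_model s.
have bh := bdd_Phi_capped ch.
rewrite -(muh _ _ _ ch) -(bdd_integral_distribution P X bh) /Rintegral; congr fine.
apply: eq_measure_integral => A mA _; apply: eq_prob_cos => // u c.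
have bc : bdd (fun x : borel_cV R d => cos (dotv u x + c)).
  by apply: bdd_trig; exists u, c.
rewrite muc [LHS](bdd_integral_distribution P X bc).
rewrite (gaussian_vector_cos gX mX cX) Ss.
by rewrite mulr_suml.
Qed.

End gaussian_value.

Lemma bdd_indic (dT : measure_display) (T : measurableType dT) (R : realType)
    (A : set T) : measurable A -> bdd (\1_A : T -> R).
Proof.
move=> mA; split; first exact: measurable_indic.
by exists 1 => x; rewrite indicE; case: (_ \in _); rewrite ?normr1 ?normr0.
Qed.

Lemma cvg_natV (R : realType) : (n%:R : R)^-1 @[n --> \oo] --> (0 : R).
Proof.
rewrite -cvg_shiftS; exact: cvg_harmonic.
Qed.

Theorem corollary2p2 (R : realType) (d : nat) (hd : (1 <= d)%N)
    (dX dY : measure_display)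
    (TX : measurableType dX) (TY : measurableType dY)
    (PX : probability TX R) (PY : probability TY R)
    (X : {RV PX >-> borel_cV R d}) (Y : {RV PY >-> borel_cV R d})
    (SigmaX SigmaY : 'M[R]_d)
    (gX : gaussian_vector X) (gY : gaussian_vector Y)
    (mX : mean_zero X) (mY : mean_zero Y)
    (cX : has_covariance_matrix X SigmaX)
    (cY : has_covariance_matrix Y SigmaY)
    (hSigma : psdmx (SigmaY - SigmaX))
    (K : set 'cV[R]_d) (closedK : closed K) (convexK : convex_set K) :
  ((2^-1)%:E <= PY (Y @^-1` K))%E ->
  (PY (Y @^-1` K) <= PX (X @^-1` K))%E.
Proof.
move=> half.
have mK : measurable (K : set (borel_cV R d)) by exact: closed_measurable_cV.
have mYK : measurable (Y @^-1` K).
  by rewrite -[X in measurable X]setTI; exact: measurable_funPT.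
have mXK : measurable (X @^-1` K).
  by rewrite -[X in measurable X]setTI; exact: measurable_funPT.
have K0 : K !=set0.
  apply/set0P/eqP => K0; move: half; rewrite K0 preimage_set0 measure0 lee_fin.
  by rewrite leNgt invr_gt0 ltr0n.
pose py := fine (PY (Y @^-1` K)); pose px := fine (PX (X @^-1` K)).
have pyE : PY (Y @^-1` K) = py%:E by rewrite /py fineK// fin_num_measure.
have pxE : PX (X @^-1` K) = px%:E by rewrite /px fineK// fin_num_measure.
move: half; rewrite pyE pxE !lee_fin => half.
have [bs diff_form] := psd_sum_squares hSigma.
have [sX sX_form] := psd_sum_squares (covariance_psd gX mX cX).
have hY u : (u^T *m SigmaY *m u) 0 0 = \sum_(a <- bs ++ sX) dotv u a ^+ 2.
  rewrite big_cat -diff_form -sX_form /= -[X in _ = X + _]/(mxform _ u u).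
  by rewrite /mxform mulmxBr mulmxBl [in RHS]mxE [X in _ = _ + X + _]mxE subrK.
have ramp_capped n : capped_concave (n%:R ^+ 2) n%:R (ramp K n).
  by apply: capped_concave_infdist => //; rewrite sqr_ge0.
pose HX n := gavgs sX (ramp K n) 0.
pose HY n := gavgs bs (gavgs sX (ramp K n)) 0.
have EX n : \int[PX]_w Phi (ramp K n (X w : 'cV[R]_d)) = Phi (HX n).
  by rewrite (integral_Phi_gavgs gX mX cX sX_form (ramp_capped n)).
have EY n : \int[PY]_w Phi (ramp K n (Y w : 'cV[R]_d)) = Phi (HY n).
  rewrite (integral_Phi_gavgs gY mY cY hY (ramp_capped n)).
  by rewrite /HY /gavgs foldr_cat.
have EYK : \int[PY]_w \1_(Y @^-1` K) w = py.
  by rewrite /Rintegral integral_indic// setIT.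
have EXK : \int[PX]_w \1_(X @^-1` K) w = px.
  by rewrite /Rintegral integral_indic// setIT.
(* ramp K n equals n on K *)
have PhiY n : Phi n%:R * py <= Phi (HY n).
  rewrite -EY -EYK -bdd_integralZ; last exact: bdd_indic.
  apply: le_integral_bdd; first by apply: bddM; [exact: bdd_cst|exact: bdd_indic].
    exact: (bdd_comp (measurable_funPT Y) (bdd_Phi_capped (ramp_capped n))).
  move=> w; rewrite indicE; case: (boolP (w \in _)); rewrite ?inE => hw.
    by rewrite mulr1 ramp_in.
  by rewrite mulr0 ltW// Phi_gt0.
have [A hA] := @prod_expR_decay R [seq `|b| | b <- bs]
  ltac:(by move=> b /mapP[c _ ->]).
(* the hypothesis gives Phi (HY n) >= Phi n / 2, so the deficit in level_loss
   is the normal tail 1 - Phi n *)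
have lossY n : (0 < n)%N ->
    Phi n%:R * py - expR 1 * A / (2 * normal_pdf 0 1 1) / n%:R <= Phi (HX n).
  move=> n0; pose C := \prod_(b <- bs) (1 + n%:R ^+ 2 * `|b|).
  have C1 : 1 <= C.
    apply: (big_ind (fun x => 1 <= x)) => // [x y|b _]; first exact: mulr_ege1.
    by rewrite lerDl mulr_ge0// sqr_ge0.
  have q0 : 0 <= 1 - Phi (n%:R : R) by rewrite subr_ge0 ltW// Phi_lt1.
  have minH : Num.min (HY n) (C * HY n) <= HX n.
    exact: (gavgs_compare bs 0 (capped_concave_gavgs sX (ramp_capped n))).
  have hq : 1 - (1 - Phi (n%:R : R)) <= Phi (HY n) *+ 2.
    move: half (PhiY n) (Phi_gt0 (n%:R : R)).
    by move: (Phi n%:R) (Phi (HY n)) (py) => a b p; clear; nra.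
  apply: le_trans (level_loss C1 minH hq q0); apply: lerB; first exact: PhiY.
  rewrite [leRHS]mulrAC; apply: ler_wpM2r.
    by rewrite invr_ge0 mulr_ge0// (ltW (phi_gt0 _)).
  apply: (@le_trans _ _ (C * expR (1 - n%:R))).
    by apply: ler_wpM2l; [exact: le_trans ler01 C1|exact: normal_tail].
  rewrite expRD mulrCA -mulrA; apply: ler_wpM2l; first exact: expR_ge0.
  by have := hA n n0; rewrite big_map.
have limX : Phi (HX n) @[n --> \oo] --> px.
  rewrite -EXK; under eq_fun do rewrite -EX.
  apply: (@bdd_cvg_integral _ _ _ PX _ _ 1).
  - by move=> n; case: (bdd_comp (measurable_funPT X) (bdd_Phi_capped (ramp_capped n))).
  - by move=> n w; rewrite ger0_norm ltW// ?Phi_lt1// Phi_gt0.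
  - by move=> w; exact: cvg_Phi_ramp.
have limY : Phi n%:R * py - expR 1 * A / (2 * normal_pdf 0 1 1) / n%:R @[n --> \oo] --> py.
  rewrite -[X in _ --> X]subr0 -[X in _ --> X - _]mul1r.
  apply: cvgB; first by apply: cvgMl; exact: cvg_Phi_nat.
  rewrite -[X in _ --> X](mulr0 (expR 1 * A / (2 * normal_pdf 0 1 1))).
  apply: cvgMr; exact: cvg_natV.
apply: (ler_cvg_to limY limX).
by exists 1%N => // n /= n0; exact: lossY.
Qed.
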